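(* Assume that $q^-<\varphi^-_{\min}$. Then there exists $\lambda_*>0$ such that every $\lambda\in(0,\lambda_* )$ is an eigenvalue of Problem $(P_a)$; that is, for every $\lambda\in(0,\lambda_* )$ there exists $u\in W\setminus\{0\}$ such that $$\int_{Q}\sum_{i=1}^{N}a_i(|D^{s}u|)\,D^{s}u\,D^{s}v\,d\mu=\lambda\int_{\Omega}|u|^{q(x)-2}uv\,dx\qquad\text{for all } v\in W.$$
   Context: Let $N\ge 1$, $0<s<1$, and let $\Omega\subset\mathbb{R}^N$ be a bounded open set with Lipschitz ($C^{0,1}$) boundary. Let $q\in C(\overline{\Omega})$ with $q(x)>1$ for all $x\in\overline\Omega$; $q^-=\inf_{\overline\Omega}q$, $q^+=\sup_{\overline\Omega}q$. For $i=1,\dots,N$ let $a_i:\mathbb{R}\to\mathbb{R}$ be such that $\varphi_i(t)=a_i(|t|)t$ for $t\ne0$, $\varphi_i(0)=0$, is an increasing homeomorphism of $\mathbb{R}$ onto itself, and let $\Phi_i(t)=\int_0^t\varphi_i(\tau)\,d\tau$. Standing assumptions, for every $i$: (a) $1<\varphi_i^-:=\inf_{t>0}\frac{t\varphi_i(t)}{\Phi_i(t)}\le\varphi_i^+:=\sup_{t>0}\frac{t\varphi_i(t)}{\Phi_i(t)}<+\infty$; (b) $t\mapsto\Phi_i(\sqrt t)$ is convex on $[0,\infty)$. Moreover there is $j\in\{1,\dots,N\}$ such that (c) $\int_0^1\frac{\Phi_j^{-1}(\tau)}{\tau^{(N+s)/N}}d\tau<\infty$ and $\int_1^\infty\frac{\Phi_j^{-1}(\tau)}{\tau^{(N+s)/N}}d\tau=\infty$;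 (d) with $(\Phi_j)_*$ defined through its inverse $(\Phi_j)_*^{-1}(t)=\int_0^t\frac{\Phi_j^{-1}(\tau)}{\tau^{(N+s)/N}}d\tau$, one has $\lim_{t\to\infty}\frac{t^{q^+}}{(\Phi_j)_*(kt)}=0$ for all $k>0$. Put $\varphi^-_{\min}=\min_i\varphi_i^-$. Let $Q=\mathbb{R}^{2N}\setminus\big((\mathbb{R}^N\setminus\Omega)\times(\mathbb{R}^N\setminus\Omega)\big)$, $D^su=D^su(x,y)=\frac{u(x)-u(y)}{|x-y|^s}$, $d\mu=\frac{dx\,dy}{|x-y|^N}$. For $u:\mathbb{R}^N\to\mathbb{R}$ measurable, $[u]_i=\inf\{\lambda>0:\int_Q\Phi_i(|D^su|/\lambda)\,d\mu\le1\}$. The fractional anisotropic Orlicz–Sobolev space $W=W_0^sL_{\overrightarrow{\Phi}}(Q)$ is the closure of $C_0^\infty(\Omega)$ (functions extended by $0$ to $\mathbb{R}^N$) with respect to the norm $\|u\|_{\overrightarrow{\Phi}}=\sum_{i=1}^N[u]_i$. The expression $a_i(|t|)t$ is read as $\varphi_i(t)$, so it is $0$ at $t=0$. Problem $(P_a)$ is: $\sum_{i=1}^N(-\Delta)^s_{a_i(\cdot)}u=\lambda|u|^{q(x)-2}u$ in $\Omega$, $u=0$ in $\mathbb{R}^N\setminus\Omega$, where $(-\Delta)^s_{a_i(\cdot)}u(x)=2\lim_{\varepsilon\searrow0}\int_{\mathbb{R}^N\setminus B_\varepsilon(x)}a_i\big(\tfrac{|u(x)-u(y)|}{|x-y|^s}\big)\tfrac{u(x)-u(y)}{|x-y|^s}\tfrac{dy}{|x-y|^{N+s}}$;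 eigenvalues are understood in the weak sense written in the claim. *)

(* Defs.v *)
From HB Require Import structures.
From mathcomp Require Import all_boot all_order all_algebra.
From mathcomp Require Import all_classical all_reals all_analysis.

Set Implicit Arguments.
Unset Strict Implicit.
Unset Printing Implicit Defensive.

Import Order.TTheory GRing.Theory Num.Theory.
Import numFieldNormedType.Exports.

Local Open Scope classical_set_scope.
Local Open Scope ring_scope.

(* The Borel sigma-algebra of R^n, generated by the coordinate functions. *)
Definition measure_rV_display : measure_display. Proof. exact: default_measure_display. Qed.

Section measurable_rV.
Variables (R : realType) (n : nat).

Let coord (i : 'I_n) (x : 'rV[R]_n) : measurableTypeR R := x ord0 i.

Let rV_set0 : g_sigma_preimage coord set0.
Proof. exact: sigma_algebra0. Qed.

Let rV_setC A : g_sigma_preimage coord A -> g_sigma_preimage coord (~` A).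
Proof. exact: sigma_algebraC. Qed.

Let rV_bigcup (F : _^nat) : (forall i, g_sigma_preimage coord (F i)) ->
  g_sigma_preimage coord (\bigcup_i (F i)).
Proof. exact: sigma_algebra_bigcup. Qed.

HB.instance Definition _ := @isMeasurable.Build measure_rV_display
  'rV[R]_n (g_sigma_preimage coord) rV_set0 rV_setC rV_bigcup.

Lemma measurable_coord (i : 'I_n) :
  measurable_fun [set: 'rV[R]_n] (fun x : 'rV[R]_n => x ord0 i : measurableTypeR R).
Proof.
move=> _ Y mY; rewrite setTI; apply: sub_sigma_algebra => /=.
rewrite -bigcup_seq/=; exists i => /=; first by rewrite mem_index_enum.
by exists Y => //; rewrite setTI.
Qed.

Lemma measurable_fun_rV d (T : measurableType d) (f : T -> 'rV[R]_n) :
  (forall i, measurable_fun [set: T] (fun t => f t ord0 i : measurableTypeR R)) ->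
  measurable_fun [set: T] f.
Proof.
move=> mf; apply: (@measurability _ _ _ _ setT f
   (\big[setU/set0]_(i < n) preimage_set_system setT (coord i) measurable)) => //.
move=> _ [B + <-]; rewrite -bigcup_seq => -[i _ [C mC <-]].
by rewrite !setTI -comp_preimage -[X in measurable X]setTI; exact: mf.
Qed.

End measurable_rV.

Section lebesgue_step.
Variables (R : realType) (n : nat).

Definition rV_cons (p : measurableTypeR R * 'rV[R]_n) : 'rV[R]_n.+1 :=
  \row_i oapp (p.2 ord0) (p.1 : R) (unlift ord0 i).

Definition rV_uncons (x : 'rV[R]_n.+1) : measurableTypeR R * 'rV[R]_n :=
  (x ord0 ord0, \row_j x ord0 (lift ord0 j)).

Lemma rV_consK : cancel rV_cons rV_uncons.
Proof.
case=> a x; rewrite /rV_uncons mxE unlift_none /=; congr pair.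
by apply/rowP => j; rewrite !mxE liftK.
Qed.

Lemma measurable_rV_cons : measurable_fun setT rV_cons.
Proof.
apply: measurable_fun_rV => i; case: (unliftP ord0 i) => [j ->|->].
  rewrite (_ : (fun _ => _) = (fun x : 'rV[R]_n => x ord0 j) \o snd).
    by apply: measurableT_comp => //; exact: measurable_coord.
  by apply/funext => p; rewrite /= mxE liftK.
rewrite (_ : (fun _ => _) = fst) //.
by apply/funext => p; rewrite /= mxE unlift_none.
Qed.

Lemma measurable_rV_uncons : measurable_fun setT rV_uncons.
Proof.
apply/measurable_fun_pairP; split; first exact: measurable_coord.
apply: measurable_fun_rV => i.
rewrite (_ : (fun _ => _) = (fun x : 'rV[R]_n.+1 => x ord0 (lift ord0 i))).
  exact: measurable_coord.
by apply/funext => x; rewrite /= mxE.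
Qed.

Variable m : {sigma_finite_measure set 'rV[R]_n -> \bar R}.

Local Open Scope ereal_scope.

Definition lebesgue_step : set 'rV[R]_n.+1 -> \bar R :=
  pushforward (lebesgue_measure \x m) rV_cons.

Let mcons A : measurable A -> measurable (rV_cons @^-1` A).
Proof. by move=> mA; rewrite -[X in measurable X]setTI; exact: measurable_rV_cons. Qed.

Let step0 : lebesgue_step set0 = 0.
Proof. by rewrite /lebesgue_step /pushforward preimage_set0 measure0. Qed.

Let step_ge0 A : 0 <= lebesgue_step A.
Proof. by rewrite /lebesgue_step /pushforward; exact: measure_ge0. Qed.

Let step_sigma_additive : semi_sigma_additive lebesgue_step.
Proof.
move=> F mF tF mUF; rewrite /lebesgue_step /pushforward preimage_bigcup.
apply: measure_semi_sigma_additive.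
- by move=> k; exact: mcons.
- apply/trivIsetP => /= i j _ _ ij; rewrite -preimage_setI.
  by move/trivIsetP : tF => /(_ _ _ _ _ ij) ->//; rewrite preimage_set0.
- by rewrite -preimage_bigcup; exact: mcons.
Qed.

HB.instance Definition _ := isMeasure.Build _ _ _ lebesgue_step
  step0 step_ge0 step_sigma_additive.

Let prod_sigma_finite : sigma_finite setT (@lebesgue_measure R \x m).
Proof.
have /sigma_finiteP[F [TF ndF Foo]] := sigma_finiteT (@lebesgue_measure R).
have /sigma_finiteP[G [TG ndG Goo]] := sigma_finiteT m.
exists (fun k => F k `*` G k) => [|k].
  rewrite -setXTT TF TG predeqE => -[x y]; split.
    move=> [/= [k _ Fkx] [l _ Gly]]; exists (maxn k l) => //; split.
    - by move: x Fkx; exact/subsetPset/ndF/leq_maxl.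
    - by move: y Gly; exact/subsetPset/ndG/leq_maxr.
  by move=> [k _ []/= ? ?]; split; exists k.
have [? ?] := Foo k; have [? ?] := Goo k.
split; first exact: measurableX.
by rewrite product_measure1E// lte_mul_pinfty// ge0_fin_numE.
Qed.

Let step_sigma_finite : sigma_finite setT lebesgue_step.
Proof.
have [F TF Foo] := prod_sigma_finite.
exists (fun k => rV_uncons @^-1` F k).
  by rewrite -preimage_bigcup -TF preimage_setT.
move=> k; have [mF Fk] := Foo k; split.
  by rewrite -[X in measurable X]setTI; exact: measurable_rV_uncons.
rewrite /lebesgue_step /pushforward -comp_preimage.
by rewrite (_ : _ \o _ = id) //; apply/funext => p; exact: rV_consK.
Qed.

HB.instance Definition _ := Measure_isSigmaFinite.Build _ _ _ lebesgue_step
  step_sigma_finite.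

End lebesgue_step.

Fixpoint lebesgue_rV (R : realType) (n : nat) :
    {sigma_finite_measure set 'rV[R]_n -> \bar R} :=
  match n with
  | 0 => \d_(0 : 'rV[R]_0)
  | n'.+1 => lebesgue_step (lebesgue_rV R n')
  end.

Lemma lebesgue_rV_box (R : realType) (n : nat)
    (A : 'I_n -> set (measurableTypeR R)) :
  (forall i, measurable (A i)) ->
  lebesgue_rV R n [set x | forall i, A i (x ord0 i)] =
  (\prod_(i < n) lebesgue_measure (A i))%E.
Proof.
elim: n A => [|n IH] A mA.
  rewrite big_ord0 /= diracE mem_set // => -[]//.
rewrite big_ord_recl -(IH (fun i => A (lift ord0 i))) //.
have mB : measurable [set x : 'rV[R]_n | forall i, A (lift ord0 i) (x ord0 i)].
  rewrite (_ : mkset _ = \bigcap_(i in [set: 'I_n])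
      (fun x : 'rV[R]_n => x ord0 i : measurableTypeR R) @^-1` A (lift ord0 i)).
    apply: fin_bigcap_measurable => // i _.
    by rewrite -[X in measurable X]setTI; exact: measurable_coord.
  by apply/seteqP; split => x /= Ax i; [move=> _|]; exact: Ax.
rewrite -product_measure1E //.
rewrite /= /lebesgue_step /pushforward; congr ((_ \x _)%E _).
apply/seteqP; split => -[a x] /=.
  by move=> Aax; split=> [|i]; [move: (Aax ord0)|move: (Aax (lift ord0 i))];
     rewrite mxE ?unlift_none ?liftK.
by move=> [Aa Ax] i; case: (unliftP ord0 i) => [j ->|->];
   rewrite mxE ?unlift_none ?liftK //=; exact: Ax.
Qed.

(* The norm carried by 'rV[R]_n in the library is the sup norm. *)
Definition enorm (R : realType) (n : nat) (x : 'rV[R]_n) : R :=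
  Num.sqrt (\sum_(i < n) x ord0 i ^+ 2).

(* Near each boundary point, in suitable orthonormal coordinates, Omega is the
   strict epigraph of a Lipschitz function of the N-1 other coordinates. *)
Definition lipschitz_boundary (R : realType) (N : nat)
    (Omega : set 'rV[R]_N) : Prop :=
  forall p, (closure Omega `\` interior Omega) p ->
  exists (A : 'M[R]_N) (k : 'I_N) (gamma : 'rV[R]_N.-1 -> R) (r : R),
    [/\ A *m A^T = 1%:M, lipschitz gamma, 0 < r &
        forall x, enorm (x - p) < r ->
          (Omega x <-> gamma (col' k (x *m A)) < (x *m A) ord0 k)].

Section test_functions.
Variables (R : realType) (N : nat).

Definition partial (i : 'I_N) (f : 'rV[R]_N -> R) : 'rV[R]_N -> R :=
  fun x => 'D_(delta_mx ord0 i) f x.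

Fixpoint class_C (k : nat) (f : 'rV[R]_N -> R) : Prop :=
  if k is k'.+1 then
    continuous f /\ forall i,
      (forall x, derivable f x (delta_mx ord0 i)) /\ class_C k' (partial i f)
  else continuous f.

Definition C0infty (Omega : set 'rV[R]_N) (f : 'rV[R]_N -> R) : Prop :=
  [/\ forall k, class_C k f,
      compact (closure [set x | f x != 0]) &
      closure [set x | f x != 0] `<=` Omega].

End test_functions.

Section orlicz.
Variable R : realType.
Implicit Types (a : R -> R) (s : R) (N : nat).

(* Since a `|0| is multiplied by 0, phi a 0 = 0 whatever the value of a at 0. *)
Definition phi a (t : R) : R := a `|t| * t.

Definition increasing_homeomorphism (f : R -> R) : Prop :=
  {homo f : x y / x < y} /\ continuous f /\
  exists g : R -> R, [/\ cancel f g, cancel g f & continuous g].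

Definition Phi a (t : R) : R :=
  if 0 <= t then \int[lebesgue_measure]_(x in `[0, t]) phi a x
  else - \int[lebesgue_measure]_(x in `[t, 0]) phi a x.

Definition phi_minus a : \bar R :=
  ereal_inf [set (t * phi a t / Phi a t)%:E | t in [set t | 0 < t]].

Definition phi_plus a : \bar R :=
  ereal_sup [set (t * phi a t / Phi a t)%:E | t in [set t | 0 < t]].

Definition Phi_inv a : R -> R := 'pinv_(fun=> 0) [set t : R | 0 <= t] (Phi a).

(* Phi^-1(tau) / tau^((N+s)/N) *)
Definition sobolev_integrand N s a (tau : R) : R :=
  Phi_inv a tau / tau `^ ((N%:R + s) / N%:R).

Definition Phi_star_inv N s a (t : R) : R :=
  \int[lebesgue_measure]_(tau in `]0, t]) sobolev_integrand N s a tau.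

Definition Phi_star N s a : R -> R :=
  'pinv_(fun=> 0) [set t : R | 0 <= t] (Phi_star_inv N s a).

Section space.
Variables (N : nat) (s : R) (Omega : set 'rV[R]_N).
Local Notation leb := (lebesgue_rV R N).

Definition QOmega : set ('rV[R]_N * 'rV[R]_N) := ~` ((~` Omega) `*` (~` Omega)).

Definition Ds (u : 'rV[R]_N -> R) (z : 'rV[R]_N * 'rV[R]_N) : R :=
  (u z.1 - u z.2) / enorm (z.1 - z.2) `^ s.

(* Density of mu with respect to Lebesgue measure. For N > 0 its value on the
   diagonal, a null set, is 0. *)
Definition mu_density (z : 'rV[R]_N * 'rV[R]_N) : R :=
  (enorm (z.1 - z.2) ^+ N)^-1.

Local Open Scope ereal_scope.

Definition modular a (u : 'rV[R]_N -> R) (l : R) : \bar R :=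
  \int[leb \x leb]_(z in QOmega) (Phi a (`|Ds u z| / l) * mu_density z)%:E.

Definition seminorm a (u : 'rV[R]_N -> R) : \bar R :=
  ereal_inf [set l%:E | l in [set l : R | (0 < l)%R /\ modular a u l <= 1]].

Definition orlicz_norm (a : 'I_N -> R -> R) (u : 'rV[R]_N -> R) : \bar R :=
  \sum_(i < N) seminorm (a i) u.

(* Elements of the space are represented by functions, not by classes.
   orlicz_norm vanishes on constants, so the closure is taken among the
   measurable functions that vanish a.e. outside Omega, where it is a norm. *)
Definition W0 (a : 'I_N -> R -> R) : set ('rV[R]_N -> R) :=
  [set u : 'rV[R]_N -> R | [/\ measurable_fun setT u,
               {ae leb, forall x, ~ Omega x -> u x = 0%R} &
               forall e : R, (0 < e)%R ->
                 exists2 f, C0infty Omega f & orlicz_norm a (u \- f)%R < e%:E]].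

Definition lhs_integrand (a : 'I_N -> R -> R) (u v : 'rV[R]_N -> R)
    (z : 'rV[R]_N * 'rV[R]_N) : R :=
  (\sum_(i < N) phi (a i) (Ds u z) * Ds v z * mu_density z)%R.

Definition rhs_integrand (q u v : 'rV[R]_N -> R) (x : 'rV[R]_N) : R :=
  (`|u x| `^ (q x - 2) * u x * v x)%R.

(* The integrability clause says that both integrals make sense; without it the
   library's convention for divergent integrals would be used. *)
Definition weak_eigenvalue (a : 'I_N -> R -> R) (q : 'rV[R]_N -> R) (lambda : R) : Prop :=
  exists u : 'rV[R]_N -> R, [/\ W0 a u, ~ {ae leb, forall x, u x = 0%R} &
    forall v, W0 a v ->
      [/\ (leb \x leb).-integrable QOmega (EFin \o lhs_integrand a u v),
          leb.-integrable Omega (EFin \o rhs_integrand q u v) &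
          \int[leb \x leb]_(z in QOmega) (lhs_integrand a u v z)%:E =
          lambda%:E * \int[leb]_(x in Omega) (rhs_integrand q u v x)%:E]].

Definition q_minus (q : 'rV[R]_N -> R) : \bar R :=
  ereal_inf [set (q x)%:E | x in closure Omega].

Definition q_plus (q : 'rV[R]_N -> R) : \bar R :=
  ereal_sup [set (q x)%:E | x in closure Omega].

End space.
End orlicz.

(* Main.v *)
Require Import Defs.
From mathcomp Require Import all_boot all_order all_algebra.
From mathcomp Require Import all_classical all_reals all_analysis.
From mathcomp Require Import measurable_realfun ring lra zify.
Import Order.TTheory GRing.Theory Num.Theory.
Import numFieldNormedType.Exports.
Local Open Scope classical_set_scope.
Local Open Scope ring_scope.
Set Implicit Arguments.
Unset Strict Implicit.
Unset Printing Implicit Defensive.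

(** All the operators act on the same quotient [Ds u], so they add up to a single
    one, driven by the even convex function [Psi = \sum_i Phi (a i)] with
    derivative [psi = \sum_i phi (a i)].  An eigenfunction for lambda is a
    critical point of [J u = E u - lambda * K u], where the energy [E u] is the
    integral of [Psi (Ds u)] over Q and [K u] is the integral of [|u|^q / q]
    over Omega.  Such a point is found by minimising J over the ball [E u <= 1].

    On that ball K is bounded by some constant C, so for [lambda < 1 / C] the
    functional is positive where [E u = 1].  Near a point where q is smaller
    than all the lower indices, there is a smooth bump f with
    [E (t f) = O(t^p0)] and [K (t f) >= c t^q2], where [q2 < p0]; hence J takes
    negative values ([small_multiple]).  A minimiser is therefore nonzero and
    satisfies [E u < 1], so it may be perturbed in every direction of the space,
    and the first variation gives the equation ([weak_solution]).

    Boundedness of K is a Sobolev embedding.  The hypothesis on the conjugate function only enters through the growth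
    [Psi w >= A w^(1/sg)] for large w, with [sg = 1/q+ + s/N] and q+ the
    supremum of the exponent ([Phi_growth]).
    If [|u x| = t] is large, then in a box of volume comparable to
    [int |u|^q+ / t^q+] around x the function is at most t/2 on half of the box,
    so the part of the energy carried by the fiber over x is large; integrating
    over x bounds [int |u|^q+] ([sobolev]), and since A is arbitrary, the same
    computation shows that [|u|^q+] is uniformly integrable.  Comparing u with
    its averages on a fine grid of boxes gives compactness in L1
    ([L1_compact]); with uniform integrability, K is then continuous along
    L1-Cauchy sequences of bounded energy ([incr_small]).

    The minimiser is obtained without weak topologies.  The convexity of
    [t |-> Phi (sqrt t)] yields the Clarkson inequality
    [E ((u+v)/2) + E ((u-v)/2) <= (E u + E v) / 2].  Along a minimising sequence
    that is Cauchy in L1 the midpoints are almost minimal too, so the sequence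
    is Cauchy in energy ([Jf_clarkson]); its limit stays in the closure of the
    test functions and attains the infimum by Fatou's lemma ([minimizer]).

    The space enters only through a few closure properties, which hold because
    smallness of the Luxemburg norm and smallness of the energy are equivalent
    ([W0_energy]), and because test functions have finite energy
    ([C0infty_energy]). *)

(** * Young functions and their indices *)

Lemma powRDp (R : realType) (x r s : R) : 0 < x -> x `^ (r + s) = x `^ r * x `^ s.
Proof. by move=> x0; rewrite powRD// lt0r_neq0 ?implybT. Qed.

Lemma powR_divN (R : realType) (x y p : R) : 0 < x -> 0 < y ->
  (x / y) `^ p = x `^ p * y `^ (- p).
Proof.
move=> x0 y0; rewrite powRM ?invr_ge0 ?ltW// -powR_inv1 ?ltW//.
by rewrite -powRrM mulN1r.
Qed.

Section PhiFacts.
Variables (R : realType) (a : R -> R).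
Hypothesis homeo : increasing_homeomorphism (phi a).
Notation mu := (@lebesgue_measure R).

Lemma phiN t : phi a (- t) = - phi a t.
Proof. by rewrite /phi normrN mulrN. Qed.

Lemma phi_at0 : phi a 0 = 0.
Proof. by rewrite /phi mulr0. Qed.

Lemma phi_lt x y : x < y -> phi a x < phi a y.
Proof. by case: homeo => + _; exact. Qed.

Lemma phi_le x y : x <= y -> phi a x <= phi a y.
Proof. by rewrite le_eqVlt => /predU1P[->//|/phi_lt/ltW]. Qed.

Lemma phi_continuous : continuous (phi a).
Proof. by case: homeo => _ []. Qed.

Lemma phi_gt0 t : 0 < t -> 0 < phi a t.
Proof. by move=> t0; rewrite -phi_at0 phi_lt. Qed.

Lemma PhiE t : 0 <= t -> Phi a t = parameterized_integral mu 0 t (phi a).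
Proof. by move=> t0; rewrite /Phi t0. Qed.

Lemma Phi_at0 : Phi a 0 = 0.
Proof. by rewrite /Phi lexx set_itv1 Rintegral_set1. Qed.

Lemma phi_integrable b : mu.-integrable `[0, b] (EFin \o phi a).
Proof.
apply: continuous_compact_integrable; first exact: segment_compact.
by apply: continuous_subspaceT; exact: phi_continuous.
Qed.

Lemma Phi_derive (t : R) : 0 < t -> is_derive t 1 (Phi a) (phi a t).
Proof.
move=> t0.
have [||||d1 d2] := @continuous_FTC1_closed R (phi a) 0 t (t + 1).
- by rewrite ltrDl.
- exact: phi_integrable.
- exact: t0.
- exact: phi_continuous.
have E : {near t, parameterized_integral mu 0 ^~ (phi a) =1 Phi a}.
  by near=> y; rewrite PhiE//; apply: ltW; near: y; exact: lt_nbhsr.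
have dP : is_derive t 1 (parameterized_integral mu 0 ^~ (phi a)) (phi a t).
  by split; [exact: d1|rewrite -derive1E; exact: d2].
by apply: near_eq_is_derive dP.
Unshelve. all: by end_near. Qed.

Lemma Phi_within b : 0 <= b -> {within `[0, b], continuous (Phi a)}.
Proof.
move=> b0; have := parameterized_integral_continuous b0 (phi_integrable b).
apply: subspace_eq_continuous => x.
by rewrite inE /= in_itv /= => /andP[x0 _]; rewrite [RHS]PhiE.
Qed.

Lemma Phi_mvt x y : 0 <= x -> x < y ->
  exists2 c, x < c < y & Phi a y - Phi a x = phi a c * (y - x).
Proof.
move=> x0 xy.
have [||c + ->] := @MVT R (Phi a) (phi a) x y xy.
- move=> z; rewrite in_itv /= => /andP[xz _].
  by apply: Phi_derive; exact: le_lt_trans xz.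
- apply: continuous_subspaceW (Phi_within (ltW (le_lt_trans x0 xy))).
  by apply: subset_itvr; rewrite bnd_simp.
by rewrite in_itv /=; exists c.
Qed.

Lemma Phi_lt x y : 0 <= x -> x < y -> Phi a x < Phi a y.
Proof.
move=> x0 xy; have [c /andP[xc cy] e] := Phi_mvt x0 xy.
by rewrite -subr_gt0 e mulr_gt0 ?subr_gt0// phi_gt0// (le_lt_trans x0).
Qed.

Lemma Phi_le x y : 0 <= x -> x <= y -> Phi a x <= Phi a y.
Proof. by move=> x0; rewrite le_eqVlt => /predU1P[->//|/(Phi_lt x0)/ltW]. Qed.

Lemma Phi_ge0 t : 0 <= t -> 0 <= Phi a t.
Proof. by move=> t0; rewrite -Phi_at0 Phi_le. Qed.

Lemma Phi_gt0 t : 0 < t -> 0 < Phi a t.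
Proof. by move=> t0; rewrite -Phi_at0 Phi_lt. Qed.

(** The mean value theorem and the monotonicity of [phi]: [Phi] lies above its
    tangents. *)
Lemma Phi_grad_nng x y : 0 <= x -> 0 <= y -> phi a x * (y - x) <= Phi a y - Phi a x.
Proof.
move=> x0 y0; have [xy|yx|->] := ltgtP x y; last by rewrite !subrr mulr0.
  have [c /andP[xc cy] ->] := Phi_mvt x0 xy.
  by rewrite ler_wpM2r ?subr_ge0 ?(ltW xy)// phi_le// ltW.
have [c /andP[xc cy] e] := Phi_mvt y0 yx.
rewrite -[leRHS]opprB e -mulrN opprB.
by rewrite ler_wnM2r ?subr_le0 ?(ltW yx)// phi_le// ltW.
Qed.

(** Evenness extends the tangent inequality to all arguments; the quotients [Ds]
    change sign. *)
Lemma Phi_abs_grad x y : phi a x * (y - x) <= Phi a `|y| - Phi a `|x|.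
Proof.
wlog x0 : x y / 0 <= x => [H|].
  have [/H//|/ltW x0] := leP 0 x.
  have := H (- x) (- y); rewrite oppr_ge0 x0 !normrN phiN => /(_ isT).
  by apply: le_trans; rewrite mulNr -mulrN opprB opprK addrC.
have := Phi_grad_nng x0 (normr_ge0 y); rewrite (ger0_norm x0).
apply: le_trans; rewrite ler_wpM2l ?lerB ?ler_norm//.
by rewrite -phi_at0 phi_le.
Qed.

(** The tangent at 1. *)
Lemma Phi_unbounded t : 1 <= t -> t * phi a 1 <= Phi a t + phi a 1.
Proof.
move=> t1; have := @Phi_grad_nng 1 t ler01 (le_trans ler01 t1).
have := Phi_ge0 ler01; set A := phi a 1; set B := Phi a t; set C := Phi a 1.
by move=> h1 h2; nra.
Qed.

Lemma Phi_surj y : 0 <= y -> exists2 t, 0 <= t & Phi a t = y.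
Proof.
move=> y0; pose b := 1 + y / phi a 1.
have p0 : 0 < phi a 1 by exact: phi_gt0.
have b1 : 1 <= b by rewrite lerDl divr_ge0// ltW.
have b0 : 0 <= b by exact: le_trans b1.
have yb : y <= Phi a b.
  have := Phi_unbounded b1; rewrite /b mulrDl mul1r divfK ?gt_eqF//; lra.
have [|t] := @IVT R (Phi a) 0 b y b0 (Phi_within b0).
  by rewrite Phi_at0 min_l ?max_r ?y0 ?yb ?Phi_ge0.
by rewrite in_itv /= => /andP[t0 _] ht; exists t.
Qed.

Lemma Phi_invK t : 0 <= t -> Phi_inv a (Phi a t) = t.
Proof.
move=> t0; rewrite /Phi_inv pinvKV ?inE// => x y; rewrite !inE /= => x0 y0 e.
by have [/(Phi_lt x0)|/(Phi_lt y0)|//] := ltgtP x y; rewrite e ltxx.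
Qed.

Lemma Phi_invKV y : 0 <= y -> Phi a (Phi_inv a y) = y.
Proof. by move=> /Phi_surj[t t0 <-]; rewrite Phi_invK. Qed.

Lemma Phi_inv_ge0 y : 0 <= y -> 0 <= Phi_inv a y.
Proof. by move=> /Phi_surj[t t0 <-]; rewrite Phi_invK. Qed.

Lemma Phi_inv_le x y : 0 <= x -> x <= y -> Phi_inv a x <= Phi_inv a y.
Proof.
move=> x0 xy; have y0 := le_trans x0 xy.
rewrite leNgt; apply/negP => /(Phi_lt (Phi_inv_ge0 y0)).
by rewrite !Phi_invKV// ltNge xy.
Qed.

Lemma Phi_inv_gt0 y : 0 < y -> 0 < Phi_inv a y.
Proof.
move=> y0; rewrite lt_neqAle Phi_inv_ge0 ?andbT ?ltW//; apply/eqP => h.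
by have := Phi_invKV (ltW y0); rewrite -h Phi_at0 => h0; rewrite h0 ltxx in y0.
Qed.

Section indices.
Variable p : R.

Let h (t : R) := Phi a t * t `^ (- p).
Let h_derive (t : R) : 0 < t ->
  is_derive t 1 h (t `^ (- p - 1) * (t * phi a t - p * Phi a t)).
Proof.
move=> t0; have d1 := Phi_derive t0.
have d2 := @is_derive1_powR R (- p) t t0.
have dM := is_deriveM d1 d2.
rewrite [X in is_derive _ _ _ X](_ : _ = Phi a t *: (- p * t `^ (- p - 1)) + t `^ (- p) *: phi a t); first exact: dM.
have -> : t `^ (- p) = t `^ (- p - 1) * t.
  by rewrite -[X in _ * X](powRr1 (ltW t0)) -powRDp// subrK.
by rewrite /GRing.scale /=; ring.
Qed.

Let h_within x y : 0 < x -> {within `[x, y], continuous h}.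
Proof.
move=> x0; apply: derivable_within_continuous => z; rewrite in_itv /= => /andP[xz _].
by have [] := h_derive (lt_le_trans x0 xz).
Qed.

Let h_ratio x y : 0 < x -> x <= y -> h x <= h y -> Phi a x <= (x / y) `^ p * Phi a y.
Proof.
move=> x0 xy; have y0 := lt_le_trans x0 xy; rewrite /h.
rewrite powR_divN//.
rewrite -(@ler_pM2l _ (x `^ p)) ?powR_gt0//.
rewrite mulrCA -powRDp// subrr powRr0 mulr1.
by rewrite [Phi a y * _]mulrC mulrA.
Qed.

Let h_ratioV x y : 0 < x -> x <= y -> h y <= h x -> Phi a y <= (y / x) `^ p * Phi a x.
Proof.
move=> x0 xy; have y0 := lt_le_trans x0 xy; rewrite /h.
rewrite powR_divN//.
rewrite -(@ler_pM2l _ (y `^ p)) ?powR_gt0//.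
rewrite mulrCA -powRDp// subrr powRr0 mulr1.
by rewrite [Phi a x * _]mulrC mulrA.
Qed.

(** A lower bound p on the logarithmic derivative of [Phi] makes
    [Phi t / t ^ p] nondecreasing. *)
Lemma Phi_scale_down : (forall t, 0 < t -> p * Phi a t <= t * phi a t) ->
  forall x y, 0 < x -> x <= y -> Phi a x <= (x / y) `^ p * Phi a y.
Proof.
move=> hp x y x0 xy; apply: h_ratio => //.
have := @ger0_derive1_le_cc R h x y; apply; rewrite ?in_itv /= ?lexx ?xy//.
- move=> z; rewrite in_itv /= => /andP[xz _].
  by have [] := h_derive (lt_trans x0 xz).
- move=> z; rewrite in_itv /= => /andP[xz _]; have z0 := lt_trans x0 xz.
  have d := h_derive z0; rewrite derive1E (@derive_val _ _ _ _ _ _ _ d).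
  by rewrite mulr_ge0 ?powR_ge0// subr_ge0 hp.
- exact: h_within.
Qed.

(** Dually, an upper bound makes [Phi t / t ^ p] nonincreasing; this bounds the
    growth of [Phi] under dilations. *)
Lemma Phi_scale_up : (forall t, 0 < t -> t * phi a t <= p * Phi a t) ->
  forall x y, 0 < x -> x <= y -> Phi a y <= (y / x) `^ p * Phi a x.
Proof.
move=> hp x y x0 xy; apply: h_ratioV => //.
have := @ler0_derive1_le_cc R h x y; apply; rewrite ?in_itv /= ?lexx ?xy//.
- move=> z; rewrite in_itv /= => /andP[xz _].
  by have [] := h_derive (lt_trans x0 xz).
- move=> z; rewrite in_itv /= => /andP[xz _]; have z0 := lt_trans x0 xz.
  have d := h_derive z0; rewrite derive1E (@derive_val _ _ _ _ _ _ _ d).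
  by rewrite mulr_ge0_le0 ?powR_ge0// subr_le0 hp.
- exact: h_within.
Qed.

End indices.

Lemma phi_minus_le (p : R) : (p%:E <= phi_minus a)%E ->
  forall t, 0 < t -> p * Phi a t <= t * phi a t.
Proof.
move=> hp t t0; rewrite -ler_pdivlMr ?Phi_gt0// -lee_fin (le_trans hp)//.
by apply: ereal_inf_lbound; exists t.
Qed.

Lemma le_phi_plus (p : R) : (phi_plus a <= p%:E)%E ->
  forall t, 0 < t -> t * phi a t <= p * Phi a t.
Proof.
move=> hp t t0; rewrite -ler_pdivrMr ?Phi_gt0// -lee_fin (le_trans _ hp)//.
by apply: ereal_sup_ubound; exists t.
Qed.

(** With [g t = Phi (sqrt t)] convex and [g 0 = 0], superadditivity of [g] bounds
    the left side by [g ((x^2 + y^2) / 2)], and convexity by the mean of [g (x^2)]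
    and [g (y^2)]. *)
Lemma Phi_clarkson :
  @convex_function R R^o [set t | 0 <= t] (fun t => Phi a (Num.sqrt t)) ->
  forall x y, Phi a `|(x + y) / 2| + Phi a `|(x - y) / 2| <=
    (Phi a `|x| + Phi a `|y|) / 2.
Proof.
move=> cvx.
pose G t := Phi a (Num.sqrt t).
have Gcvx t x y : 0 <= t <= 1 -> 0 <= x -> 0 <= y ->
    G (t * x + (1 - t) * y) <= t * G x + (1 - t) * G y.
  move=> /andP[t0 t1] x0 y0.
  have tI : t \in `[0, 1]%R by rewrite in_itv /= t0 t1.
  by have := cvx (Itv01 t0 t1) x y; rewrite !inE => /(_ x0 y0); rewrite !convRE.
have G0 : G 0 = 0 by rewrite /G sqrtr0 Phi_at0.
have Gsc t x : 0 <= t <= 1 -> 0 <= x -> G (t * x) <= t * G x.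
  move=> t01 x0; have := @Gcvx t x 0 t01 x0 (lexx 0).
  by rewrite G0 !mulr0 !addr0.
have Gsup x y : 0 <= x -> 0 <= y -> G x + G y <= G (x + y).
  move=> x0 y0; have [/eqP|xy0] := eqVneq (x + y) 0.
    by rewrite paddr_eq0// => /andP[/eqP-> /eqP->]; rewrite addr0 G0 addr0.
  have s0 : 0 < x + y by rewrite lt_neqAle eq_sym xy0 addr_ge0.
  have := Gsc (x / (x + y)) (x + y); rewrite divfK// => h1.
  have := Gsc (y / (x + y)) (x + y); rewrite divfK// => h2.
  apply: le_trans (lerD (h1 _ (ltW s0)) (h2 _ (ltW s0))) _.
  - by rewrite divr_ge0 ?(ltW s0)//= ler_pdivrMr// mul1r lerDl.
  - by rewrite divr_ge0 ?(ltW s0)//= ler_pdivrMr// mul1r lerDr.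
  by rewrite -!mulrDl mulfV// mul1r.
have GE x : Phi a `|x| = G (x ^+ 2) by rewrite /G sqrtr_sqr.
move=> x y; rewrite !GE; apply: le_trans (Gsup _ _ (sqr_ge0 _) (sqr_ge0 _)) _.
have := Gcvx 2^-1 (x ^+ 2) (y ^+ 2); rewrite (_ : 1 - 2^-1 = 2^-1 :> R); last by lra.
rewrite (_ : ((x + y) / 2) ^+ 2 + ((x - y) / 2) ^+ 2 =
  2^-1 * x ^+ 2 + 2^-1 * y ^+ 2); last by field.
move=> /(_ _ (sqr_ge0 _) (sqr_ge0 _)) h; apply: le_trans (h _) _; first by lra.
by rewrite -mulrDr mulrC.
Qed.

End PhiFacts.

(** * The sum of the Young functions *)

(** What the variational argument uses of [Psi]: the tangent inequality, the
    upper bounds that control dilations ([young_upper], [young_dbl]), the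
    power decay at 0 that makes the energy of small multiples negligible
    ([young_pow]), and the Clarkson inequality. *)
Record young (R : realType) (Psi psi : R -> R) (P K p0 : R) : Prop := Young {
  young_cont : continuous psi;
  young_mono : {homo psi : x y / x <= y};
  young_odd : forall t, psi (- t) = - psi t;
  young_abs : forall t, Psi `|t| = Psi t;
  young_0 : Psi 0 = 0;
  young_gt0 : forall t, 0 < t -> 0 < Psi t;
  young_grad : forall x y, psi x * (y - x) <= Psi y - Psi x;
  young_upper : forall t, psi t * t <= P * Psi t;
  young_dbl : forall t, Psi (2 * t) <= K * Psi t;
  young_pow : forall k t, 0 <= k <= 1 -> Psi (k * t) <= k `^ p0 * Psi t;
  young_clarkson : forall x y,
    Psi ((x + y) / 2) + Psi ((x - y) / 2) <= (Psi x + Psi y) / 2 }.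

Definition Phi_sum (R : realType) (N : nat) (a : 'I_N -> R -> R) (t : R) : R :=
  \sum_(i < N) Phi (a i) `|t|.

Definition phi_sum (R : realType) (N : nat) (a : 'I_N -> R -> R) (t : R) : R :=
  \sum_(i < N) phi (a i) t.

(** Each property is linear in the Young function, except that the indices of
    the summands have to be bounded by common exponents. *)
Lemma young_Phi_sum (R : realType) (N : nat) (a : 'I_N -> R -> R) (p0 : R) :
  (1 <= N)%N ->
  (forall i, increasing_homeomorphism (phi (a i))) ->
  (forall i, p0%:E <= phi_minus (a i))%E ->
  (forall i, phi_plus (a i) < +oo)%E ->
  (forall i, @convex_function R R^o [set t | 0 <= t]
     (fun t => Phi (a i) (Num.sqrt t))) ->
  exists P K, young (Phi_sum a) (phi_sum a) P K p0.
Proof.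
move=> N1 homeo hmin hmax cvx.
have [P hP] : exists P : R, forall i, (phi_plus (a i) <= P%:E)%E.
  exists (\sum_i `|fine (phi_plus (a i))|) => i.
  have : (phi_plus (a i) <= `|fine (phi_plus (a i))|%:E)%E.
    case: (phi_plus (a i)) (hmax i) => //= [r _|_]; last exact: leNye.
    by rewrite lee_fin ler_norm.
  move=> h; apply: (le_trans h); rewrite lee_fin (bigD1 i)//= lerDl.
  by apply: sumr_ge0.
pose i0 : 'I_N := Ordinal N1.
exists P, (2 `^ P); split.
- apply: continuous_big => [|i _]; first exact: add_continuous.
  exact: (phi_continuous (homeo i)).
- by move=> x y xy; apply: ler_sum => i _; exact: phi_le.
- by move=> t; rewrite /phi_sum -sumrN; apply: eq_bigr => i _; rewrite phiN.
- by move=> t; rewrite /Phi_sum normr_id.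
- by rewrite /Phi_sum normr0 big1// => i _; rewrite Phi_at0.
- move=> t t0; rewrite /Phi_sum (bigD1 i0)//= ltr_wpDr//.
    by apply: sumr_ge0 => i _; exact: Phi_ge0.
  by rewrite gtr0_norm// Phi_gt0.
- move=> x y; rewrite /phi_sum /Phi_sum mulr_suml -sumrB.
  by apply: ler_sum => i _; exact: Phi_abs_grad.
- move=> t; rewrite /phi_sum /Phi_sum mulr_suml mulr_sumr.
  apply: ler_sum => i _.
  have [->|t0] := eqVneq t 0; first by rewrite normr0 Phi_at0 !mulr0.
  have -> : phi (a i) t * t = `|t| * phi (a i) `|t|.
    rewrite /phi normr_id mulrCA -[`|t| * `|t|]expr2 real_normK ?num_real//.
    by rewrite expr2 mulrA.
  by apply: (le_phi_plus (homeo i) (hP i)); rewrite normr_gt0.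
- move=> t; rewrite /Phi_sum mulr_sumr; apply: ler_sum => i _.
  have [->|t0] := eqVneq t 0; first by rewrite mulr0 normr0 Phi_at0 mulr0.
  have nt : 0 < `|t| by rewrite normr_gt0.
  have := @Phi_scale_up _ _ (homeo i) P (le_phi_plus (homeo i) (hP i)) `|t| `|2 * t| nt.
  rewrite normrM ger0_norm// mulfK ?gt_eqF//; apply.
  by rewrite ler_peMl ?(ltW nt)// ler1n.
- move=> k t /andP[]; rewrite le_eqVlt => /predU1P[<- _|k0 k1].
    rewrite mul0r /Phi_sum normr0 big1 => [|i _]; last exact: Phi_at0.
    by rewrite mulr_ge0 ?powR_ge0// sumr_ge0// => i _; exact: Phi_ge0.
  rewrite /Phi_sum mulr_sumr; apply: ler_sum => i _.
  have [->|t0] := eqVneq t 0; first by rewrite mulr0 normr0 Phi_at0 mulr0.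
  have nt : 0 < `|t| by rewrite normr_gt0.
  have := @Phi_scale_down _ _ (homeo i) p0 (phi_minus_le (homeo i) (hmin i)) (k * `|t|) `|t|.
  rewrite normrM gtr0_norm// mulfK ?gt_eqF//; apply; first exact: mulr_gt0.
  by rewrite ler_piMl// (ltW nt).
- move=> x y; rewrite /Phi_sum -!big_split /= mulr_suml; apply: ler_sum => i _.
  exact: Phi_clarkson.
Qed.

(** * Growth forced by the conjugate function *)

Lemma powR_le_inv (R : realType) (r x y : R) : 0 < r -> 0 <= y ->
  x `^ r <= y `^ r -> x <= y.
Proof.
move=> r0 y0; apply: contraTT; rewrite -!ltNge => yx.
by apply: gt0_ltr_powR => //; rewrite nnegrE// (le_trans y0)// ltW.
Qed.

Section Growth.
Variables (R : realType) (N : nat) (s : R) (a : R -> R).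
Hypothesis N1 : (1 <= N)%N.
Hypothesis s0 : 0 < s.
Hypothesis homeo : increasing_homeomorphism (phi a).
Notation mu := (@lebesgue_measure R).
Notation f := (sobolev_integrand N s a).
Notation F := (Phi_star_inv N s a).
Let e : R := (N%:R + s) / N%:R.
Hypothesis fin1 : (\int[mu]_(t in `]0%R, 1%R]) (f t)%:E < +oo)%E.
Hypothesis infy : (\int[mu]_(t in `[1%R, +oo[) (f t)%:E = +oo)%E.

Let Nn0 : N%:R != 0 :> R.
Proof. by rewrite pnatr_eq0 -lt0n. Qed.

Let e_gt0 : 0 < e.
Proof. by rewrite divr_gt0 ?ltr0n// addr_gt0// ltr0n. Qed.

Let f_ge0 (t : R) : 0 < t -> 0 <= f t.
Proof. by move=> t0; rewrite divr_ge0 ?powR_ge0// Phi_inv_ge0// ltW. Qed.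

Let f_measurable (D : set R) : measurable D -> D `<=` `]0, +oo[ -> measurable_fun D f.
Proof.
move=> mD D0.
pose g t := Phi_inv a (Num.max 0 t) * t `^ (- e).
apply: (@eq_measurable_fun _ _ _ _ _ g) => [t|].
  rewrite inE => /D0; rewrite /= in_itv /= andbT => t0.
  by rewrite /g /sobolev_integrand -/e powRN max_r// ltW.
apply: measurable_funM; last by apply: measurable_funTS; exact: measurable_powR.
apply: nondecreasing_measurable => // x y xy.
apply: Phi_inv_le => //; first by rewrite le_max lexx.
by rewrite ge_max !le_max lexx xy orbT.
Qed.

Let f_measurable_oc (x y : R) : 0 <= x -> measurable_fun `]x, y] (EFin \o f).
Proof.
move=> x0; apply/measurable_EFinP; apply: f_measurable => // t /=.
by rewrite !in_itv /= andbT => /andP[xt _]; exact: le_lt_trans xt.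
Qed.

Let f_le (x y t : R) : 0 < x -> x <= t <= y -> f t <= Phi_inv a y / x `^ e.
Proof.
move=> x0 /andP[xt ty]; have t0 := lt_le_trans x0 xt.
rewrite /sobolev_integrand ler_pM ?invr_ge0 ?powR_ge0//.
- by rewrite Phi_inv_ge0// ltW.
- by rewrite Phi_inv_le// ltW.
rewrite lef_pV2 ?posrE ?powR_gt0// ge0_ler_powR ?nnegrE// ltW//.
Qed.

Let f_integrable (y : R) : mu.-integrable `]0, y] (EFin \o f).
Proof.
suff H : forall y, 1 <= y -> mu.-integrable `]0, y] (EFin \o f).
  have [/H//|y1] := leP 1 y.
  apply: integrableS (H 1 (lexx 1)) => //; apply: subset_itvl.
  by rewrite bnd_simp ltW.
move=> {}y y1; apply/integrableP; split; first exact: f_measurable_oc.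
under eq_integral => t.
  rewrite inE /= in_itv /= => /andP[t0 _]; rewrite ger0_norm ?f_ge0//.
  over.
rewrite (@itv_bndbnd_setU _ _ _ (BRight 1)) ?bnd_simp//.
rewrite ge0_integral_setU//=; first last.
- apply/disj_setPS => t /=; rewrite !in_itv /= => -[/andP[_ h1] /andP[h2 _]].
  by move: (lt_le_trans h2 h1); rewrite ltxx.
- move=> t; rewrite /= !in_itv /= => -[] /andP[t0 _]; rewrite lee_fin f_ge0//.
  exact: lt_trans t0.
- rewrite -itv_bndbnd_setU ?bnd_simp//; exact: f_measurable_oc.
rewrite lte_add_pinfty//.
have mfu : measurable_fun `]1, y] (EFin \o f) by exact: f_measurable_oc.
apply: (@le_lt_trans _ _ (\int[mu]_(t in `]1%R, y]) (Phi_inv a y / 1 `^ e)%:E)%E).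
  apply: ge0_le_integral => //=.
  - move=> t; rewrite in_itv /= => /andP[t0 _]; rewrite lee_fin f_ge0//.
    exact: lt_trans t0.
  - move=> t; rewrite in_itv /= => /andP[t0 ty]; rewrite lee_fin f_le// ty.
    by rewrite (ltW t0).
by rewrite integral_cst//= lebesgue_measure_itv /=; case: ifP => _;
   rewrite -?EFinD -?EFinM ?mule0 ltry.
Qed.

Let F_sub (x y : R) : 0 < x -> x <= y -> F y - F x = \int[mu]_(t in `]x, y]) f t.
Proof.
move=> x0 xy; by rewrite /Phi_star_inv Rintegral_itvB ?bnd_simp ?(ltW x0).
Qed.

Let F_lower (x y : R) : 0 < x -> x <= y -> Phi_inv a x / y `^ e * (y - x) <= F y - F x.
Proof.
move=> x0 xy; rewrite F_sub//.
have -> : Phi_inv a x / y `^ e * (y - x) =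
    \int[mu]_(t in `]x, y]) (Phi_inv a x / y `^ e).
  rewrite Rintegral_cst//= lebesgue_measure_itv /= lte_fin.
  by case: ltgtP xy => //= -> _; rewrite subrr.
apply: le_Rintegral => //.
- apply/integrableP; split; first exact: measurable_cst.
  rewrite /= integral_cst//= lebesgue_measure_itv /=; case: ifP => _;
  by rewrite -?EFinD -?EFinM ?mule0 ltry.
- apply: integrableS (f_integrable y) => //; apply: subset_itvr.
  by rewrite bnd_simp ltW.
- move=> t /=; rewrite in_itv /= => /andP[xt ty]; have t0 := lt_trans x0 xt.
  rewrite ler_pM ?invr_ge0 ?powR_ge0//; first by rewrite Phi_inv_ge0// ltW.
    by rewrite Phi_inv_le// ltW.
  by rewrite lef_pV2 ?posrE ?powR_gt0 ?(lt_le_trans t0)// ge0_ler_powR ?nnegrE// ltW// (lt_le_trans t0).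
Qed.

Let F_lt0 (x y : R) : 0 < x -> x < y -> F x < F y.
Proof.
move=> x0 xy; rewrite -subr_gt0 (lt_le_trans _ (F_lower x0 (ltW xy)))//.
by rewrite mulr_gt0 ?subr_gt0// divr_gt0 ?powR_gt0 ?Phi_inv_gt0// (lt_trans x0).
Qed.

Let F_0 : F 0 = 0.
Proof. by rewrite /Phi_star_inv set_itv_ge ?bnd_simp ?ltxx// Rintegral_set0. Qed.

Let F_ge0 (y : R) : 0 <= F y.
Proof.
apply: Rintegral_ge0 => t /=; rewrite in_itv /= => /andP[t0 _]; exact: f_ge0.
Qed.

Let F_lt (x y : R) : 0 <= x -> x < y -> F x < F y.
Proof.
rewrite le_eqVlt => /predU1P[<- y0|]; last exact: F_lt0.
rewrite F_0; apply: le_lt_trans (F_ge0 (y / 2)) _; apply: F_lt0; lra.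
Qed.

Let F_star (y : R) : 0 <= y -> Phi_star N s a (F y) = y.
Proof.
move=> y0; rewrite /Phi_star pinvKV ?inE// => u v; rewrite !inE /= => u0 v0 h.
by have [/(F_lt u0)|/(F_lt v0)|//] := ltgtP u v; rewrite h ltxx.
Qed.

Let F_infty (M : R) : exists2 y0, 0 < y0 & forall y, y0 <= y -> M < F y.
Proof.
apply: contrapT => H.
have FM y : 0 <= y -> F y <= M.
  move=> y0; rewrite leNgt; apply/negP => h; apply: H.
  exists (y + 1); first by rewrite ltr_wpDl.
  move=> z yz; apply: lt_trans h _; apply: F_lt => //; lra.
pose Fs (n : nat) : set R := `[1%R, n%:R]%classic.
have Fs_nd : nondecreasing_seq Fs.
  by move=> m n mn; apply/subsetPset/subset_itvl; rewrite bnd_simp ler_nat.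
have Fs_gt0 n t : Fs n t -> 0 < t.
  by rewrite /Fs /= in_itv /= => /andP[xt _]; exact: lt_le_trans xt.
have mFs i : measurable (Fs i) by exact: measurable_itv.
have mf i : measurable_fun (Fs i) (EFin \o f).
  apply/measurable_EFinP; apply: f_measurable => // t /Fs_gt0.
  by rewrite /= in_itv /= andbT.
have f0 i t : Fs i t -> (0 <= (EFin \o f) t)%E.
  by move=> /Fs_gt0 t0; rewrite lee_fin f_ge0.
have := ge0_nondecreasing_set_cvg_integral (mu := mu) Fs_nd mFs mf f0.
rewrite (_ : \bigcup_i _ = `[1%R, +oo[%classic); last first.
  apply/seteqP; split => t /=.
    by move=> [n _]; rewrite /Fs /= !in_itv /= andbT => /andP[].
  rewrite in_itv /= andbT => t1; exists (Num.bound t) => //=.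
  by rewrite /Fs /= in_itv /= t1 ltW// archi_boundP// (le_trans ler01).
rewrite infy => cvg; have : (+oo <= M%:E :> \bar R)%E.
  apply: cvge_to_le cvg _; apply: nearW => n.
  apply: (@le_trans _ _ (\int[mu]_(t in `]0%R, n%:R]) (f t)%:E)%E).
    apply: ge0_subset_integral.
    - exact: mFs.
    - exact: measurable_itv.
    - exact: f_measurable_oc.
    - by move=> t /=; rewrite in_itv /= => /andP[t0 _]; rewrite lee_fin f_ge0.
    - by apply: subset_itvr; rewrite bnd_simp.
  have := FM n%:R (ler0n _ _); rewrite /Phi_star_inv /Rintegral -lee_fin fineK//.
  by rewrite integrable_fin_num.
by [].
Qed.

Variable q : R.
Hypothesis q1 : 1 < q.
Hypothesis lim_star :
  (t `^ q / Phi_star N s a (1 * t)) @[t --> +oo] --> (0 : R).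

(** For large [y] the hypothesis says [F y ^ q <= eps * y].  Since [Phi_inv] is
    monotone, [F y >= Phi_inv (y/2) * y^(-s/N) / 2]; at [y = 2 * Phi w] the two
    bounds combine to [w <= c * (Phi w)^(1/q + s/N)]. *)
Lemma Phi_growth (A : R) : 0 < A -> exists2 T, 0 < T &
  forall w, T <= w -> A * w `^ (q^-1 + s / N%:R)^-1 <= Phi a w.
Proof.
move=> A0; pose sg := q^-1 + s / N%:R.
have q0 : 0 < q by exact: lt_trans q1.
have sg0 : 0 < sg by rewrite addr_gt0 ?invr_gt0// divr_gt0// ltr0n.
pose B := ((2 * A)^-1 `^ sg / 2).
have B0 : 0 < B by rewrite divr_gt0// powR_gt0// invr_gt0 mulr_gt0.
pose eps := B `^ q.
have eps0 : 0 < eps by rewrite powR_gt0.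
have [t0 ht0] : exists t0 : R, forall t, t0 < t -> t `^ q / Phi_star N s a t < eps.
  move/cvgrPdist_lt : lim_star => /(_ eps eps0)[t0 [_ ht0]].
  exists t0 => t /ht0; rewrite /= mul1r sub0r normrN.
  exact: le_lt_trans (ler_norm _).
have [y0 y00 hy0] := F_infty t0.
have FB y : y0 <= y -> F y <= B * y `^ q^-1.
  move=> yy0; have y1 : 0 < y by exact: lt_le_trans yy0.
  have := ht0 _ (hy0 _ yy0); rewrite F_star ?(ltW y1)// ltr_pdivrMr// => /ltW h.
  apply: (powR_le_inv q0); first by rewrite mulr_ge0 ?powR_ge0// ltW.
  by rewrite powRM ?powR_ge0 ?(ltW B0)// -powRrM mulVf ?gt_eqF// powRr1 ?(ltW y1).
pose T := 1 + y0 / phi a 1 + 1.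
have p10 : 0 < phi a 1 by exact: phi_gt0.
exists T; first by rewrite addr_gt0// ltr_wpDr// divr_ge0// ltW.
move=> w Tw.
have w1 : 1 <= w.
  apply: le_trans Tw; rewrite /T -addrA lerDl addr_ge0// divr_ge0// ltW//.
have w0 : 0 < w by exact: lt_le_trans w1.
have Pw : y0 <= Phi a w.
  have := Phi_unbounded homeo w1; apply: contraTT; rewrite -!ltNge => h.
  have : (y0 / phi a 1 + 1) * phi a 1 <= w * phi a 1.
    rewrite ler_wpM2r ?(ltW p10)//; apply: le_trans Tw.
    by rewrite /T -addrA lerDr.
  rewrite mulrDl divfK ?gt_eqF// mul1r => h'; apply: lt_le_trans h'; lra.
pose y := 2 * Phi a w.
have Pw0 : 0 < Phi a w by exact: Phi_gt0.
have yy0 : y0 <= y by apply: (le_trans Pw); rewrite /y; lra.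
have y_gt0 : 0 < y by rewrite mulr_gt0.
have Pwy : Phi a w <= y by rewrite /y; lra.
have h := F_lower Pw0 Pwy; rewrite Phi_invK// ?(ltW w0)// in h.
have : w / y `^ e * (y / 2) <= F y.
  rewrite -(_ : y - Phi a w = y / 2); last by rewrite /y; field.
  by apply: (le_trans h); rewrite gerBl F_ge0.
move=> /le_trans/(_ (FB _ yy0)).
have -> : w / y `^ e * (y / 2) = w / (2 * y `^ (s / N%:R)).
  have -> : e = 1 + s / N%:R by rewrite /e mulrDl mulfV.
  rewrite powRDp// powRr1 ?(ltW y_gt0)//.
  by field; rewrite !gt_eqF ?powR_gt0.
rewrite ler_pdivrMr ?mulr_gt0 ?powR_gt0// => h2.
have h3 : w <= (2 * B) * y `^ sg by rewrite /sg powRDp//; lra.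
have h4 : w `^ sg^-1 <= (2 * A)^-1 * y.
  have -> : (2 * A)^-1 * y = (2 * B * y `^ sg) `^ sg^-1.
    have -> : 2 * B = (2 * A)^-1 `^ sg by rewrite /B mulrCA mulfV// mulr1.
    rewrite powRM ?powR_ge0// -!powRrM mulfV ?gt_eqF//.
    by rewrite !powRr1 ?(ltW y_gt0)// invr_ge0 ltW// mulr_gt0.
  apply: ge0_ler_powR => //; rewrite ?nnegrE ?invr_ge0 ?(ltW w0) ?(ltW sg0)//.
  exact: le_trans (ltW w0) h3.
apply: le_trans (ler_wpM2l (ltW A0) h4) _.
by rewrite /y le_eqVlt; apply/orP; left; apply/eqP; field; rewrite gt_eqF.
Qed.

End Growth.

(** * Measure and geometry of row vectors *)

Section RowSpace.
Variables (R : realType) (N : nat).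
Notation leb := (lebesgue_rV R N).
Notation V := ('rV[R]_N).

Lemma measurable_rV_prod (A : 'I_N -> set (measurableTypeR R)) :
  (forall i, measurable (A i)) ->
  measurable [set x : V | forall i, A i (x ord0 i)].
Proof.
move=> mA; rewrite (_ : mkset _ = \bigcap_(i in [set: 'I_N])
    (fun x : V => x ord0 i : measurableTypeR R) @^-1` A i).
  apply: fin_bigcap_measurable => // i _.
  by rewrite -[X in measurable X]setTI; exact: measurable_coord.
by apply/seteqP; split => x /= Ax i; [move=> _|]; exact: Ax.
Qed.

Lemma rV_nbhs_sup (x : V) (A : set V) : nbhs x A ->
  exists2 e : R, 0 < e & forall y : V, (forall i, `|x ord0 i - y ord0 i| < e) -> A y.
Proof.
move=> /nbhs_ballP[e /= e0 eA]; exists e => // y xy; apply: eA.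
by split => // i j; rewrite (ord1 i) /ball /=; exact: xy.
Qed.

(** An open set is the union of the rational boxes that it contains. *)
Lemma open_measurable_rV (U : set V) : open U -> measurable U.
Proof.
move=> Uo.
pose side (p : 'rV[rat]_N * nat) (i : 'I_N) : set (measurableTypeR R) :=
  `](ratr (p.1 ord0 i) - p.2.+1%:R^-1 : R), (ratr (p.1 ord0 i) + p.2.+1%:R^-1)[%classic.
pose box p : set V := [set y | forall i, side p i (y ord0 i)].
pose F p := if `[< box p `<=` U >] then box p else set0.
have -> : U = \bigcup_p F p.
  apply/seteqP; split => [x Ux|x [p _]]; last first.
    by rewrite /F; case: ifPn => // /asboolP; exact.
  have : nbhs x U by exact: open_nbhs_nbhs.
  move=> /rV_nbhs_sup[e e0 xU].
  pose k := Num.bound (2 / e).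
  have ke : k.+1%:R^-1 < e / 2 :> R.
    rewrite invf_plt ?posrE ?divr_gt0// invf_div (lt_trans (archi_boundP _))//.
      by rewrite divr_ge0// ltW.
    by rewrite ltr_nat.
  have kp : 0 < k.+1%:R^-1 :> R by rewrite invr_gt0.
  have cex i : exists c : rat, ratr c \in `](x ord0 i - k.+1%:R^-1), (x ord0 i + k.+1%:R^-1)[.
    by apply: rat_in_itvoo; rewrite ltrBlDr -addrA ltrDl addr_gt0.
  pose c : 'rV[rat]_N := \row_i projT1 (cid (cex i)).
  have cP i : `|x ord0 i - ratr (c ord0 i)| < k.+1%:R^-1.
    rewrite mxE; have := projT2 (cid (cex i)).
    by rewrite in_itv /= ltr_distlC => /andP[? ?]; apply/andP; split.
  exists (c, k) => //; rewrite /F; case: ifPn => [_ i /=|/asboolP].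
    by move: (cP i); rewrite /side /= in_itv /= ltr_distl.
  case=> y /= yc; apply: xU => i; rewrite -(subrKA (ratr (c ord0 i))).
  have yci : `|ratr (c ord0 i) - y ord0 i| < k.+1%:R^-1.
    by move: (yc i); rewrite /side /= in_itv /= ltr_distlC.
  apply: (le_lt_trans (ler_normD _ _)); move: (cP i) yci ke; set d := _^-1; lra.
apply: countable_bigcupT_measurable => //.
move=> p; rewrite /F; case: ifPn => // _.
by apply: (measurable_rV_prod (A := side p)) => i; exact: measurable_itv.
Qed.

Lemma continuous_measurable_rV (D : set V) (f : V -> R) :
  open D -> {in D, continuous f} -> measurable_fun D f.
Proof.
move=> Do cf; apply: (measurability _ (RGenOInfty.measurableE R)) => //.
move=> /= _ [_ [a ->] <-]; apply: open_measurable_rV; rewrite openE => x [Dx fx].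
have fa : \forall y \near x, a < f y.
  move: fx; rewrite /= in_itv /= andbT => fx.
  exact: (cf x (mem_set Dx) _ (lt_nbhsr fx)).
near=> y; split; first by near: y; exact: open_nbhs_nbhs.
rewrite /= in_itv /= andbT; near: y; exact: fa.
Unshelve. all: by end_near. Qed.

Lemma within_continuous_measurable_rV (D : set V) (f : V -> R) :
  open D -> {within closure D, continuous f} -> measurable_fun D f.
Proof.
move=> Do cf; apply: continuous_measurable_rV => // x Dx.
have : {within D, continuous f}.
  by apply: continuous_subspaceW cf; exact: subset_closure.
by rewrite continuous_open_subspace//; apply.
Qed.

(** The closed ball of the sup norm, in a form that exposes the coordinates; its
    volume is explicit. *)
Definition cbox (x : V) (r : R) : set V :=
  [set y | forall i, `|x ord0 i - y ord0 i| <= r].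

Lemma cboxE x r : cbox x r =
  [set y | forall i, `[x ord0 i - r, x ord0 i + r]%classic (y ord0 i)].
Proof.
by apply/seteqP; split => y /= h i; move: (h i); rewrite in_itv /= ler_distlC.
Qed.

Lemma measurable_cbox x r : measurable (cbox x r).
Proof.
rewrite cboxE.
by apply: (measurable_rV_prod (A := fun i => `[x ord0 i - r, x ord0 i + r]%classic)).
Qed.

Lemma leb_cbox x r : 0 <= r -> leb (cbox x r) = ((2 * r) ^+ N)%:E.
Proof.
move=> r0; rewrite cboxE.
rewrite (lebesgue_rV_box (A := fun i => `[x ord0 i - r, x ord0 i + r]%classic)) => [|i]; last exact: measurable_itv.
rewrite (eq_bigr (fun=> (2 * r)%:E)) => [|i _].
  by rewrite prodEFin prodr_const card_ord.
rewrite lebesgue_measure_itv /= lte_fin; case: ltgtP => h.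
- by rewrite -EFinD; congr EFin; ring.
- by exfalso; lra.
- by rewrite (_ : 2 * r = 0)//; lra.
Qed.

Lemma enorm_ge0 (x : V) : 0 <= enorm x.
Proof. exact: sqrtr_ge0. Qed.

Lemma enorm_coord (x : V) i : `|x ord0 i| <= enorm x.
Proof.
rewrite -sqrtr_sqr ler_wsqrtr// (bigD1 i)//= lerDl.
by apply: sumr_ge0 => j _; exact: sqr_ge0.
Qed.

Lemma enorm_eq0 (x : V) : enorm x = 0 -> x = 0.
Proof.
move=> x0; apply/rowP => i; rewrite mxE; apply/eqP.
by have := enorm_coord x i; rewrite x0 normr_le0.
Qed.

Lemma enorm_gt0 (x y : V) : x != y -> 0 < enorm (x - y).
Proof.
move=> xy; rewrite lt_neqAle enorm_ge0 andbT eq_sym; apply: contra xy => /eqP h.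
by rewrite -subr_eq0 (enorm_eq0 h).
Qed.

Lemma enormBC (x y : V) : enorm (x - y) = enorm (y - x).
Proof.
by congr Num.sqrt; apply: eq_bigr => i _; rewrite !mxE -sqrrN opprB.
Qed.

Lemma enorm_le (x : V) r : 0 <= r -> (forall i, `|x ord0 i| <= r) -> enorm x <= N%:R * r.
Proof.
move=> r0 xr; rewrite -[leRHS]ger0_norm ?mulr_ge0// -sqrtr_sqr ler_wsqrtr//.
apply: (@le_trans _ _ (\sum_(i < N) r ^+ 2)).
  apply: ler_sum => i _; rewrite -[leLHS]real_normK ?num_real//.
  by rewrite ler_sqr ?nnegrE.
rewrite sumr_const card_ord exprMn -[_ *+ N]mulr_natl ler_wpM2r ?sqr_ge0//.
by case: (N) => [|n]; rewrite ?expr0n// expr2 ler_peMr// ler1n.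
Qed.

Lemma cbox_enorm (x y : V) r : enorm (x - y) <= r -> cbox x r y.
Proof.
by move=> xy i; have := enorm_coord (x - y) i; rewrite !mxE => /le_trans; apply.
Qed.

Lemma enorm_cbox (x y : V) r : 0 <= r -> cbox x r y -> enorm (x - y) <= N%:R * r.
Proof. by move=> r0 xy; apply: enorm_le => // i; rewrite !mxE; exact: xy. Qed.

Lemma bounded_cbox (A : set V) : bounded_set A ->
  exists2 L : R, 0 < L & A `<=` cbox 0 L.
Proof.
move=> [M [_ hM]]; exists (`|M| + 1); first by rewrite ltr_wpDl.
move=> x Ax i; rewrite mxE sub0r normrN.
have := hM (`|M| + 1); rewrite (le_lt_trans (ler_norm _)) ?ltrDl// => /(_ isT x Ax).
apply: le_trans; rewrite [leRHS]mx_normrE.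
by apply: (le_trans _ (le_bigmax _ _ (ord0, i))).
Qed.

Lemma measurable_enormB :
  measurable_fun setT (fun z : V * V => enorm (z.1 - z.2)).
Proof.
rewrite /enorm; apply: measurableT_comp.
  by apply: continuous_measurable_fun; exact: sqrt_continuous.
apply: measurable_sum => i; apply: measurable_funX.
rewrite (_ : (fun _ => _) = (fun z : V * V => z.1 ord0 i - z.2 ord0 i)).
  apply: measurable_funB.
    exact: (measurableT_comp (@measurable_coord R N i) measurable_fst).
  exact: (measurableT_comp (@measurable_coord R N i) measurable_snd).
by apply/funext => z; rewrite !mxE.
Qed.

Lemma null_setXl (A : set V) : measurable A -> leb A = 0%E ->
  (leb \x leb)%E (A `*` setT) = 0%E.
Proof.
move=> mA A0; transitivity (leb A * leb setT)%E; first exact: product_measure1E.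
by rewrite A0 mul0e.
Qed.

Lemma null_setXr (A : set V) : measurable A -> leb A = 0%E ->
  (leb \x leb)%E (setT `*` A) = 0%E.
Proof.
move=> mA A0; transitivity (leb setT * leb A)%E; first exact: product_measure1E.
by rewrite A0 mule0.
Qed.

(** The product of a null set with the whole space is null. *)
Lemma ae_pair (P : V -> Prop) : {ae leb, forall x, P x} ->
  {ae (leb \x leb)%E, forall z, P z.1 /\ P z.2}.
Proof.
move=> [A [mA A0 PA]].
exists ((A `*` setT) `|` (setT `*` A)); split.
- by apply: measurableU; exact: measurableX.
- apply/eqP; rewrite eq_le measure_ge0 andbT.
  apply: (le_trans (measureU2 _ _ _)); try exact: measurableX.
  by rewrite [X in (X + _)%E]null_setXl// [X in (_ + X)%E]null_setXr// adde0.
- move=> z /= /not_andP[] h; [left|right]; split => //; exact: PA.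
Qed.

End RowSpace.

(** * Pointwise inequalities for the sum *)

Section YoungTheory.
Variables (R : realType) (Psi psi : R -> R) (P K p0 : R).
Hypothesis yg : young Psi psi P K p0.

Lemma young_ge0 t : 0 <= Psi t.
Proof.
rewrite -(young_abs yg); have [->|t0] := eqVneq t 0.
  by rewrite normr0 (young_0 yg).
by apply: ltW; apply: (young_gt0 yg); rewrite normr_gt0.
Qed.

Lemma young_psi0 : psi 0 = 0.
Proof. by have := young_odd yg 0; rewrite oppr0; lra. Qed.

Lemma young_le_nng x y : 0 <= x -> x <= y -> Psi x <= Psi y.
Proof.
move=> x0 xy; rewrite -subr_ge0; apply: le_trans (young_grad yg x y).
by rewrite mulr_ge0 ?subr_ge0// -young_psi0 (young_mono yg).
Qed.

Lemma young_le x y : `|x| <= `|y| -> Psi x <= Psi y.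
Proof. by rewrite -(young_abs yg x) -(young_abs yg y); exact: young_le_nng. Qed.

Lemma youngN x : Psi (- x) = Psi x.
Proof. by rewrite -(young_abs yg) normrN (young_abs yg). Qed.

Lemma young_convex t x y : 0 <= t <= 1 ->
  Psi ((1 - t) * x + t * y) <= (1 - t) * Psi x + t * Psi y.
Proof.
move=> /andP[t0 t1]; set m := _ + _.
have hx := young_grad yg m x; have hy := young_grad yg m y.
have e : (1 - t) * (psi m * (x - m)) + t * (psi m * (y - m)) = 0 by rewrite /m; ring.
have t1' : 0 <= 1 - t by lra.
have := ler_wpM2l t0 hy; have := ler_wpM2l t1' hx; lra.
Qed.

Lemma young_scale k t : 0 <= k <= 1 -> Psi (k * t) <= k * Psi t.
Proof.
by move=> /(young_convex 0 t); rewrite mulr0 add0r (young_0 yg) mulr0 add0r.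
Qed.

(** The tangents at [x] and at [y] squeeze [Psi y] as [y] tends to [x]. *)
Lemma young_continuous : continuous Psi.
Proof.
move=> x; apply: (@squeeze_cvgr _ _ _ _ (fun y => Psi x + psi x * (y - x))
   (fun y => Psi x + psi y * (y - x))).
- near=> y; have := young_grad yg x y; have := young_grad yg y x.
  by move=> h1 h2; apply/andP; split; lra.
- have : Psi x + psi x * (y - x) @[y --> x] --> Psi x + psi x * (x - x).
    apply: cvgD; first exact: cvg_cst.
    apply: cvgM; first exact: cvg_cst.
    by apply: cvgB; [exact: cvg_id|exact: cvg_cst].
  by rewrite subrr mulr0 addr0.
- have : Psi x + psi y * (y - x) @[y --> x] --> Psi x + psi x * (x - x).
    apply: cvgD; first exact: cvg_cst.
    apply: cvgM; first exact: (young_cont yg).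
    by apply: cvgB; [exact: cvg_id|exact: cvg_cst].
  by rewrite subrr mulr0 addr0.
Unshelve. all: by end_near. Qed.

Lemma young_K_ge0 : 0 <= K.
Proof.
have h1 := young_gt0 yg ltr01.
rewrite -(@pmulr_lge0 _ (Psi 1))//; apply: le_trans (young_dbl yg 1).
exact: young_ge0.
Qed.

Lemma young_add x y : Psi (x + y) <= K / 2 * (Psi x + Psi y).
Proof.
have -> : x + y = 2 * ((1 - 2^-1) * x + 2^-1 * y) by field.
apply: le_trans (young_dbl yg _) _; rewrite -mulrA ler_wpM2l ?young_K_ge0//.
by apply: le_trans (young_convex _ _ _) _; lra.
Qed.

Lemma young_dilate c : exists2 C, 0 <= C & forall t, Psi (c * t) <= C * Psi t.
Proof.
have [n cn] : exists n, `|c| <= 2 ^+ n.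
  exists (Num.bound `|c|); apply: le_trans (ltW (archi_boundP (normr_ge0 _))) _.
  by rewrite -natrX ler_nat; apply: ltnW; exact: ltn_expl.
exists (K ^+ n); first by rewrite exprn_ge0// young_K_ge0.
have H m t : Psi (2 ^+ m * t) <= K ^+ m * Psi t.
  elim: m t => [|m IH] t; first by rewrite !expr0 !mul1r.
  rewrite exprS -mulrA; apply: le_trans (young_dbl yg _) _.
  by rewrite exprS -mulrA ler_wpM2l ?young_K_ge0.
move=> t; apply: le_trans (H n t); apply: young_le.
by rewrite !normrM ler_wpM2r// (le_trans cn)// ler_norm.
Qed.

(** For [|t| >= 1] convexity gives [Psi t >= |t| * Psi 1]. *)
Lemma young_linear t : `|t| <= 1 + Psi t / Psi 1.
Proof.
have h1 := young_gt0 yg ltr01.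
have [t1|t1] := leP `|t| 1.
  by apply: (le_trans t1); rewrite lerDl divr_ge0 ?young_ge0.
have t0 : 0 < `|t| by exact: lt_trans t1.
have := @young_scale `|t|^-1 `|t|; rewrite mulVf ?gt_eqF// (young_abs yg).
rewrite invr_ge0 (ltW t0) invf_le1// (ltW t1) => /(_ isT).
rewrite ler_pdivlMl// -ler_pdivlMr// => h; apply: (le_trans h).
by rewrite lerDr.
Qed.

(** A Young inequality without the conjugate function: with [c = |x| + |y|] the
    product is at most [psi c * c <= P * Psi c]. *)
Lemma young_mul_le x y : `|psi x * y| <= P * K / 2 * (Psi x + Psi y).
Proof.
have h1 := young_gt0 yg ltr01.
have psi_nng t : 0 <= t -> 0 <= psi t.
  by move=> t0; rewrite -young_psi0 (young_mono yg).
have P0 : 0 <= P.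
  rewrite -(@pmulr_lge0 _ (Psi 1))//; apply: le_trans (young_upper yg 1).
  by rewrite mulr1 psi_nng.
have psi_abs t : `|psi t| = psi `|t|.
  have [t0|/ltW t0] := leP 0 t; first by rewrite !ger0_norm// psi_nng.
  rewrite (ler0_norm t0) (young_odd yg) ler0_norm//.
  by have := psi_nng (- t); rewrite (young_odd yg) !oppr_ge0; exact.
pose c := `|x| + `|y|.
have c0 : 0 <= c by rewrite addr_ge0.
rewrite normrM psi_abs; apply: (@le_trans _ _ (psi c * c)).
  apply: ler_pM => //; first exact: psi_nng.
    by apply: (young_mono yg); rewrite /c lerDl.
  by rewrite /c lerDr.
apply: le_trans (young_upper yg _) _.
rewrite -mulrA -mulrA ler_wpM2l// mulrA.
by apply: le_trans (young_add _ _) _; rewrite !(young_abs yg).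
Qed.

End YoungTheory.

(** * The energy *)

Section Energy.
Variables (R : realType) (N : nat) (s : R) (Omega : set 'rV[R]_N).
Notation V := ('rV[R]_N).
Notation leb := (lebesgue_rV R N).
Notation leb2 := (lebesgue_rV R N \x lebesgue_rV R N)%E.
Hypothesis Omega_open : open Omega.
Implicit Types (u v w : V -> R) (z : V * V).

Lemma measurable_Omega : measurable Omega.
Proof. exact: open_measurable_rV. Qed.

Lemma measurable_QOmega : measurable (QOmega Omega).
Proof.
by apply: measurableC; apply: measurableX; apply: measurableC;
  exact: measurable_Omega.
Qed.

Lemma measurable_Ds (u : V -> R) : measurable_fun setT u ->
  measurable_fun setT (Ds s u).
Proof.
move=> mu; rewrite /Ds.
rewrite (_ : (fun _ => _) = (fun z : V * V => (u z.1 - u z.2) * enorm (z.1 - z.2) `^ (- s))).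
  apply: measurable_funM.
    apply: measurable_funB; first exact: (measurableT_comp mu measurable_fst).
    exact: (measurableT_comp mu measurable_snd).
  exact: (measurableT_comp (measurable_powR _) (@measurable_enormB R N)).
by apply/funext => z; rewrite powRN.
Qed.

Lemma mu_density_ge0 (z : V * V) : 0 <= mu_density z.
Proof. by rewrite invr_ge0 exprn_ge0// enorm_ge0. Qed.

Lemma measurable_mu_density : measurable_fun setT (@mu_density R N).
Proof.
rewrite (_ : @mu_density R N = (fun z : V * V => enorm (z.1 - z.2) `^ (- N%:R))).
  exact: (measurableT_comp (measurable_powR _) (@measurable_enormB R N)).
by apply/funext => z; rewrite powR_invn// enorm_ge0.
Qed.

Variables (Psi psi : R -> R) (P K p0 : R).
Hypothesis yg : young Psi psi P K p0.

(** The energy density with respect to the product Lebesgue measure. *)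
Definition edens (u : V -> R) (z : V * V) : R := Psi (Ds s u z) * mu_density z.

Definition energy (u : V -> R) : \bar R :=
  (\int[leb2]_(z in QOmega Omega) (edens u z)%:E)%E.

Lemma edens_ge0 u z : 0 <= edens u z.
Proof. by rewrite mulr_ge0 ?mu_density_ge0// (young_ge0 yg). Qed.

Lemma measurable_edens u : measurable_fun setT u -> measurable_fun setT (edens u).
Proof.
move=> mu; apply: measurable_funM; last exact: measurable_mu_density.
apply: measurableT_comp; last exact: measurable_Ds.
by apply: continuous_measurable_fun; exact: (young_continuous yg).
Qed.

Lemma measurable_edensE D u : measurable_fun setT u ->
  measurable_fun D (fun z => (edens u z)%:E).
Proof.
by move=> mu; apply: measurable_funTS; apply/measurable_EFinP; exact: measurable_edens.
Qed.

Lemma energy_ge0 u : (0 <= energy u)%E.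
Proof. by apply: integral_ge0 => z _; rewrite lee_fin edens_ge0. Qed.

Lemma DsD u v z : Ds s (fun x => u x + v x) z = Ds s u z + Ds s v z.
Proof. by rewrite /Ds -mulrDl; congr (_ / _); ring. Qed.

Lemma DsZ c u z : Ds s (fun x => c * u x) z = c * Ds s u z.
Proof. by rewrite /Ds mulrA -mulrBr. Qed.

(** Every pointwise inequality that is linear in the values of [Psi] passes to
    the energies. *)
Lemma energy_comb u v w1 w2 (c1 c2 : R) :
  measurable_fun setT u -> measurable_fun setT v ->
  measurable_fun setT w1 -> measurable_fun setT w2 -> 0 <= c1 -> 0 <= c2 ->
  (forall z, Psi (Ds s w1 z) + Psi (Ds s w2 z) <=
     c1 * Psi (Ds s u z) + c2 * Psi (Ds s v z)) ->
  (energy w1 + energy w2 <= c1%:E * energy u + c2%:E * energy v)%E.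
Proof.
move=> mu mv mw1 mw2 c10 c20 h.
have mQ := measurable_QOmega.
have d0 f z : (QOmega Omega) z -> (0 <= (edens f z)%:E)%E.
  by rewrite lee_fin edens_ge0.
pose A (c : R) f z := (c%:E * (edens f z)%:E)%E.
have mA c f : measurable_fun setT f -> measurable_fun (QOmega Omega) (A c f).
  by move=> mf; apply: measurable_funeM; exact: measurable_edensE.
have A0 c f z : 0 <= c -> (0 <= A c f z)%E.
  by move=> c0; rewrite /A -EFinM lee_fin mulr_ge0// edens_ge0.
have eA c f : 0 <= c -> measurable_fun setT f ->
    (c%:E * energy f = \int[leb2]_(z in QOmega Omega) A c f z)%E.
  move=> c0 mf; rewrite /A ge0_integralZl_EFin//; first exact: d0.
  exact: measurable_edensE.
have e1 : (\int[leb2]_(z in QOmega Omega) (A c1 u z + A c2 v z) =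
    \int[leb2]_(z in QOmega Omega) A c1 u z + \int[leb2]_(z in QOmega Omega) A c2 v z)%E.
  by apply: ge0_integralD => //; first [exact: mA|move=> z _; exact: A0].
have e2 : (\int[leb2]_(z in QOmega Omega) ((edens w1 z)%:E + (edens w2 z)%:E) =
    energy w1 + energy w2)%E.
  by apply: ge0_integralD => //; first [exact: measurable_edensE|exact: d0].
rewrite !eA// -e1 -e2;  apply: ge0_le_integral.
- exact: mQ.
- by move=> z Qz; rewrite -EFinD lee_fin addr_ge0// edens_ge0.
- by apply: emeasurable_funD; exact: measurable_edensE.
- by apply: emeasurable_funD; exact: mA.
- move=> z _; rewrite /A -!EFinM -!EFinD lee_fin /edens !mulrA -!mulrDl.
  by rewrite ler_wpM2r// mu_density_ge0.
Qed.

Lemma energy0 : energy (fun=> 0) = 0%E.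
Proof.
apply: integral0_eq => z _.
by rewrite /edens /Ds subrr mul0r (young_0 yg) mul0r.
Qed.

(** The case with one function on the left. *)
Lemma energy_comb1 u v w (c1 c2 : R) :
  measurable_fun setT u -> measurable_fun setT v ->
  measurable_fun setT w -> 0 <= c1 -> 0 <= c2 ->
  (forall z, Psi (Ds s w z) <= c1 * Psi (Ds s u z) + c2 * Psi (Ds s v z)) ->
  (energy w <= c1%:E * energy u + c2%:E * energy v)%E.
Proof.
move=> mu mv mw c10 c20 h.
have m0 : measurable_fun setT (fun _ : V => 0 : R) by exact: measurable_cst.
have := energy_comb mu mv mw m0 c10 c20; rewrite energy0 adde0; apply => z.
by rewrite {2}/Ds subrr mul0r (young_0 yg) addr0.
Qed.

Lemma energy_le u w : measurable_fun setT u -> measurable_fun setT w ->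
  (forall x y, `|w x - w y| <= `|u x - u y|) -> (energy w <= energy u)%E.
Proof.
move=> mu mw h; have := @energy_comb1 u u w 1 0 mu mu mw ler01 (lexx 0).
rewrite mul1e mul0e adde0; apply => z; rewrite mul1r mul0r addr0.
by apply: (young_le yg); rewrite /Ds !normrM ler_wpM2r.
Qed.

Definition ediff (u v : V -> R) (x : V) : R := (u x - v x) / 2.
Definition emean (u v : V -> R) (x : V) : R := (u x + v x) / 2.

Lemma measurable_ediff u v : measurable_fun setT u -> measurable_fun setT v ->
  measurable_fun setT (ediff u v).
Proof.
by move=> mu mv; apply: measurable_funM => //; exact: measurable_funB.
Qed.

Lemma measurable_emean u v : measurable_fun setT u -> measurable_fun setT v ->
  measurable_fun setT (emean u v).
Proof.
by move=> mu mv; apply: measurable_funM => //; exact: measurable_funD.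
Qed.

Lemma Ds_ediff u v z : Ds s (ediff u v) z = (Ds s u z - Ds s v z) / 2.
Proof. by rewrite /Ds /ediff; ring. Qed.

Lemma Ds_emean u v z : Ds s (emean u v) z = (Ds s u z + Ds s v z) / 2.
Proof. by rewrite /Ds /emean; ring. Qed.

Lemma energy_clarkson u v : measurable_fun setT u -> measurable_fun setT v ->
  (energy (emean u v) + energy (ediff u v) <=
    (2^-1)%:E * energy u + (2^-1)%:E * energy v)%E.
Proof.
move=> mu mv; apply: energy_comb => //.
- exact: measurable_emean.
- exact: measurable_ediff.
- move=> z; rewrite Ds_emean Ds_ediff.
  apply: le_trans (young_clarkson yg _ _) _.
  by rewrite -mulrDr mulrC.
Qed.

Lemma energy_convex t u v : 0 <= t <= 1 ->
  measurable_fun setT u -> measurable_fun setT v ->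
  (energy (fun x => (1 - t) * u x + t * v x)%R <=
    (1 - t)%:E * energy u + t%:E * energy v)%E.
Proof.
move=> t01 mu mv; have /andP[t0 t1] := t01.
apply: energy_comb1 => //.
- by apply: measurable_funD; apply: measurable_funM.
- by rewrite subr_ge0.
- by move=> z; rewrite DsD !DsZ; exact: (young_convex yg).
Qed.

Lemma energy_pow t u : 0 <= t <= 1 -> measurable_fun setT u ->
  (energy (fun x => t * u x)%R <= (t `^ p0)%:E * energy u)%E.
Proof.
move=> t01 mu.
have mcu : measurable_fun setT (fun x => t * u x) by exact: measurable_funM.
have := energy_comb1 mu mu mcu (powR_ge0 t p0) (lexx 0); rewrite mul0e adde0.
by apply => z; rewrite DsZ mul0r addr0; exact: (young_pow yg).
Qed.

(** The part of the energy carried by the pairs whose first point is [x]; it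
    turns estimates at a point of [Omega] into estimates by the energy. *)
Definition fiber (u : V -> R) (x : V) : \bar R :=
  (\int[leb]_y (edens u (x, y))%:E)%E.

Lemma measurable_fiber u : measurable_fun setT u -> measurable_fun setT (fiber u).
Proof.
move=> mu.
apply: (measurable_fun_fubini_tonelli_F (fun z => (edens u z)%:E)) => [|z].
  exact: measurable_edensE.
by rewrite lee_fin edens_ge0.
Qed.

Lemma fiber_ge0 u x : (0 <= fiber u x)%E.
Proof. by apply: integral_ge0 => y _; rewrite lee_fin edens_ge0. Qed.

Lemma fiber_strip u : measurable_fun setT u ->
  (\int[leb2]_(z in Omega `*` setT) (edens u z)%:E = \int[leb]_(x in Omega) fiber u x)%E.
Proof.
move=> mu; have mO := measurable_Omega.
rewrite integral_mkcond /= fubini_tonelli1/=; first last.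
- by apply: erestrict_ge0 => z; rewrite lee_fin edens_ge0.
- apply/(measurable_restrictT _ _).1; first exact: measurableX.
  exact: measurable_edensE.
rewrite [RHS]integral_mkcond.
apply: eq_integral => x _; rewrite /fubini_F patchE; case: ifPn => xO.
  apply: eq_integral => y _; rewrite patchE ifT// inE; split => //.
  by rewrite inE in xO.
rewrite integral0_eq// => y _; rewrite patchE ifF//.
by apply/negP; rewrite inE => -[/= Ox _]; rewrite notin_setE in xO.
Qed.

Lemma fiber_energy u : measurable_fun setT u ->
  (\int[leb]_(x in Omega) fiber u x <= energy u)%E.
Proof.
move=> mu; have mO := measurable_Omega; rewrite -fiber_strip//.
apply: ge0_subset_integral => //.
- exact: measurableX.
- exact: measurable_QOmega.
- exact: measurable_edensE.
- by move=> z _; rewrite lee_fin edens_ge0.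
- by move=> z [/= Oz _] [].
Qed.

(** Lower semicontinuity along almost everywhere convergence, by Fatou. *)
Lemma energy_lsc (u_ : nat -> V -> R) (u : V -> R) (c : \bar R) :
  (forall k, measurable_fun setT (u_ k)) -> measurable_fun setT u ->
  {ae leb, forall x, (u_ ^~ x) @ \oo --> u x} ->
  (forall k, energy (u_ k) <= c)%E -> (energy u <= c)%E.
Proof.
move=> mu_ mu cvg le_c; have mQ := measurable_QOmega.
have -> : energy u = (\int[leb2]_(z in QOmega Omega) limn_einf (fun k => (edens (u_ k) z)%:E))%E.
  apply: ge0_ae_eq_integral => //.
  - exact: measurable_edensE.
  - rewrite /limn_einf; apply: (measurableT_comp (@oppe_measurable R setT)).
    apply: measurable_fun_limn_esup => k.
    by apply: (measurableT_comp (@oppe_measurable R setT)); exact: measurable_edensE.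
  - by move=> z _; rewrite lee_fin edens_ge0.
  - move=> z _; rewrite limn_einf_lim; apply: lime_ge; first exact: is_cvg_einfs.
    apply: nearW => n; apply: le_ereal_inf_tmp => _ [k _ <-].
    by rewrite lee_fin edens_ge0.
  have := ae_pair cvg; apply: filterS => z [c1 c2] _.
  have cz : (edens (u_ k) z)%:E @[k --> \oo] --> (edens u z)%:E.
    apply/cvg_EFin; first by near=> k.
    apply: cvgM; last exact: cvg_cst.
    apply: continuous_cvg; first exact: (young_continuous yg).
    by apply: cvgM; [apply: cvgB|exact: cvg_cst].
  by rewrite is_cvg_limn_einfE; [rewrite (cvg_lim _ cz)|exact: cvgP cz].
apply: (le_trans (fatou _ _ _ _)) => //.
- by move=> k; exact: measurable_edensE.
- by move=> k z _; rewrite lee_fin edens_ge0.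
rewrite limn_einf_lim; apply: lime_le; first exact: is_cvg_einfs.
apply: nearW => n; apply: le_trans (le_c n).
by apply: ereal_inf_lbound; exists n => //=.
Unshelve. all: by end_near. Qed.

End Energy.

(** * Auxiliary facts on integrals, ultrafilters and powers *)

Lemma le_integral_affine d (T : measurableType d) (R : realType)
    (mu : {measure set T -> \bar R}) (D : set T) (f : T -> R) (G : T -> \bar R)
    (a b : R) : measurable D -> measurable_fun D f -> measurable_fun D G ->
  0 <= a -> 0 <= b -> (forall x, D x -> 0 <= f x) ->
  (forall x, D x -> 0 <= G x)%E ->
  (forall x, D x -> (f x)%:E <= a%:E + b%:E * G x)%E ->
  (\int[mu]_(x in D) (f x)%:E <= a%:E * mu D + b%:E * \int[mu]_(x in D) G x)%E.
Proof.
move=> mD mf mG a0 b0 f0 G0 h.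
rewrite -integral_cst// -ge0_integralZl_EFin// -ge0_integralD//; first last.
- exact: measurable_funeM.
- by move=> x Dx; rewrite mule_ge0// G0.
apply: ge0_le_integral => //; first exact/measurable_EFinP.
by apply: emeasurable_funD => //; exact: measurable_funeM.
Qed.

(** The image ultrafilter lives in a segment, so it converges by compactness. *)
Lemma ultra_cauchy (R : realType) (F : set_system nat) (a : nat -> R) (B e : R) :
  UltraFilter F -> (forall n, `|a n| <= B) -> 0 < e ->
  exists2 A, F A & forall n m, A n -> A m -> `|a n - a m| <= e.
Proof.
move=> UF aB e0.
have cB : compact `[- B, B] by exact: segment_compact.
have aF : (a @ F) `[- B, B]%classic.
  have : F (a @^-1` `[- B, B]%classic).
    by apply: filterE => n; rewrite /= in_itv /= -ler_norml.
  exact.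
have [p [_ clp]] := cB (a @ F) _ aF.
have e20 : 0 < e / 2 by rewrite divr_gt0.
have nb : nbhs p (ball p (e / 2)) by exact: nbhsx_ballx.
exists (a @^-1` ball p (e / 2)).
  have [//|h] := in_ultra_setVsetC (a @^-1` ball p (e / 2)) UF.
  have [y [ny py]] := clp (~` ball p (e / 2)) _ h nb.
  by exfalso; exact: ny py.
move=> n m /= pn pm; have := ball_splitr pn pm; rewrite /ball /= => h.
exact: ltW.
Qed.

Section PowerConvexity.
Variable R : realType.
Implicit Types q a b : R.

(** The derivative of [|a|^q / q]. *)
Definition dpow q a : R := `|a| `^ (q - 2) * a.

Lemma norm_dpow q a : 1 < q -> `|dpow q a| = `|a| `^ (q - 1).
Proof.
move=> q1; rewrite /dpow normrM (ger0_norm (powR_ge0 _ _)).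
have [->|a0] := eqVneq a 0.
  by rewrite normr0 mulr0 powR0// gt_eqF// subr_gt0.
have na : 0 < `|a| by rewrite normr_gt0.
rewrite -[X in _ * X](powRr1 (normr_ge0 a)) -powRDp//.
by congr (_ `^ _); ring.
Qed.

Lemma dpowM q a : 1 < q -> dpow q a * a = `|a| `^ q.
Proof.
move=> q1; have [->|a0] := eqVneq a 0.
  by rewrite mulr0 normr0 powR0// gt_eqF// (lt_trans ltr01).
have na : 0 < `|a| by rewrite normr_gt0.
rewrite /dpow -mulrA -expr2 -real_normK ?num_real// -powR_mulrn// -powRDp//.
by rewrite subrK.
Qed.

(** Young's inequality for the exponents [q / (q - 1)] and [q]. *)
Lemma power_young q a b : 1 < q ->
  `|a| `^ (q - 1) * `|b| <= (1 - q^-1) * `|a| `^ q + `|b| `^ q / q.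
Proof.
move=> q1; have q0 : 0 < q by exact: lt_trans q1.
have q10 : 0 < q - 1 by rewrite subr_gt0.
have := @conjugate_powR R (`|a| `^ (q - 1)) `|b| (q / (q - 1)) q.
rewrite powR_ge0 normr_ge0 divr_gt0// q0 => /(_ isT isT isT isT).
have -> : (q / (q - 1))^-1 + q^-1 = 1 by field; rewrite !gt_eqF.
have -> : (`|a| `^ (q - 1)) `^ (q / (q - 1)) = `|a| `^ q.
  by rewrite -powRrM mulrC divfK// gt_eqF.
have -> : `|a| `^ q / (q / (q - 1)) = (1 - q^-1) * `|a| `^ q.
  by field; rewrite !gt_eqF.
by apply.
Qed.

(** The tangent inequality of the convex function [|.|^q / q]. *)
Lemma pow_grad q a b : 1 < q ->
  dpow q a * (b - a) <= `|b| `^ q / q - `|a| `^ q / q.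
Proof.
move=> q1; rewrite mulrBr dpowM//.
have h : dpow q a * b <= `|a| `^ (q - 1) * `|b|.
  by rewrite -norm_dpow// -normrM ler_norm.
have := power_young a b q1; lra.
Qed.

Lemma pow_increment q a b : 1 < q ->
  `|a| `^ q / q - `|b| `^ q / q <= (`|a| `^ (q - 1) + `|b| `^ (q - 1)) * `|a - b|.
Proof.
move=> q1; have := pow_grad a b q1.
have : dpow q a * (a - b) <= `|a| `^ (q - 1) * `|a - b|.
  by rewrite -norm_dpow// -normrM ler_norm.
have : 0 <= `|b| `^ (q - 1) * `|a - b| by rewrite mulr_ge0// powR_ge0.
lra.
Qed.

(** The tangents at [a] and [b] bound the convexity defect by the derivatives at
    these points times the distance. *)
Lemma pow_midpoint q a b : 1 < q ->
  (`|a| `^ q / q + `|b| `^ q / q) / 2 - `|(a + b) / 2| `^ q / q <=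
    (`|a| `^ (q - 1) + `|b| `^ (q - 1)) * `|a - b|.
Proof.
move=> q1; have ha := pow_grad a ((a + b) / 2) q1; have hb := pow_grad b ((a + b) / 2) q1.
have h1 : dpow q a * (a - b) <= `|a| `^ (q - 1) * `|a - b|.
  by rewrite -norm_dpow// -normrM ler_norm.
have h2 : dpow q b * (b - a) <= `|b| `^ (q - 1) * `|a - b|.
  by rewrite -norm_dpow// distrC -normrM ler_norm.
have : 0 <= (`|a| `^ (q - 1) + `|b| `^ (q - 1)) * `|a - b|.
  by rewrite mulr_ge0// addr_ge0// powR_ge0.
have e1 : dpow q a * ((a + b) / 2 - a) = - (dpow q a * (a - b)) / 2 by field.
have e2 : dpow q b * ((a + b) / 2 - b) = - (dpow q b * (b - a)) / 2 by field.
rewrite e1 in ha; rewrite e2 in hb; lra.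
Qed.

(** Splitting at the level [M]: below it the powers are bounded, above it they
    are absorbed by the top power. *)
Lemma pow_split q qp M a b : 1 < q -> q <= qp -> 1 <= M ->
  (`|a| `^ (q - 1) + `|b| `^ (q - 1)) * `|a - b| <=
    2 * M `^ qp * `|a - b| +
    4 * ((if M < `|a| then `|a| `^ qp else 0) + (if M < `|b| then `|b| `^ qp else 0)).
Proof.
move=> q1 qqp M1; have q10 : 0 <= q - 1 by lra.
have M0 : 0 <= M by lra.
have pM (c : R) : `|c| <= M -> `|c| `^ (q - 1) <= M `^ qp.
  move=> cM; apply: (@le_trans _ _ (M `^ (q - 1))).
    by rewrite ge0_ler_powR ?nnegrE.
  by rewrite ler_powR//; lra.
have big (c : R) : M < `|c| -> `|c| `^ (q - 1) * `|c| <= `|c| `^ qp.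
  move=> Mc; have c0 : 0 < `|c| by lra.
  rewrite -[X in _ * X](powRr1 (normr_ge0 c)) -powRDp// subrK ler_powR//.
  by lra.
have mono (c d : R) : `|c| <= `|d| -> `|c| `^ (q - 1) <= `|d| `^ (q - 1).
  by move=> cd; rewrite ge0_ler_powR ?nnegrE.
have key (c d : R) : M < `|c| -> `|d| <= `|c| ->
    (`|c| `^ (q - 1) + `|d| `^ (q - 1)) * `|c - d| <= 4 * `|c| `^ qp.
  move=> Mc dc; apply: (@le_trans _ _ ((2 * `|c| `^ (q - 1)) * (2 * `|c|))).
    apply: ler_pM => //; first by have := mono _ _ dc; lra.
    by apply: (le_trans (ler_normB _ _)); lra.
  by have := big _ Mc; lra.
have p0 (c : R) : 0 <= (if M < `|c| then `|c| `^ qp else 0).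
  by case: ifP => // _; exact: powR_ge0.
have t0 : 0 <= 2 * M `^ qp * `|a - b| by rewrite mulr_ge0// mulr_ge0// powR_ge0.
have [aM|Ma] := leP `|a| M; have [bM|Mb] := leP `|b| M.
- rewrite addr0 mulr0 addr0 ler_wpM2r//.
  by have := pM _ aM; have := pM _ bM; lra.
- have := key b a Mb (le_trans aM (ltW Mb)); rewrite distrC [X in X * _]addrC; lra.
- have := key a b Ma (le_trans bM (ltW Ma)); lra.
- have pa := powR_ge0 `|a| qp; have pb := powR_ge0 `|b| qp.
  have [ab|ba] := leP `|a| `|b|.
    have := key b a Mb ab; rewrite distrC [X in X * _]addrC; lra.
  have := key a b Ma (ltW ba); lra.
Qed.

End PowerConvexity.

Section RealIntegrable.
Context d (T : measurableType d) (R : realType).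
Variables (mu : {measure set T -> \bar R}) (D : set T).
Hypothesis mD : measurable D.
Implicit Types f g : T -> R.

Lemma integrableD_EFin f g : mu.-integrable D (EFin \o f) ->
  mu.-integrable D (EFin \o g) -> mu.-integrable D (EFin \o (fun x => f x + g x)).
Proof. by move=> fi gi; exact: (integrableD mD fi gi). Qed.

Lemma integrableB_EFin f g : mu.-integrable D (EFin \o f) ->
  mu.-integrable D (EFin \o g) -> mu.-integrable D (EFin \o (fun x => f x - g x)).
Proof. by move=> fi gi; exact: (integrableB mD fi gi). Qed.

Lemma integrableZ_EFin k f : mu.-integrable D (EFin \o f) ->
  mu.-integrable D (EFin \o (fun x => k * f x)).
Proof. by move=> fi; exact: (integrableZl mD k fi). Qed.

End RealIntegrable.

Lemma measurable_powR2 d (T : measurableType d) (R : realType) (D : set T)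
    (f g : T -> R) : measurable D -> measurable_fun D f -> measurable_fun D g ->
  measurable_fun D (fun x => f x `^ g x).
Proof.
move=> mD mf mg; rewrite /powR.
have mf0 : measurable_fun D (fun x => f x == 0).
  by apply: measurable_fun_eqr => //; exact: measurable_cst.
have mS b : measurable (D `&` (fun x => f x == 0) @^-1` [set b]) by exact: mf0.
apply: measurable_fun_if => //.
  apply: measurableT_comp => //; apply: measurable_fun_eqr; last exact: measurable_cst.
  by apply: measurable_funS mg => //; exact: subIsetl.
apply: measurableT_comp => //; apply: measurable_funM.
  by apply: measurable_funS mg => //; exact: subIsetl.
apply: measurableT_comp => //.
by apply: measurable_funS mf => //; exact: subIsetl.
Qed.

(** The series of the consecutive distances has a finite integral, so it
    converges almost everywhere, and the sequence telescopes. *)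
Lemma fast_L1_cvg d (T : measurableType d) (R : realType)
    (mu : {measure set T -> \bar R}) (D : set T) (w : nat -> T -> R) :
  measurable D -> (forall k, measurable_fun D (w k)) ->
  (forall k, \int[mu]_(x in D) `|w k.+1 x - w k x|%:E <= (2^-1 ^+ k)%:E)%E ->
  {ae mu, forall x, D x -> cvgn (w ^~ x)}.
Proof.
move=> mD mw hw.
pose g k x := `|w k.+1 x - w k x|%:E.
have mg k : measurable_fun D (g k).
  apply/measurable_EFinP; apply: measurableT_comp => //; exact: measurable_funB.
have g0 k x : D x -> (0 <= g k x)%E by rewrite lee_fin.
have mG : measurable_fun D (fun x => (\sum_(0 <= k <oo) g k x)%E).
  by apply: ge0_emeasurable_sum => [k x Dx _|k _]; [exact: g0|exact: mg].
have G0 x : (0 <= \sum_(0 <= k <oo) g k x)%E.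
  by apply: nneseries_ge0 => k _ _; rewrite lee_fin.
have intG : (\int[mu]_(x in D) (\sum_(0 <= k <oo) g k x) < +oo)%E.
  rewrite integral_nneseries//.
  apply: (@le_lt_trans _ _ 2%:E); last exact: ltry.
  apply: lime_le.
    by apply: is_cvg_nneseries => k _ _; apply: integral_ge0 => x _; rewrite lee_fin.
  apply: nearW => n; apply: (@le_trans _ _ (\sum_(0 <= k < n) (2^-1 ^+ k)%:E)%E).
    by apply: lee_sum => k _; exact: hw.
  rewrite sumEFin lee_fin.
  have : \sum_(0 <= k < n) 2^-1 ^+ k = 2 - 2 * 2^-1 ^+ n :> R.
    elim: n => [|n IH]; first by rewrite big_nil expr0 mulr1 subrr.
    by rewrite big_nat_recr//= IH exprS; field.
  move=> ->; have : 0 <= 2^-1 ^+ n :> R by rewrite exprn_ge0.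
  by lra.
have iG : mu.-integrable D (fun x => (\sum_(0 <= k <oo) g k x)%E).
  apply/integrableP; split => //.
  by under eq_integral do rewrite gee0_abs//.
have := integrable_ae mD iG; apply: filterS => x Gx Dx.
have {}Gx := Gx Dx.
pose a k := w k.+1 x - w k x.
have ca : cvgn [normed series a].
  apply: nondecreasing_is_cvgn.
    apply/nondecreasing_seqP => n; rewrite /= !seriesEnat /= big_nat_recr//=.
    by rewrite lerDl.
  exists (fine (\sum_(0 <= k <oo) g k x)%E) => _ [n _ <-].
  rewrite -lee_fin fineK//.
  have -> : [normed series a] n = \sum_(0 <= k < n) `|a k| by rewrite /= seriesEnat.
  rewrite -sumEFin.
  apply: (@nneseries_lim_ge _ (fun k => g k x) xpredT 0 n) => k _.
  by rewrite lee_fin.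
have := normed_cvg ca.
have -> : series a = (fun n => w n x - w 0 x).
  apply/funext => n; rewrite seriesEnat /=.
  by rewrite telescope_sumr.
move=> cs; have -> : w ^~ x = (fun n => (w n x - w 0 x) + w 0 x).
  by apply/funext => n; rewrite subrK.
by apply: is_cvgD => //; exact: is_cvg_cst.
Qed.

(** * Poincare and Sobolev estimates *)

Section Embedding.
Variables (R : realType) (N : nat) (s : R) (Omega : set 'rV[R]_N) (L : R).
Notation V := ('rV[R]_N).
Notation leb := (lebesgue_rV R N).
Notation leb2 := (lebesgue_rV R N \x lebesgue_rV R N)%E.
Implicit Types (u v w : V -> R) (z : V * V).
Hypothesis N1 : (1 <= N)%N.
Hypothesis s01 : 0 < s < 1.
Hypothesis Omega_open : open Omega.
Hypothesis L0 : 0 < L.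
Hypothesis Omega_cbox : Omega `<=` cbox 0 L.
Variables (Psi psi : R -> R) (P K p0 : R).
Hypothesis yg : young Psi psi P K p0.
Notation energy := (energy s Omega Psi).
Notation edens := (edens s Psi).
Notation fiber := (fiber s Psi).

Let s0 : 0 < s. Proof. by case/andP: s01. Qed.
Let N0 : 0 < N%:R :> R. Proof. by rewrite ltr0n. Qed.
Let mO : measurable Omega. Proof. exact: measurable_Omega. Qed.

(** Membership in the space apart from the approximation by test functions. *)
Definition admissible u := measurable_fun setT u /\
  {ae leb, forall x, ~ Omega x -> u x = 0}.

Lemma leb_Omega_le : (leb Omega <= ((2 * L) ^+ N)%:E)%E.
Proof.
rewrite -(leb_cbox (0 : V) (ltW L0)).
exact: (le_measure leb (mem_set mO) (mem_set (measurable_cbox 0 L)) Omega_cbox).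
Qed.

Lemma leb_Omega_fin : leb Omega \is a fin_num.
Proof. by rewrite ge0_fin_numE// (le_lt_trans leb_Omega_le)// ltry. Qed.

(** Closeness of [x] and [y] makes both the quotient and the density large. *)
Lemma edens_lower u (x y : V) (t D : R) : x != y -> 0 < D -> 0 <= t ->
  enorm (x - y) <= D -> t <= `|u x - u y| ->
  Psi (t / D `^ s) / D ^+ N <= edens u (x, y).
Proof.
move=> xy D0 t0 xyD tu; have e0 := enorm_gt0 xy.
rewrite /edens /Defs.mu_density /=; apply: ler_pM.
- exact: (young_ge0 yg).
- by rewrite invr_ge0 exprn_ge0// ltW.
- apply: (young_le yg); rewrite /Ds /= normrM [leRHS]normrM.
  rewrite (ger0_norm t0) !normfV !(ger0_norm (powR_ge0 _ _)).
  rewrite ler_pM ?invr_ge0 ?powR_ge0//.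
  rewrite lef_pV2 ?posrE ?powR_gt0// ge0_ler_powR ?nnegrE ?(ltW s0) ?(ltW e0) ?(ltW D0)//.
- by rewrite lef_pV2 ?posrE ?exprn_gt0// lerXn2r ?nnegrE ?(ltW e0) ?(ltW D0).
Qed.

Lemma measurable_edens_fiber u x : measurable_fun setT u ->
  measurable_fun setT (fun y => edens u (x, y)).
Proof.
by move=> mu; apply: (measurableT_comp (measurable_edens s yg mu)); exact: pair1_measurable.
Qed.

Lemma fiber_lower u x (B : set V) (k : R) : measurable_fun setT u ->
  measurable B -> 0 <= k -> {ae leb, forall y, B y -> k <= edens u (x, y)} ->
  (k%:E * leb B <= fiber u x)%E.
Proof.
move=> mu mB k0 h; rewrite -integral_cst//.
have md := measurable_edens_fiber x mu.
apply: (@le_trans _ _ (\int[leb]_(y in B) (edens u (x, y))%:E)%E).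
  apply: ae_ge0_le_integral => //.
  - by move=> y _; rewrite lee_fin (edens_ge0 _ yg).
  - by apply/measurable_EFinP; exact: measurable_funTS.
apply: ge0_subset_integral => //.
- exact/measurable_EFinP.
- by move=> y _; rewrite lee_fin (edens_ge0 _ yg).
Qed.

(** The points of a box far away from [Omega] carry the value 0 and are at
    bounded distance from [Omega]. *)
Lemma poincare : exists2 C : R, 0 <= C &
  forall u, admissible u ->
  (\int[leb]_(x in Omega) `|u x|%:E <= C%:E + C%:E * energy u)%E.
Proof.
(* The box of centre [c] and radius [L] is disjoint from [cbox 0 L], and the
   coordinates of a point in each differ by at most [6 * L]. *)
pose c : V := \row_i (4 * L); pose D := N%:R * (6 * L).
have D0 : 0 < D by rewrite mulr_gt0// mulr_gt0.
have Psi1 := young_gt0 yg ltr01.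
pose l := (2 * L) ^+ N; have l0 : 0 < l by rewrite exprn_gt0// mulr_gt0.
pose C1 := D `^ s; pose C2 := D `^ s * (D ^+ N / l / Psi 1).
have C10 : 0 <= C1 by exact: powR_ge0.
have C20 : 0 <= C2.
  apply: mulr_ge0; first exact: powR_ge0.
  by apply: divr_ge0; [apply: divr_ge0; [apply: exprn_ge0|]|]; exact: ltW.
exists (C1 * l + C2); first by rewrite addr_ge0// mulr_ge0// ltW.
move=> u [mu u0].
have H x : Omega x -> (`|u x|%:E <= C1%:E + C2%:E * fiber u x)%E.
  move=> Ox.
  have hf : ((Psi (`|u x| / D `^ s) / D ^+ N)%:E * l%:E <= fiber u x)%E.
    rewrite -(leb_cbox c (ltW L0)); apply: fiber_lower => //.
    - exact: measurable_cbox.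
    - by rewrite divr_ge0 ?exprn_ge0 ?(ltW D0)// (young_ge0 yg).
    apply: filterS u0 => y uy By.
    have xy i : `|y ord0 i| > L /\ `|x ord0 i - y ord0 i| <= 6 * L.
      have := By i; have := Omega_cbox Ox i; rewrite !mxE sub0r normrN.
      rewrite !ler_norml => /andP[x1 x2] /andP[y1 y2].
      split; last by apply/andP; split; lra.
      have y3 : 3 * L <= y ord0 i by lra.
      rewrite ltr_normr; apply/orP; left; apply: lt_le_trans y3.
      by rewrite ltr_pMl// ltr1n.
    have nOy : ~ Omega y.
      move=> /Omega_cbox/(_ (Ordinal N1)); rewrite mxE sub0r normrN.
      by rewrite leNgt (xy _).1.
    apply: edens_lower => //.
    - by apply/eqP => exy; apply: nOy; rewrite -exy.
    - apply: enorm_le => [|i]; first by rewrite mulr_ge0// ltW.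
      by rewrite !mxE (xy i).2.
    - by rewrite (uy nOy) subr0.
  have h1 : `|u x| <= C1 + C2 * (Psi (`|u x| / D `^ s) / D ^+ N * l).
    have := young_linear yg (`|u x| / D `^ s).
    have Ds0 : 0 < D `^ s by rewrite powR_gt0.
    rewrite ger0_norm ?divr_ge0 ?(ltW Ds0)// ler_pdivrMr// => h.
    rewrite /C2 /C1; apply: (le_trans h); rewrite mulrC mulrDr mulr1 lerD2l.
    rewrite le_eqVlt; apply/orP; left; apply/eqP; field.
    by rewrite !gt_eqF//= ?exprn_gt0.
  apply: (@le_trans _ _ (C1%:E + C2%:E * ((Psi (`|u x| / D `^ s) / D ^+ N)%:E * l%:E))%E).
    by rewrite -!EFinM -EFinD lee_fin.
  by rewrite leeD2l// lee_wpmul2l.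
have := @le_integral_affine _ _ R leb Omega (fun x => `|u x|) (fiber u) C1 C2 mO.
move=> /(_ _ _ C10 C20 _ _ H) h; apply: (le_trans (h _ _ _ _)).
- apply: measurable_funTS; exact: measurableT_comp.
- by apply: measurable_funTS; exact: (measurable_fiber s yg).
- by [].
- by move=> x _; exact: (fiber_ge0 s yg).
rewrite leeD//.
  apply: (@le_trans _ _ (C1%:E * l%:E)%E); first by rewrite lee_wpmul2l// leb_Omega_le.
  by rewrite -EFinM lee_fin lerDl.
rewrite lee_pmul//.
- by apply: integral_ge0 => x _; exact: (fiber_ge0 s yg).
- by rewrite lee_fin lerDr mulr_ge0// ltW.
- exact: (fiber_energy s Omega_open yg).
Qed.

Variable q : R.
Hypothesis q1 : 1 < q.
Let sg : R := q^-1 + s / N%:R.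
Let th : R := s / N%:R / sg.
Hypothesis growth : forall A : R, 0 < A -> exists2 T : R, 0 < T &
  forall r : R, T <= r -> A * r `^ sg^-1 <= Psi r.
Let q0 : 0 < q. Proof. exact: lt_trans q1. Qed.
Let sg0 : 0 < sg. Proof. by rewrite addr_gt0 ?invr_gt0// divr_gt0. Qed.

Lemma measurable_powq D u : measurable_fun setT u ->
  measurable_fun D (fun x => `|u x| `^ q).
Proof.
move=> mu; apply: measurable_funTS; apply: (measurableT_comp (measurable_powR q)).
exact: measurableT_comp.
Qed.

Definition level u (t : R) : set V := [set y | t < `|u y|].

Lemma measurable_level u (t : R) : measurable_fun setT u ->
  measurable (level u t).
Proof.
move=> mu; rewrite -[X in measurable X]setTI.
have mn : measurable_fun setT (fun y => `|u y|) by exact: measurableT_comp.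
have := mn measurableT `]t, +oo[%classic (measurable_itv _).
by congr measurable; apply/seteqP; split => y /=; rewrite in_itv /= andbT.
Qed.

(** Chebyshev's inequality, on the whole space because [u] vanishes outside
    [Omega]. *)
Lemma level_measure u (S t : R) : admissible u -> 0 < t ->
  (\int[leb]_(x in Omega) (`|u x| `^ q)%:E <= S%:E)%E ->
  (leb (level u t) <= (S * t `^ (- q))%:E)%E.
Proof.
move=> [mu u0] t0 hS; set B := level u t.
have mB : measurable B by exact: measurable_level.
have mBO : measurable (Omega `&` B) by exact: measurableI.
have tq : 0 < t `^ q by rewrite powR_gt0.
have h1 : ((t `^ q)%:E * leb (Omega `&` B) <= S%:E)%E.
  apply: (fun h => le_trans h hS); rewrite -integral_cst//.
  apply: (@le_trans _ _ (\int[leb]_(x in Omega `&` B) (`|u x| `^ q)%:E)%E).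
    apply: ge0_le_integral => //.
    - by move=> x _; rewrite lee_fin ltW.
    - by apply/measurable_EFinP; exact: measurable_powq.
    - move=> x [_ /= tx]; rewrite lee_fin ge0_ler_powR ?nnegrE ?(ltW q0) ?(ltW t0)//.
      exact: ltW.
  apply: ge0_subset_integral => //.
  by apply/measurable_EFinP; exact: measurable_powq.
have h2 : (leb B <= leb (Omega `&` B))%E.
  case: u0 => Z [mZ Z0 uZ].
  apply: (@le_trans _ _ (leb ((Omega `&` B) `|` Z))).
    apply: le_measure; rewrite ?inE//; first exact: measurableU.
    move=> y By; have [Oy|nOy] := pselect (Omega y); first by left.
    right; apply: uZ => /= /(_ nOy) h; move: By; rewrite /B /level /= h normr0.
    by rewrite ltNge (ltW t0).
  by apply: (le_trans (measureU2 _ _ _)) => //; rewrite [X in (_ + X)%E]Z0 adde0.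
apply: (le_trans h2); by rewrite powRN mulrC EFinM lee_pdivlMl.
Qed.

(** Around a point [x] with [t = |u x|], the box of volume
    [2 * 2^q * S / t^q] has at least half of its points at level at most t/2. *)
Lemma fiber_sobolev u (S t : R) x : admissible u -> 0 < S -> 0 < t -> t = `|u x| ->
  (\int[leb]_(x in Omega) (`|u x| `^ q)%:E <= S%:E)%E ->
  let rho := 2 * 2 `^ q * S * t `^ (- q) in
  ((Psi (t / 2 / (N%:R / 2 * rho `^ N%:R^-1) `^ s) / (2 * (N%:R / 2) ^+ N))%:E
     <= fiber u x)%E.
Proof.
move=> adm S0 t0 tE hS; have [mu u0] := adm; set rho := 2 * _ * S * _.
rewrite /=.
have rho0 : 0 < rho by rewrite !mulr_gt0// powR_gt0.
pose r := rho `^ N%:R^-1 / 2.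
have r0 : 0 < r by rewrite divr_gt0// powR_gt0.
have rN : (2 * r) ^+ N = rho.
  rewrite /r mulrCA mulfV// mulr1 -powR_mulrn ?powR_ge0// -powRrM.
  by rewrite mulVf ?gt_eqF// powRr1// ltW.
pose B := level u (t / 2).
have mB : measurable B by exact: measurable_level.
have t20 : 0 < t / 2 by rewrite divr_gt0.
have lB : (leb B <= (rho / 2)%:E)%E.
  apply: (le_trans (level_measure adm t20 hS)); rewrite lee_fin powR_divN//.
  by rewrite opprK /rho le_eqVlt; apply/orP; left; apply/eqP; field.
pose G := cbox x r `\` B.
have mG : measurable G by apply: measurableD => //; exact: measurable_cbox.
have lG : ((rho / 2)%:E <= leb G)%E.
  have : (rho%:E <= leb G + (rho / 2)%:E)%E.
    rewrite -rN -(leb_cbox x (ltW r0)) rN.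
    apply: (@le_trans _ _ (leb (G `|` B))).
      apply: le_measure; rewrite ?inE//; [exact: measurable_cbox|exact: measurableU|].
      by move=> y xy; have [|] := pselect (B y); [right|left].
    by apply: (le_trans (measureU2 _ _ _)) => //; rewrite leeD2l.
  by rewrite -leeBlDr// -EFinB; apply: le_trans; rewrite lee_fin; lra.
have NrE : N%:R * r = N%:R / 2 * rho `^ N%:R^-1 by rewrite /r; ring.
rewrite -NrE; have Nr0 : 0 < N%:R * r by rewrite mulr_gt0.
set w := t / 2 / _.
have Pw : 0 <= Psi w by exact: (young_ge0 yg).
have Pk : 0 <= Psi w / (N%:R * r) ^+ N by rewrite divr_ge0// exprn_ge0// ltW.
apply: (@le_trans _ _ ((Psi w / (N%:R * r) ^+ N)%:E * (rho / 2)%:E)%E).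
  have -> : (N%:R * r) ^+ N = (N%:R / 2) ^+ N * rho.
    by rewrite -rN -exprMn; congr (_ ^+ _); field.
  have k0 : 0 < (N%:R / 2) ^+ N :> R by rewrite exprn_gt0// divr_gt0.
  rewrite -EFinM lee_fin; move: k0; set k := (N%:R / 2) ^+ N => k0.
  rewrite le_eqVlt; apply/orP; left; apply/eqP; field.
  by rewrite !gt_eqF.
apply: (@le_trans _ _ ((Psi w / (N%:R * r) ^+ N)%:E * leb G)%E).
  by rewrite lee_wpmul2l// lee_fin.
apply: fiber_lower => //; apply: aeW => y [xy /negP]; rewrite -leNgt => uy.
have tu : t / 2 <= `|u x - u y|.
  have := ler_normD (u x - u y) (u y); rewrite subrK -tE; lra.
apply: edens_lower => //; last exact: enorm_cbox (ltW r0) xy.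
- by apply/eqP => exy; move: tu; rewrite exy subrr normr0; lra.
- exact: ltW.
Qed.

(** With [rho] as in [fiber_sobolev] the argument of [Psi] is a constant times
    [(t^q / S^th)^sg], so the growth [Psi w >= A * w^(1/sg)] bounds [t^q] by
    [S^th] times the fiber; [A] is arbitrary, hence so is [eps]. *)
Lemma sobolev_pointwise (eps : R) : 0 < eps -> exists2 M, 0 < M &
  forall u (S : R), admissible u -> 0 < S ->
  (\int[leb]_(x in Omega) (`|u x| `^ q)%:E <= S%:E)%E ->
  forall x, M * S `^ th <= `|u x| `^ q ->
  ((`|u x| `^ q)%:E <= (eps * S `^ th)%:E * fiber u x)%E.
Proof.
move=> eps0; pose C1 : R := 2 * (N%:R / 2) ^+ N.
have C10 : 0 < C1 by rewrite mulr_gt0// exprn_gt0// divr_gt0.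
pose k0 : R := (2 * ((N%:R / 2) `^ s * (2 * 2 `^ q) `^ (s / N%:R)))^-1.
have Ns0 : 0 < (N%:R / 2) `^ s by rewrite powR_gt0// divr_gt0.
have c20 : 0 < 2 * 2 `^ q :> R by rewrite mulr_gt0// powR_gt0.
have c2s : 0 < (2 * 2 `^ q) `^ (s / N%:R) :> R by rewrite powR_gt0.
have k00 : 0 < k0 by rewrite invr_gt0 !mulr_gt0.
pose k1 := k0 `^ sg^-1; have k10 : 0 < k1 by rewrite powR_gt0.
have [T T0 hT] := growth (divr_gt0 C10 (mulr_gt0 k10 eps0)).
exists (T `^ sg^-1 / k1); first by rewrite divr_gt0// powR_gt0.
move=> u S adm S0 hS x hx.
have Sth : 0 < S `^ th by rewrite powR_gt0.
have t0 : 0 < `|u x|.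
  rewrite normr_gt0; apply/eqP => ux; move: hx; rewrite ux normr0 powR0 ?gt_eqF//.
  by rewrite leNgt mulr_gt0// divr_gt0// powR_gt0.
set t := `|u x| in t0 hx *.
have := fiber_sobolev adm S0 t0 erefl hS.
rewrite /= -/t; set rho := 2 * _ * S * _.
set w := t / 2 / (_ `^ _) => hf.
have wE : w = k0 * t `^ (q * sg) * S `^ (- (s / N%:R)).
  have e1 : (N%:R / 2 * rho `^ N%:R^-1) `^ s = (N%:R / 2) `^ s *
      ((2 * 2 `^ q) `^ (s / N%:R) * S `^ (s / N%:R) * (t `^ (q * (s / N%:R)))^-1).
    rewrite [LHS]powRM ?powR_ge0 ?divr_ge0 ?(ltW N0)//; congr (_ * _).
    rewrite -powRrM [N%:R^-1 * s]mulrC /rho.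
    have c30 : 0 <= 2 * 2 `^ q * S by rewrite mulr_ge0 ?(ltW S0) ?(ltW c20).
    rewrite [LHS](powRM _ c30 (powR_ge0 _ _)) (powRM _ (ltW c20) (ltW S0)).
    by rewrite -[(t `^ (- q)) `^ _]powRrM mulNr powRN.
  have e2 : t `^ (q * sg) = t * t `^ (q * (s / N%:R)).
    by rewrite /sg mulrDr mulfV ?gt_eqF// (powRDp _ _ t0) powRr1 ?(ltW t0).
  rewrite /w e1 e2 /k0 powRN; field.
  by rewrite !gt_eqF ?powR_gt0 ?divr_gt0.
have w0 : 0 < w by rewrite wE !mulr_gt0// powR_gt0.
have wsg : w `^ sg^-1 = k1 * (t `^ q / S `^ th).
  rewrite wE !powRM ?mulr_ge0 ?powR_ge0 ?(ltW k00)// -!powRrM -mulrA.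
  by rewrite mulfK ?gt_eqF// mulNr -/th powRN.
have Tw : T <= w.
  apply: (@powR_le_inv _ sg^-1); rewrite ?invr_gt0 ?(ltW w0)//.
  by rewrite wsg -ler_pdivrMl// [_^-1 * _]mulrC ler_pdivlMr.
have := hT _ Tw; rewrite wsg => hP.
have h3 : t `^ q <= eps * S `^ th * (Psi w / C1).
  rewrite -ler_pdivrMl ?mulr_gt0// ler_pdivlMr//; apply: le_trans hP.
  rewrite le_eqVlt; apply/orP; left; apply/eqP; field.
  by rewrite !gt_eqF.
apply: (@le_trans _ _ ((eps * S `^ th)%:E * (Psi w / C1)%:E)%E).
  by rewrite -EFinM lee_fin.
by rewrite lee_wpmul2l// lee_fin mulr_ge0// ltW.
Qed.

(** Integrating the pointwise estimate gives [S <= B * S^th] with [th < 1], which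
    bounds [S] as soon as it is finite. *)
Lemma poly_level (R0 : R) : 0 <= R0 -> exists2 C, 0 < C &
  forall u (S : R), admissible u -> (energy u <= R0%:E)%E ->
  (\int[leb]_(x in Omega) (`|u x| `^ q)%:E = S%:E)%E -> S <= C.
Proof.
move=> R00; have [M M0 hM] := sobolev_pointwise ltr01.
pose l : R := (2 * L) ^+ N.
have l0 : 0 < l by rewrite exprn_gt0// mulr_gt0.
pose B := M * l + R0.
have B0 : 0 < B by rewrite ltr_wpDr// mulr_gt0.
have sN : 0 < s / N%:R by rewrite divr_gt0.
have th1 : 0 < 1 - th.
  by rewrite subr_gt0 /th ltr_pdivrMr// mul1r /sg ltrDr invr_gt0.
exists (B `^ (1 - th)^-1); first by rewrite powR_gt0.
move=> u S adm eu hS; have [mu u0] := adm.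
have S_ge0 : 0 <= S.
  by rewrite -lee_fin -hS; apply: integral_ge0 => x _; rewrite lee_fin powR_ge0.
have [->|Sn0] := eqVneq S 0; first exact: powR_ge0.
have S0 : 0 < S by rewrite lt_neqAle eq_sym Sn0.
have Sth : 0 < S `^ th by rewrite powR_gt0.
have H x : Omega x ->
    ((`|u x| `^ q)%:E <= (M * S `^ th)%:E + (S `^ th)%:E * fiber u x)%E.
  move=> _; have f0 := fiber_ge0 s yg u x.
  have hS' : (\int[leb]_(x in Omega) (`|u x| `^ q)%:E <= S%:E)%E by rewrite hS.
  have [h|h] := leP (M * S `^ th) (`|u x| `^ q).
    apply: (le_trans (hM u S adm S0 hS' x h)); rewrite mul1r leeDr// lee_fin.
    by rewrite mulr_ge0// ltW.
  apply: (@le_trans _ _ (M * S `^ th)%:E); first by rewrite lee_fin ltW.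
  by rewrite leeDl// mule_ge0// lee_fin ltW.
have MS : 0 <= M * S `^ th by rewrite mulr_ge0// ltW.
have mq : measurable_fun Omega (fun x => `|u x| `^ q) by exact: measurable_powq.
have mf : measurable_fun Omega (fiber u).
  by apply: measurable_funTS; exact: (measurable_fiber s yg).
have := le_integral_affine leb mO mq mf MS (ltW Sth) (fun x _ => powR_ge0 _ _)
  (fun x _ => fiber_ge0 s yg u x) H.
rewrite hS => h; have : (S%:E <= (S `^ th * B)%:E)%E.
  apply: (le_trans h).
  apply: (@le_trans _ _ ((M * S `^ th)%:E * l%:E + (S `^ th)%:E * R0%:E)%E).
    apply: leeD; first by rewrite lee_wpmul2l// leb_Omega_le.
    rewrite lee_wpmul2l ?lee_fin ?(ltW Sth)//.
    exact: le_trans (fiber_energy s Omega_open yg mu) eu.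
  by rewrite -!EFinM -EFinD lee_fin /B; lra.
rewrite lee_fin => h2; apply: (powR_le_inv th1); first exact: powR_ge0.
rewrite -powRrM mulVf ?gt_eqF// powRr1 ?(ltW B0)//.
by rewrite powRDp// powRr1 ?(ltW S0)// powRN ler_pdivrMr// mulrC.
Qed.

(** Truncation makes the q-th moment finite and does not increase the energy. *)
Definition clip (k : R) u : V -> R := fun x => Num.max (- k) (Num.min (u x) k).

Lemma clip_dist k u x y : `|clip k u x - clip k u y| <= `|u x - u y|.
Proof.
have minL (a b : R) : `|Num.min a k - Num.min b k| <= `|a - b|.
  have := ler_norm (a - b); have := ler_norm (- (a - b)); rewrite normrN ler_norml.
  by case: (leP a k) => ?; case: (leP b k) => ? ? ?; apply/andP; split; lra.
have maxL (a b : R) : `|Num.max (- k) a - Num.max (- k) b| <= `|a - b|.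
  have := ler_norm (a - b); have := ler_norm (- (a - b)); rewrite normrN ler_norml.
  by case: (leP (- k) a) => ?; case: (leP (- k) b) => ? ? ?; apply/andP; split; lra.
exact: le_trans (maxL _ _) (minL _ _).
Qed.

Lemma clip_le (k : R) u x : 0 <= k -> `|clip k u x| <= k.
Proof.
move=> k0; rewrite /clip ler_norml le_max lexx /= ge_max ge_min lexx orbT andbT.
lra.
Qed.

Lemma clip_id (k : R) u x : `|u x| <= k -> clip k u x = u x.
Proof.
by rewrite ler_norml => /andP[h1 h2]; rewrite /clip min_l// max_r.
Qed.

Lemma clip_admissible (k : R) u : 0 <= k -> admissible u -> admissible (clip k u).
Proof.
move=> k0 [mu u0]; split.
  by apply: measurable_maxr => //; exact: measurable_minr.
by apply: filterS u0 => x h /h ux; rewrite clip_id ux// normr0.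
Qed.

(** The truncations have finite q-th moments, so [poly_level] applies to them. *)
Lemma sobolev (R0 : R) : 0 <= R0 -> exists2 C, 0 < C &
  forall u, admissible u -> (energy u <= R0%:E)%E ->
  (\int[leb]_(x in Omega) (`|u x| `^ q)%:E <= C%:E)%E.
Proof.
move=> /poly_level[C C0 hC]; exists C => // u adm eu; have [mu _] := adm.
pose f (n : nat) x := (`|clip n%:R u x| `^ q)%:E.
have admn n : admissible (clip n%:R u) by exact: clip_admissible.
have fC n : (\int[leb]_(x in Omega) f n x <= C%:E)%E.
  have [mc _] := admn n.
  have ec : (energy (clip n%:R u) <= R0%:E)%E.
    apply: le_trans eu; apply: (energy_le s Omega_open yg mu mc) => x y.
    exact: clip_dist.
  have ffin : (\int[leb]_(x in Omega) f n x)%E \is a fin_num.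
    rewrite ge0_fin_numE; last first.
      by apply: integral_ge0 => x _; rewrite lee_fin powR_ge0.
    apply: (@le_lt_trans _ _ (\int[leb]_(x in Omega) (n%:R `^ q)%:E)%E).
      apply: ge0_le_integral => //.
      - by move=> x _; rewrite lee_fin powR_ge0.
      - by rewrite /f; apply/measurable_EFinP; exact: measurable_powq.
      - move=> x _; rewrite lee_fin ge0_ler_powR ?nnegrE ?(ltW q0)//.
        exact: clip_le.
    rewrite integral_cst//= lte_mul_pinfty//.
    by rewrite -ge0_fin_numE// (leb_Omega_fin).
  rewrite -(fineK ffin) lee_fin; apply: (hC _ _ (admn n) ec).
  by rewrite fineK.
have -> : (\int[leb]_(x in Omega) (`|u x| `^ q)%:E =
    \int[leb]_(x in Omega) limn_einf (f ^~ x))%E.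
  apply: eq_integral => x _.
  have cx : f n x @[n --> \oo] --> (`|u x| `^ q)%:E.
    apply: cvg_near_cst; exists (Num.bound `|u x|) => // n /= hn.
    rewrite /f clip_id//; apply: (le_trans (ltW (archi_boundP _))) => //.
    by rewrite ler_nat.
  by rewrite is_cvg_limn_einfE; [rewrite (cvg_lim _ cx)|exact: cvgP cx].
apply: (le_trans (fatou _ _ _ _)) => //.
- move=> n; rewrite /f; apply/measurable_EFinP; apply: measurable_powq.
  by case: (admn n).
- by move=> n x _; rewrite lee_fin powR_ge0.
rewrite limn_einf_lim; apply: lime_le; first exact: is_cvg_einfs.
apply: nearW => n; apply: le_trans (fC n).
by apply: ereal_inf_lbound; exists n => //=.
Qed.

(** The pointwise estimate with a small [eps], at a level that depends only on
    the Sobolev bound. *)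
Lemma uniform_integrability (R0 eps : R) : 0 <= R0 -> 0 < eps ->
  exists2 M, 0 < M & forall u, admissible u -> (energy u <= R0%:E)%E ->
  (\int[leb]_(x in Omega `&` level u M) (`|u x| `^ q)%:E <= eps%:E)%E.
Proof.
move=> R00 eps0; have [C C0 hC] := sobolev R00.
have Cth : 0 < C `^ th by rewrite powR_gt0.
pose eps1 := eps / (C `^ th * (R0 + 1)).
have R1 : 0 < R0 + 1 by rewrite ltr_wpDl.
have eps10 : 0 < eps1 by rewrite divr_gt0// mulr_gt0.
have [M' M'0 hM'] := sobolev_pointwise eps10.
pose M := (M' * C `^ th) `^ q^-1.
have M0 : 0 < M by rewrite powR_gt0// mulr_gt0.
exists M => // u adm eu; have [mu _] := adm.
have mD : measurable (Omega `&` level u M).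
  by apply: measurableI => //; exact: measurable_level.
have k0 : 0 <= eps1 * C `^ th by rewrite mulr_ge0// ltW.
have H x : (Omega `&` level u M) x ->
    ((`|u x| `^ q)%:E <= 0%:E + (eps1 * C `^ th)%:E * fiber u x)%E.
  move=> [Ox /= Mx]; rewrite add0e; apply: (hM' u C adm C0 (hC u adm eu)).
  have -> : M' * C `^ th = M `^ q.
    by rewrite -powRrM mulVf ?gt_eqF// powRr1// mulr_ge0// ltW.
  by rewrite ge0_ler_powR ?nnegrE ?(ltW q0) ?(ltW M0)// ltW.
have mq : measurable_fun (Omega `&` level u M) (fun x => `|u x| `^ q).
  exact: measurable_powq.
have mf D : measurable_fun D (fiber u).
  by apply: measurable_funTS; exact: (measurable_fiber s yg).
have := le_integral_affine leb mD mq (mf _) (lexx 0) k0 (fun x _ => powR_ge0 _ _)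
  (fun x _ => fiber_ge0 s yg u x) H.
rewrite mul0e add0e => h; apply: (le_trans h).
apply: (@le_trans _ _ ((eps1 * C `^ th)%:E * R0%:E)%E).
  rewrite lee_wpmul2l ?lee_fin//; apply: le_trans eu.
  apply: le_trans (fiber_energy s Omega_open yg mu).
  apply: ge0_subset_integral => //.
  by move=> x _; exact: (fiber_ge0 s yg).
rewrite -EFinM lee_fin /eps1.
have -> : eps / (C `^ th * (R0 + 1)) * C `^ th * R0 = eps * (R0 / (R0 + 1)).
  by field; rewrite !gt_eqF.
by rewrite ler_piMr ?(ltW eps0)// ler_pdivrMr// mul1r lerDl.
Qed.

(** * Compactness in L1 *)

Definition mean u (c : V) (h : R) : R := \int[leb]_(y in cbox c h) u y.

Lemma admissible_integrable u D : admissible u -> (energy u < +oo)%E ->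
  measurable D -> leb.-integrable D (EFin \o u).
Proof.
move=> adm eu mD; have [mu u0] := adm.
suff : leb.-integrable setT (EFin \o u).
  by move=> /(integrableS measurableT mD); apply.
have [C C0 hC] := poincare.
apply/integrableP; split; first exact/measurable_EFinP.
have -> : (\int[leb]_(x in setT) `|(EFin \o u) x| = \int[leb]_(x in Omega) `|u x|%:E)%E.
  rewrite [RHS]integral_mkcond; apply: ge0_ae_eq_integral => //.
  - by apply: measurableT_comp => //; exact/measurable_EFinP.
  - apply/(measurable_restrictT _ _).1 => //; apply: measurable_funTS.
    by apply/measurable_EFinP; exact: measurableT_comp.
  - by move=> x _; apply: erestrict_ge0.
  apply: filterS u0 => x ux _; rewrite patchE; case: ifPn => //.
  by rewrite notin_setE => /ux /= ->; rewrite normr0.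
apply: le_lt_trans (hC u adm) _.
have ef : energy u \is a fin_num by rewrite ge0_fin_numE// (energy_ge0 s Omega yg).
by rewrite -(fineK ef) -EFinM -EFinD ltry.
Qed.

Lemma mean_le u c h (C : R) : admissible u -> (energy u < +oo)%E ->
  (\int[leb]_(x in Omega) `|u x|%:E <= C%:E)%E -> `|mean u c h| <= C.
Proof.
move=> adm eu hC; have [mu u0] := adm.
have mB := measurable_cbox c h.
have iu := admissible_integrable adm eu mB.
apply: (le_trans (le_normr_Rintegral mB iu)).
rewrite -lee_fin /Rintegral fineK; last first.
  by apply: integrable_fin_num => //; exact: integrable_norm.
apply: le_trans hC; rewrite [leRHS]integral_mkcond.
apply: (@le_trans _ _ (\int[leb]_(x in cbox c h) (((fun x => `|u x|%:E) \_ Omega) x))%E).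
  have mn : measurable_fun setT (fun x => `|u x|%:E).
    by apply/measurable_EFinP; exact: measurableT_comp.
  apply: ae_ge0_le_integral => //.
  - exact: measurable_funTS.
  - by move=> x _; apply: erestrict_ge0.
  - by apply: measurable_funTS; apply/(measurable_restrictT _ _).1 => //; exact: measurable_funTS.
  apply: filterS u0 => x ux _; rewrite patchE; case: ifPn => //.
  by rewrite notin_setE => /ux /= ->; rewrite normr0.
apply: ge0_subset_integral => //.
- apply/(measurable_restrictT _ _).1 => //; apply: measurable_funTS.
  by apply/measurable_EFinP; exact: measurableT_comp.
- by move=> x _; apply: erestrict_ge0.
Qed.

(** The linear lower bound on [Psi] turns a difference at distance at most [D]
    into [D^s] plus a multiple of the energy density. *)
Lemma edens_upper u (x y : V) (D : R) : 0 < D -> enorm (x - y) <= D ->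
  `|u x - u y| <= D `^ s + D `^ s * D ^+ N / Psi 1 * edens u (x, y).
Proof.
move=> D0 xyD; have Psi1 := young_gt0 yg ltr01.
have Ds0 : 0 < D `^ s by rewrite powR_gt0.
have k0 : 0 <= D `^ s * D ^+ N / Psi 1 * edens u (x, y).
  rewrite mulr_ge0 ?(edens_ge0 s yg)// divr_ge0 ?(ltW Psi1)// mulr_ge0 ?(ltW Ds0)//.
  by rewrite exprn_ge0// ltW.
have [exy|xy] := eqVneq x y.
  by rewrite exy subrr normr0 -{1}exy addr_ge0// ltW.
have e0 := enorm_gt0 xy.
have es0 : 0 < enorm (x - y) `^ s by rewrite powR_gt0.
have hs : enorm (x - y) `^ s <= D `^ s.
  by rewrite ge0_ler_powR ?nnegrE ?(ltW s0) ?(ltW e0) ?(ltW D0).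
have hN : enorm (x - y) ^+ N <= D ^+ N.
  by rewrite lerXn2r ?nnegrE ?(ltW e0) ?(ltW D0).
have -> : `|u x - u y| = enorm (x - y) `^ s * `|Ds s u (x, y)|.
  by rewrite /Ds /= normrM normfV (ger0_norm (ltW es0)) mulrCA mulfV ?gt_eqF// mulr1.
have hP : Psi (Ds s u (x, y)) <= D ^+ N * edens u (x, y).
  rewrite /edens /Defs.mu_density /= mulrA [D ^+ N * _]mulrC -mulrA.
  rewrite ler_peMr ?(young_ge0 yg)// ler_pdivlMr ?exprn_gt0//. by rewrite mul1r.
apply: (@le_trans _ _ (D `^ s * (1 + Psi (Ds s u (x, y)) / Psi 1))).
  by rewrite ler_pM// ?(ltW es0)//; exact: (young_linear yg).
rewrite mulrDr mulr1 lerD2l -!mulrA ler_wpM2l ?(ltW Ds0)//.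
by rewrite [leRHS]mulrCA [leLHS]mulrC ler_wpM2l ?invr_ge0 ?(ltW Psi1).
Qed.

(** The difference of [u x] and the average of [u] over a box around [x] is an
    average of differences, to which [edens_upper] applies; the coefficient of
    the fiber tends to 0 with the size [h] of the box. *)
Lemma L1_point u (c x : V) (h : R) : 0 < h -> admissible u -> (energy u < +oo)%E ->
  cbox c h x ->
  (`|u x|%:E <= ((2 * N%:R * h) `^ s + `|mean u c h| / (2 * h) ^+ N)%:E +
     ((2 * N%:R * h) `^ s * N%:R ^+ N / Psi 1)%:E * fiber u x)%E.
Proof.
move=> h0 adm eu cx; have [mu u0] := adm; set D := 2 * N%:R * h.
have D0 : 0 < D by rewrite !mulr_gt0.
have Psi1 := young_gt0 yg ltr01.
pose v := (2 * h) ^+ N; have v0 : 0 < v by rewrite exprn_gt0// mulr_gt0.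
have lv : leb (cbox c h) = v%:E by rewrite leb_cbox// ltW.
have mB := measurable_cbox c h.
have iu := admissible_integrable adm eu mB.
have ic (k : R) : leb.-integrable (cbox c h) (EFin \o (fun=> k)).
  apply/integrableP; split; first exact: measurable_cst.
  by rewrite /= integral_cst//= lv -EFinM ltry.
have iB : leb.-integrable (cbox c h) (EFin \o (fun y => u x - u y)).
  rewrite (_ : _ \o _ = ((EFin \o (fun=> u x)) \- (EFin \o u))%E); last exact/funext.
  by apply: integrableB => //; exact: ic.
pose k := D `^ s * D ^+ N / Psi 1.
have k0 : 0 <= k.
  by rewrite divr_ge0 ?(ltW Psi1)// mulr_ge0 ?powR_ge0// exprn_ge0// ltW.
have mdi : measurable_fun (cbox c h) (fun y => u x - u y).
  by apply: measurable_funB => //; exact: measurable_funTS.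
have main : (\int[leb]_(y in cbox c h) `|u x - u y|%:E <=
    (D `^ s)%:E * v%:E + k%:E * fiber u x)%E.
  have me : measurable_fun (cbox c h) (fun y => (edens u (x, y))%:E).
    apply: measurable_funTS; apply/measurable_EFinP.
    exact: (measurable_edens_fiber x mu).
  have := @le_integral_affine _ _ R leb (cbox c h) (fun y => `|u x - u y|)
    (fun y => (edens u (x, y))%:E) (D `^ s) k mB.
  move=> /(_ _ me (powR_ge0 _ _) k0 (fun _ _ => normr_ge0 _)) hh.
  apply: (le_trans (hh _ _ _)).
  - exact: measurableT_comp.
  - by move=> y _; rewrite lee_fin (edens_ge0 s yg).
  - move=> y cy; rewrite -EFinM -EFinD lee_fin; apply: edens_upper => //.
    rewrite /D mulrAC mulrC mulrA; apply: (@le_trans _ _ (N%:R * (2 * h))).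
      apply: enorm_le => [|i]; first by rewrite mulr_ge0// ltW.
      rewrite !mxE; have := cx i; have := cy i.
      by rewrite !ler_norml => /andP[? ?] /andP[? ?]; apply/andP; split; lra.
    by rewrite le_eqVlt; apply/orP; left; apply/eqP; ring.
  apply: leeD; first by rewrite lee_wpmul2l ?lee_fin ?powR_ge0// -lv.
  rewrite lee_wpmul2l ?lee_fin//; apply: ge0_subset_integral => //.
  - by apply/measurable_EFinP; exact: (measurable_edens_fiber x mu).
  - by move=> y _; rewrite lee_fin (edens_ge0 s yg).
have dec : `|u x| * v <= \int[leb]_(y in cbox c h) `|u x - u y| + `|mean u c h|.
  have -> : `|u x| * v = `|\int[leb]_(y in cbox c h) (u x - u y) + mean u c h|.
    rewrite /mean -RintegralD//.
    under eq_Rintegral do rewrite subrK.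
    by rewrite Rintegral_cst//= [X in fine X]lv /= normrM (gtr0_norm v0).
  apply: (le_trans (ler_normD _ _)); rewrite lerD2r.
  exact: le_normr_Rintegral.
have intf : (\int[leb]_(y in cbox c h) `|u x - u y|%:E)%E \is a fin_num.
  apply: integrable_fin_num => //.
  exact: (integrable_norm iB).
have step : ((`|u x| * v)%:E <= ((D `^ s)%:E * v%:E + k%:E * fiber u x) + `|mean u c h|%:E)%E.
  apply: (@le_trans _ _ (\int[leb]_(y in cbox c h) `|u x - u y|%:E + `|mean u c h|%:E)%E).
    by rewrite -(fineK intf) -EFinD lee_fin.
  by rewrite leeD2r.
have -> : `|u x|%:E = ((v^-1)%R%:E * (`|u x| * v)%:E)%E.
  by rewrite -EFinM mulrC mulfK// gt_eqF.
apply: (@le_trans _ _ ((v^-1)%R%:E * (((D `^ s)%:E * v%:E + k%:E * fiber u x) + `|mean u c h|%:E))%E).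
  by rewrite lee_wpmul2l// lee_fin invr_ge0 ltW.
have f0 := fiber_ge0 s yg u x.
have kE : k / v = D `^ s * N%:R ^+ N / Psi 1.
  have -> : k = D `^ s * N%:R ^+ N / Psi 1 * v; last by rewrite mulfK// gt_eqF.
  have DN : D ^+ N = N%:R ^+ N * v.
    by rewrite /v -exprMn /D; congr (_ ^+ _); ring.
  by rewrite /k DN; ring.
have kv0 : 0 <= D `^ s * N%:R ^+ N / Psi 1.
  by rewrite -kE divr_ge0// ltW.
case: (fiber u x) f0 => [f f0| _|//].
  rewrite -!EFinM -!EFinD -?EFinM lee_fin -kE -/v.
  by rewrite le_eqVlt; apply/orP; left; apply/eqP; field; rewrite gt_eqF.
have kv : 0 < D `^ s * N%:R ^+ N / Psi 1.
  by rewrite divr_gt0// mulr_gt0 ?powR_gt0// exprn_gt0.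
by rewrite [X in (_ <= _ + X)%E]gt0_muley ?lte_fin// addey// leey.
Qed.

(** The lower corners of a cubic grid of mesh [h]. *)
Lemma cbox_cover (h : R) : 0 < h -> exists cs : seq V,
  forall x, Omega x -> exists2 c, c \in cs & cbox c h x.
Proof.
move=> h0; pose m := (Num.truncn (2 * L / h)).+1.
pose ctr (k : {ffun 'I_N -> 'I_m}) : V := \row_i (- L + (k i)%:R * h).
exists [seq ctr k | k : {ffun 'I_N -> 'I_m}] => x Ox.
have xL i : - L <= x ord0 i <= L.
  by have := Omega_cbox Ox i; rewrite mxE sub0r normrN ler_norml.
have x0 i : 0 <= (x ord0 i + L) / h.
  by have /andP[? ?] := xL i; rewrite divr_ge0 ?(ltW h0)//; lra.
have km i : (Num.truncn ((x ord0 i + L) / h) < m)%N.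
  rewrite ltnS; apply: le_truncn; rewrite ler_wpM2r ?invr_ge0 ?(ltW h0)//.
  by have /andP[? ?] := xL i; lra.
pose k : {ffun 'I_N -> 'I_m} := [ffun i => Ordinal (km i)].
exists (ctr k); first by apply/mapP; exists k; rewrite ?mem_enum.
move=> i; rewrite !mxE ffunE /=.
have /andP[t1 t2] := truncn_itv (x0 i).
rewrite ler_pdivlMr// in t1; rewrite ltr_pdivrMr// in t2.
move: t1 t2; set n := Num.truncn _; rewrite -natr1 => t1 t2.
by rewrite ler_norml; apply/andP; split; lra.
Qed.

(** The size of the boxes is chosen so that the terms of [L1_point] other than
    the averages integrate to at most [delta]; the averages then control the L1
    norm. *)
Lemma L1_net (delta R0 : R) : 0 < delta -> 0 <= R0 ->
  exists h, exists cs : seq V, exists2 C, 0 <= C & forall u, admissible u ->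
  (energy u <= R0%:E)%E ->
  (\int[leb]_(x in Omega) `|u x|%:E <=
     (delta + C * \sum_(c <- cs) `|mean u c h|)%:E)%E.
Proof.
move=> d0 R00; have Psi1 := young_gt0 yg ltr01.
pose l : R := (2 * L) ^+ N.
have l0 : 0 < l by rewrite exprn_gt0// mulr_gt0.
(* [h] is such that the diameter bound [D = 2 * N * h] satisfies
   [D^s * k = delta], where [k] collects the error terms of [L1_point]. *)
pose k : R := l + N%:R ^+ N / Psi 1 * R0.
have k0 : 0 < k.
  by rewrite ltr_wpDr// mulr_ge0// divr_ge0 ?(ltW Psi1)// exprn_ge0.
pose D := (delta / k) `^ s^-1.
have D0 : 0 < D by rewrite powR_gt0// divr_gt0.
have Ds : D `^ s = delta / k.
  by rewrite /D -powRrM mulVf ?gt_eqF// powRr1// divr_ge0// ltW.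
pose h := D / (2 * N%:R).
have h0 : 0 < h by rewrite divr_gt0// mulr_gt0.
have hD : 2 * N%:R * h = D by rewrite /h mulrC divfK// gt_eqF// mulr_gt0.
have [cs hcs] := cbox_cover h0.
pose v := (2 * h) ^+ N; have v0 : 0 < v by rewrite exprn_gt0// mulr_gt0.
exists h, cs, (l / v); first by rewrite divr_ge0// ltW.
move=> u adm eu; have [mu u0] := adm.
set S := \sum_(c <- cs) _.
have eu' : (energy u < +oo)%E by rewrite (le_lt_trans eu)// ltry.
have Sc c : c \in cs -> `|mean u c h| <= S.
  move=> ccs; rewrite /S (big_rem c)//= lerDl; exact: sumr_ge0.
have S0 : 0 <= S by exact: sumr_ge0.
pose a := D `^ s + S / v; pose b := D `^ s * N%:R ^+ N / Psi 1.
have a0 : 0 <= a by rewrite addr_ge0 ?powR_ge0// divr_ge0// ltW.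
have b0 : 0 <= b.
  by rewrite divr_ge0 ?(ltW Psi1)// mulr_ge0 ?powR_ge0// exprn_ge0.
have H x : Omega x -> (`|u x|%:E <= a%:E + b%:E * fiber u x)%E.
  move=> Ox; have [c ccs cx] := hcs x Ox.
  apply: (le_trans (L1_point h0 adm eu' cx)); rewrite hD leeD2r// lee_fin lerD2l.
  by rewrite ler_wpM2r ?invr_ge0 ?(ltW v0)// Sc.
have mn : measurable_fun Omega (fun x => `|u x|).
  by apply: measurable_funTS; exact: measurableT_comp.
have mf : measurable_fun Omega (fiber u).
  by apply: measurable_funTS; exact: (measurable_fiber s yg).
have := le_integral_affine leb mO mn mf a0 b0 (fun x _ => normr_ge0 _)
  (fun x _ => fiber_ge0 s yg u x) H.
move=> hh; apply: (le_trans hh).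
apply: (@le_trans _ _ (a%:E * l%:E + b%:E * R0%:E)%E).
  apply: leeD; first by rewrite lee_wpmul2l ?lee_fin// leb_Omega_le.
  rewrite lee_wpmul2l ?lee_fin//.
  exact: le_trans (fiber_energy s Omega_open yg mu) eu.
rewrite -!EFinM -EFinD lee_fin /a /b Ds.
have -> : (delta / k + S / v) * l + delta / k * N%:R ^+ N / Psi 1 * R0 =
  delta / k * k + l / v * S by rewrite /k; ring.
by rewrite divfK// gt_eqF.
Qed.

Lemma admissible_comb (c d : R) u v : admissible u -> admissible v ->
  admissible (fun x => c * u x + d * v x).
Proof.
move=> [mu u0] [mv v0]; split.
  by apply: measurable_funD; apply: measurable_funM.
by apply: filterS2 u0 v0 => x ux vx Ox; rewrite ux// vx// !mulr0 addr0.
Qed.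

Lemma admissible_sub u v : admissible u -> admissible v ->
  admissible (fun x => u x - v x).
Proof.
move=> au av; have := admissible_comb 1 (-1) au av.
by under eq_fun do rewrite mul1r mulN1r.
Qed.

Lemma energy_sub u v : admissible u -> admissible v ->
  (energy (fun x => u x - v x)%R <= (K / 2)%:E * energy u + (K / 2)%:E * energy v)%E.
Proof.
move=> [mu _] [mv _]; have K0 : 0 <= K / 2 by rewrite divr_ge0// (young_K_ge0 yg).
apply: (energy_comb1 Omega_open yg) => //; first exact: measurable_funB.
move=> z; have -> : Ds s (fun x => u x - v x) z = Ds s u z + - Ds s v z.
  by rewrite /Ds; ring.
by rewrite -(youngN yg (Ds s v z)) -mulrDr; exact: (young_add yg).
Qed.

(** By [L1_net] finitely many averages control the L1 distance.  Along an
    ultrafilter all bounded sequences of averages converge at once, which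
    replaces a diagonal extraction. *)
Lemma L1_compact (u_ : nat -> V -> R) (R0 : R) : 0 <= R0 ->
  (forall n, admissible (u_ n)) -> (forall n, energy (u_ n) <= R0%:E)%E ->
  exists F : set_system nat, [/\ ProperFilter F, \oo `<=` F &
    forall e : R, 0 < e -> exists2 A, F A & forall n m, A n -> A m ->
      (\int[leb]_(x in Omega) `|u_ n x - u_ m x|%:E <= e%:E)%E].
Proof.
move=> R00 adm eR0.
have [F [UF oF]] := ultraFilterLemma (_ : ProperFilter (\oo : set_system nat)).
exists F; split => [| |e e0]; [exact: ultra_proper|exact: oF|].
have K0 : 0 <= K by exact: (young_K_ge0 yg).
have [C C0 hC] := poincare.
pose B := C + C * R0.
have uB n : (\int[leb]_(x in Omega) `|u_ n x|%:E <= B%:E)%E.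
  apply: (le_trans (hC _ (adm n))); rewrite EFinD leeD2l// EFinM lee_wpmul2l//.
have e20 : 0 < e / 2 by rewrite divr_gt0.
have [h [cs [C' C'0 net]]] := L1_net e20 (mulr_ge0 K0 R00).
have efin n : (energy (u_ n) < +oo)%E by rewrite (le_lt_trans (eR0 n))// ltry.
have mB n c : `|mean (u_ n) c h| <= B.
  exact: (mean_le c h (adm n) (efin n) (uB n)).
pose d := e / 2 / (C' * (size cs)%:R + 1).
have C'1 : 0 < C' * (size cs)%:R + 1 by rewrite ltr_wpDl// mulr_ge0.
have d0 : 0 < d by rewrite divr_gt0.
have [A FA hA] : exists2 A, F A & forall n m, A n -> A m ->
    forall c, c \in cs -> `|mean (u_ n) c h - mean (u_ m) c h| <= d.
  elim: (cs) => [|c l [A FA hA]]; first by exists setT => //; exact: filterT.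
  have [A' FA' hA'] := ultra_cauchy UF (mB ^~ c) d0.
  exists (A `&` A'); first exact: filterI.
  move=> n m [An A'n] [Am A'm] c'; rewrite inE => /predU1P[->|]; last exact: hA.
  exact: hA'.
exists A => // n m An Am.
have adm' : admissible (fun x => u_ n x - u_ m x) by exact: admissible_sub.
apply: (le_trans (net _ adm' _)).
  apply: (le_trans (energy_sub (adm n) (adm m))).
  apply: (@le_trans _ _ ((K / 2)%:E * R0%:E + (K / 2)%:E * R0%:E)%E).
    by apply: leeD; rewrite lee_wpmul2l// lee_fin divr_ge0.
  by rewrite -EFinM -EFinD lee_fin; lra.
rewrite lee_fin.
have : \sum_(c <- cs) `|mean (fun x => u_ n x - u_ m x) c h| <= (size cs)%:R * d.
  apply: (@le_trans _ _ (\sum_(c <- cs) d)).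
    rewrite big_seq [leRHS]big_seq; apply: ler_sum => c ccs.
    rewrite /mean RintegralB ?hA//; first exact: measurable_cbox.
      exact: (admissible_integrable (adm n) (efin n) (measurable_cbox c h)).
    exact: (admissible_integrable (adm m) (efin m) (measurable_cbox c h)).
  by rewrite big_const_seq count_predT iter_addr_0 mulr_natl.
move=> /(ler_wpM2l C'0) h1; have : C' * ((size cs)%:R * d) <= e / 2.
  have -> : C' * ((size cs)%:R * d) = e / 2 * (C' * (size cs)%:R / (C' * (size cs)%:R + 1)).
    by rewrite /d; field; rewrite gt_eqF.
  rewrite ler_piMr ?(ltW e20)//.
  by rewrite ler_pdivrMr// mul1r lerDl.
lra.
Qed.

(** * The reaction term *)

Variable qf : V -> R.
Hypothesis mqf : measurable_fun Omega qf.
Hypothesis qf_gt1 : forall x, Omega x -> 1 < qf x.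
Hypothesis qf_le : forall x, Omega x -> qf x <= q.

(** A bound for the increments of [|.|^q / q] and for its convexity defect. *)
Definition incr u v (x : V) : R :=
  (`|u x| `^ (qf x - 1) + `|v x| `^ (qf x - 1)) * `|u x - v x|.

Lemma measurable_incr u v : measurable_fun setT u -> measurable_fun setT v ->
  measurable_fun Omega (incr u v).
Proof.
move=> mu mv; have mS (f : V -> R) : measurable_fun setT f -> measurable_fun Omega f.
  by move=> ?; exact: measurable_funTS.
have mq1 : measurable_fun Omega (fun x => qf x - 1) by exact: measurable_funB.
apply: measurable_funM.
  apply: measurable_funD; apply: measurable_powR2 => //;
    by apply: mS; exact: measurableT_comp.
by apply: mS; apply: measurableT_comp => //; exact: measurable_funB.
Qed.

Definition tail u (M : R) (x : V) : R := if M < `|u x| then `|u x| `^ q else 0.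

Lemma measurable_tail u M : measurable_fun setT u -> measurable_fun setT (tail u M).
Proof.
move=> mu; apply: measurable_fun_ifT.
- apply: measurable_fun_ltr; first exact: measurable_cst.
  exact: measurableT_comp.
- exact: measurable_powq.
- exact: measurable_cst.
Qed.

Lemma tail_ge0 u M x : 0 <= tail u M x.
Proof. by rewrite /tail; case: ifP => // _; exact: powR_ge0. Qed.

Lemma integral_tail u M : (\int[leb]_(x in Omega) (tail u M x)%:E =
  \int[leb]_(x in Omega `&` level u M) (`|u x| `^ q)%:E)%E.
Proof.
rewrite integral_mkcondr; apply: eq_integral => x _.
rewrite /tail patchE /level; case: ifPn => [Mx|Mx]; first by rewrite mem_set.
by rewrite memNset//= => h; rewrite h in Mx.
Qed.

(** Above a high level the increments are small by uniform integrability; below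
    it they are at most a constant times [|u - v|]. *)
Lemma incr_small (R0 e : R) : 0 <= R0 -> 0 < e -> exists2 d, 0 < d &
  forall u v, admissible u -> admissible v ->
  (energy u <= R0%:E)%E -> (energy v <= R0%:E)%E ->
  (\int[leb]_(x in Omega) `|u x - v x|%:E <= d%:E)%E ->
  (\int[leb]_(x in Omega) (incr u v x)%:E <= e%:E)%E.
Proof.
move=> R00 e0.
(* The two tails enter with the factor 4, which makes [8 / 16] of [e]; the
   other half comes from the L1 distance. *)
have e16 : 0 < e / 16 by rewrite divr_gt0.
have [M0 M00 hM0] := uniform_integrability R00 e16.
pose M := Num.max M0 1.
have M1 : 1 <= M by rewrite le_max lexx orbT.
have hM u : admissible u -> (energy u <= R0%:E)%E ->
    (\int[leb]_(x in Omega) (tail u M x)%:E <= (e / 16)%:E)%E.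
  move=> adm eu; have [mu _] := adm; apply: le_trans (hM0 u adm eu).
  rewrite -integral_tail; apply: ge0_le_integral => //.
  - by move=> x _; rewrite lee_fin tail_ge0.
  - by apply: measurable_funTS; apply/measurable_EFinP; exact: measurable_tail.
  - by apply: measurable_funTS; apply/measurable_EFinP; exact: measurable_tail.
  - move=> x _; rewrite lee_fin /tail.
    case: ifP => Mx; last by case: ifP => // _; exact: powR_ge0.
    by rewrite ifT// (le_lt_trans _ Mx)// le_max lexx.
pose c := 2 * M `^ q.
have c0 : 0 < c by rewrite mulr_gt0// powR_gt0// (lt_le_trans ltr01).
exists (e / 2 / c); first by rewrite !divr_gt0.
move=> u v au av eu ev duv; have [mu _] := au; have [mv _] := av.
have mT : measurable_fun Omega (fun x => (4 * (tail u M x + tail v M x))%:E).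
  apply: measurable_funTS; apply/measurable_EFinP; apply: measurable_funM => //.
  by apply: measurable_funD; exact: measurable_tail.
have mD : measurable_fun Omega (fun x => `|u x - v x|%:E).
  apply: measurable_funTS; apply/measurable_EFinP; apply: measurableT_comp => //.
  exact: measurable_funB.
have tt0 x : 0 <= tail u M x + tail v M x by rewrite addr_ge0// tail_ge0.
apply: (@le_trans _ _ (\int[leb]_(x in Omega)
   (c%:E * `|u x - v x|%:E + (4 * (tail u M x + tail v M x))%:E))%E).
  apply: ge0_le_integral => //.
  - by move=> x _; rewrite lee_fin mulr_ge0// addr_ge0// powR_ge0.
  - by apply/measurable_EFinP; exact: measurable_incr.
  - by apply: emeasurable_funD => //; exact: measurable_funeM.
  - move=> x Ox; rewrite -EFinM -EFinD lee_fin; apply: pow_split => //.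
      exact: qf_gt1.
    exact: qf_le.
rewrite ge0_integralD//; first last.
- by move=> x _; rewrite lee_fin mulr_ge0.
- exact: measurable_funeM.
- by move=> x _; rewrite -EFinM lee_fin mulr_ge0// ltW.
rewrite ge0_integralZl_EFin//; last exact: ltW.
have -> : (\int[leb]_(x in Omega) (4 * (tail u M x + tail v M x))%:E =
   4%:E * (\int[leb]_(x in Omega) (tail u M x)%:E + \int[leb]_(x in Omega) (tail v M x)%:E))%E.
  under eq_integral do rewrite EFinM.
  have mTT : measurable_fun Omega (fun x => (tail u M x + tail v M x)%:E).
    by apply: measurable_funTS; apply/measurable_EFinP; apply: measurable_funD; exact: measurable_tail.
  rewrite ge0_integralZl_EFin => //; last by move=> x _; rewrite lee_fin.
  congr (_ * _)%E; under eq_integral do rewrite EFinD.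
  rewrite ge0_integralD//.
  - by move=> x _; rewrite lee_fin tail_ge0.
  - by apply: measurable_funTS; apply/measurable_EFinP; exact: measurable_tail.
  - by move=> x _; rewrite lee_fin tail_ge0.
  - by apply: measurable_funTS; apply/measurable_EFinP; exact: measurable_tail.
apply: (@le_trans _ _ (c%:E * (e / 2 / c)%:E + 4%:E * ((e / 16)%:E + (e / 16)%:E))%E).
  apply: leeD; first by rewrite lee_wpmul2l// lee_fin ltW.
  by rewrite lee_wpmul2l//; apply: leeD; exact: hM.
rewrite -!EFinM -!EFinD -?EFinM lee_fin.
have -> : c * (e / 2 / c) = e / 2 by field; rewrite gt_eqF.
lra.
Qed.

Definition reac u (x : V) : R := `|u x| `^ qf x / qf x.
Definition Kf u : R := \int[leb]_(x in Omega) reac u x.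

Lemma measurable_reac u : measurable_fun setT u -> measurable_fun Omega (reac u).
Proof.
move=> mu; apply: measurable_funM.
  apply: measurable_powR2 => //; apply: measurable_funTS; exact: measurableT_comp.
apply: (@eq_measurable_fun _ _ _ _ _ (fun x => qf x `^ (-1))).
  move=> x; rewrite inE => /qf_gt1 h; rewrite powR_inv1// ltW//.
  exact: lt_trans h.
by apply: (measurableT_comp (measurable_powR _)).
Qed.

Lemma reac_ge0 u x : Omega x -> 0 <= reac u x.
Proof.
move=> /qf_gt1 h; rewrite divr_ge0 ?powR_ge0// ltW// .
exact: lt_trans h.
Qed.

Lemma powR_le1D (a p : R) : 0 <= a -> 0 < p -> p <= q -> a `^ p <= 1 + a `^ q.
Proof.
move=> a0 p_gt0 pq; have [a1|a1] := leP a 1.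
  apply: (@le_trans _ _ 1); last by rewrite lerDl powR_ge0.
  by have := @ge0_ler_powR R p (ltW p_gt0) a 1; rewrite powR1 !nnegrE; exact.
by apply: (@le_trans _ _ (a `^ q)); [rewrite ler_powR// ltW|rewrite lerDr].
Qed.

Lemma reac_le u x : Omega x -> reac u x <= 1 + `|u x| `^ q.
Proof.
move=> Ox; have h := qf_gt1 Ox.
have q0' : 0 < qf x by exact: lt_trans h.
apply: (@le_trans _ _ (`|u x| `^ qf x)); last exact: powR_le1D (qf_le Ox).
by rewrite /reac ler_piMr ?powR_ge0// invf_le1// ltW.
Qed.

Lemma powq_integrable u : admissible u -> (energy u < +oo)%E ->
  leb.-integrable Omega (EFin \o (fun x => 1 + `|u x| `^ q)).
Proof.
move=> adm eu; have [mu _] := adm.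
have E0 := energy_ge0 s Omega yg u.
have ef : energy u \is a fin_num by rewrite ge0_fin_numE.
have R00 : 0 <= fine (energy u) by exact: fine_ge0.
have [C C0 hC] := sobolev R00.
have := hC u adm; rewrite fineK// => /(_ (lexx _)) h.
have i1 : leb.-integrable Omega (EFin \o (fun=> 1 : R)).
  apply/integrableP; split; first exact: measurable_cst.
  rewrite /= integral_cst// normr1 mul1e.
  exact: le_lt_trans (leb_Omega_le) (ltry _).
have i2 : leb.-integrable Omega (EFin \o (fun x => `|u x| `^ q)).
  apply/integrableP; split.
    by apply/measurable_EFinP; exact: measurable_powq.
  apply: le_lt_trans (ltry C); apply: le_trans h.
  by under eq_integral do rewrite /= ger0_norm ?powR_ge0//.
exact: integrableD_EFin.
Qed.

Lemma reac_integrable u : admissible u -> (energy u < +oo)%E ->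
  leb.-integrable Omega (EFin \o reac u).
Proof.
move=> adm eu; have [mu _] := adm.
apply: le_integrable (powq_integrable adm eu) => //.
  by apply/measurable_EFinP; exact: measurable_reac.
move=> x Ox; rewrite /= lee_fin ger0_norm ?reac_ge0// ger0_norm ?reac_le//.
Qed.

Lemma incr_integrable u v : admissible u -> (energy u < +oo)%E ->
  admissible v -> (energy v < +oo)%E -> leb.-integrable Omega (EFin \o incr u v).
Proof.
move=> au eu av ev; have [mu _] := au; have [mv _] := av.
pose R0 := fine (energy u) + fine (energy v).
have E0 w := energy_ge0 s Omega yg w.
have ef w : (energy w < +oo)%E -> energy w \is a fin_num by move=> ?; rewrite ge0_fin_numE.
have fu := fine_ge0 (E0 u); have fv := fine_ge0 (E0 v).
have R00 : 0 <= R0 by exact: addr_ge0.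
have i0 : leb.-integrable Omega (EFin \o
    (fun x => 4 * ((1 + `|u x| `^ q) + (1 + `|v x| `^ q)))).
  apply: integrableZ_EFin => //.
  by apply: integrableD_EFin => //; exact: powq_integrable.
apply: le_integrable i0 => //; first by apply/measurable_EFinP; exact: measurable_incr.
move=> x Ox; have pu := powR_ge0 `|u x| q; have pv := powR_ge0 `|v x| q.
have i_ge0 : 0 <= incr u v x by rewrite mulr_ge0// addr_ge0// powR_ge0.
rewrite /= lee_fin ger0_norm// ger0_norm; last by lra.
have h := qf_gt1 Ox.
have q0' : 0 < qf x by exact: lt_trans h.
have key (a b : R) : 0 <= a -> 0 <= b -> a <= b ->
    a `^ (qf x - 1) + b `^ (qf x - 1) <= 2 * b `^ (qf x - 1).
  move=> a0 b0 ab; have : a `^ (qf x - 1) <= b `^ (qf x - 1).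
    by rewrite ge0_ler_powR ?nnegrE//; lra.
  lra.
have pw (b : R) : 0 <= b -> b `^ (qf x - 1) * b = b `^ qf x.
  rewrite le_eqVlt => /predU1P[<-|b0].
    by rewrite mulr0 powR0// gt_eqF.
  by rewrite -[X in _ * X](powRr1 (ltW b0)) -powRDp// subrK.
have main (a b : R) : `|a| <= `|b| -> (`|a| `^ (qf x - 1) + `|b| `^ (qf x - 1)) * `|a - b|
    <= 4 * (1 + `|b| `^ q).
  move=> ab; apply: (@le_trans _ _ ((2 * `|b| `^ (qf x - 1)) * (2 * `|b|))).
    apply: ler_pM => //; first exact: key.
    by apply: (le_trans (ler_normB _ _)); lra.
  have := powR_le1D (normr_ge0 b) q0' (qf_le Ox); rewrite -(pw _ (normr_ge0 b)); lra.
rewrite /incr; have [uv|/ltW vu] := leP `|u x| `|v x|.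
  by have := main _ _ uv; lra.
by have := main _ _ vu; rewrite distrC [X in X * _]addrC; lra.
Qed.

Lemma Kf_midpoint u v : admissible u -> (energy u < +oo)%E ->
  admissible v -> (energy v < +oo)%E ->
  admissible (emean u v) -> (energy (emean u v) < +oo)%E ->
  (Kf u + Kf v) / 2 - Kf (emean u v) <= \int[leb]_(x in Omega) incr u v x.
Proof.
move=> au eu av ev am em.
have iu := reac_integrable au eu; have iv := reac_integrable av ev.
have im := reac_integrable am em.
have iuv : leb.-integrable Omega (EFin \o (fun x => reac u x + reac v x)) by exact: integrableD_EFin.
have i2 : leb.-integrable Omega (EFin \o (fun x => 2^-1 * (reac u x + reac v x))).
  exact: integrableZ_EFin.
have -> : (Kf u + Kf v) / 2 - Kf (emean u v) =
    \int[leb]_(x in Omega) (2^-1 * (reac u x + reac v x) - reac (emean u v) x).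
  by rewrite RintegralB// RintegralZl// RintegralD// mulrC.
apply: le_Rintegral => //; first exact: integrableB_EFin.
  exact: incr_integrable.
by move=> x Ox; rewrite mulrC; exact: (pow_midpoint (u x) (v x) (qf_gt1 Ox)).
Qed.

Lemma Kf_increment u v : admissible u -> (energy u < +oo)%E ->
  admissible v -> (energy v < +oo)%E ->
  Kf u - Kf v <= \int[leb]_(x in Omega) incr u v x.
Proof.
move=> au eu av ev.
have iu := reac_integrable au eu; have iv := reac_integrable av ev.
rewrite -RintegralB//; apply: le_Rintegral => //; first exact: integrableB_EFin.
  exact: incr_integrable.
by move=> x Ox; exact: (pow_increment (u x) (v x) (qf_gt1 Ox)).
Qed.

(** * Minimisation on the unit ball of the energy *)

(** The minimisation uses the space of competitors only through these closure
    properties. *)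
Variable W : set (V -> R).
Hypothesis W_adm : forall u, W u -> admissible u.
Hypothesis W_fin : forall u, W u -> (energy u < +oo)%E.
Hypothesis W_comb : forall (c d : R) u v, W u -> W v -> W (fun x => c * u x + d * v x).
Hypothesis W_closed : forall (w : nat -> V -> R) u, (forall k, W (w k)) ->
  admissible u ->
  (forall e : R, 0 < e -> exists k, (energy (ediff (w k) u) <= e%:E)%E) -> W u.

Lemma Kf_bound : exists2 C, 0 < C & forall u, admissible u ->
  (energy u <= 1%:E)%E -> Kf u <= C.
Proof.
have [C C0 hC] := sobolev (@ler01 R).
have l0 : 0 < (2 * L) ^+ N by rewrite exprn_gt0// mulr_gt0.
exists ((2 * L) ^+ N + C); first by rewrite addr_gt0.
move=> u adm eu; have [mu _] := adm.
have eu' : (energy u < +oo)%E by rewrite (le_lt_trans eu)// ltry.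
have i1 := reac_integrable adm eu'.
rewrite -lee_fin /Kf /Rintegral fineK; last exact: integrable_fin_num.
have iq : measurable_fun Omega (fun x => `|u x| `^ q) by exact: measurable_powq.
apply: (@le_trans _ _ (\int[leb]_(x in Omega) (1%:E + (`|u x| `^ q)%:E))%E).
  apply: ge0_le_integral => //.
  - by move=> x Ox; rewrite lee_fin (reac_ge0).
  - by apply/measurable_EFinP; exact: (measurable_reac).
  - by apply: emeasurable_funD; [exact: measurable_cst|exact/measurable_EFinP].
  - by move=> x Ox; rewrite -EFinD lee_fin (reac_le).
rewrite ge0_integralD//; last exact/measurable_EFinP.
rewrite integral_cst// mul1e EFinD; apply: leeD; last exact: hC.
exact: leb_Omega_le.
Qed.

(** Fatou's lemma. *)
Lemma L1_lsc (w : nat -> V -> R) (f u : V -> R) (c : \bar R) :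
  (forall k, measurable_fun setT (w k)) -> measurable_fun setT f ->
  measurable_fun setT u ->
  {ae leb, forall x, (w ^~ x) @ \oo --> u x} ->
  (forall k, \int[leb]_(x in Omega) `|f x - w k x|%:E <= c)%E ->
  (\int[leb]_(x in Omega) `|f x - u x|%:E <= c)%E.
Proof.
move=> mw mf mu cvg le_c.
have md (g : V -> R) : measurable_fun setT g -> measurable_fun Omega (fun x => `|f x - g x|%:E).
  move=> mg; apply: measurable_funTS; apply/measurable_EFinP.
  by apply: measurableT_comp => //; exact: measurable_funB.
have -> : (\int[leb]_(x in Omega) `|f x - u x|%:E =
    \int[leb]_(x in Omega) limn_einf (fun k => `|f x - w k x|%:E))%E.
  apply: ge0_ae_eq_integral => //.
  - exact: md.
  - rewrite /limn_einf; apply: (measurableT_comp (@oppe_measurable R setT)).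
    apply: measurable_fun_limn_esup => k.
    by apply: (measurableT_comp (@oppe_measurable R setT)); exact: md.
  - move=> x _; rewrite limn_einf_lim; apply: lime_ge; first exact: is_cvg_einfs.
    by apply: nearW => n; apply: le_ereal_inf_tmp => _ [k _ <-].
  apply: filterS cvg => x cx _.
  have cz : `|f x - w k x|%:E @[k --> \oo] --> `|f x - u x|%:E.
    apply/cvg_EFin; first by near=> k.
    by apply: cvg_norm; apply: cvgB => //; exact: cvg_cst.
  by rewrite is_cvg_limn_einfE; [rewrite (cvg_lim _ cz)|exact: cvgP cz].
apply: (le_trans (fatou _ _ _ _)) => //; first by move=> k; exact: md.
rewrite limn_einf_lim; apply: lime_le; first exact: is_cvg_einfs.
apply: nearW => n; apply: le_trans (le_c n).
by apply: ereal_inf_lbound; exists n => //=.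
Unshelve. all: by end_near. Qed.

Lemma W_emean u v : W u -> W v -> W (emean u v).
Proof.
move=> Wu Wv; rewrite (_ : emean u v = (fun x => 2^-1 * u x + 2^-1 * v x)).
  exact: W_comb.
by apply/funext => x; rewrite /emean -mulrDr mulrC.
Qed.

Lemma W_ediff u v : W u -> W v -> W (ediff u v).
Proof.
move=> Wu Wv; rewrite (_ : ediff u v = (fun x => 2^-1 * u x + (- 2^-1) * v x)).
  exact: W_comb.
by apply/funext => x; rewrite /ediff mulrC mulrBr mulNr.
Qed.

Lemma W_energy u : W u -> energy u = (fine (energy u))%:E.
Proof.
by move=> Wu; rewrite fineK// ge0_fin_numE ?W_fin//; exact: (energy_ge0 s Omega yg).
Qed.

Lemma W_emean_le u v (c : R) : W u -> W v -> (energy u <= c%:E)%E ->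
  (energy v <= c%:E)%E -> (energy (emean u v) <= c%:E)%E.
Proof.
move=> Wu Wv; have [mu _] := W_adm Wu; have [mv _] := W_adm Wv.
have := energy_clarkson s Omega_open yg mu mv.
rewrite (W_energy Wu) (W_energy Wv) (W_energy (W_emean Wu Wv)) (W_energy (W_ediff Wu Wv)).
rewrite -!EFinM -!EFinD !lee_fin.
have : 0 <= fine (energy (ediff u v)) by apply: fine_ge0; exact: (energy_ge0 s Omega yg).
lra.
Qed.

Section Functional.
Variable lam : R.
Hypothesis lam0 : 0 < lam.

Definition Jf u : R := fine (energy u) - lam * Kf u.

(** The Clarkson inequality turns the deficit of a midpoint into a bound on the
    energy of the half difference. *)
Lemma Jf_clarkson u v (m b : R) : W u -> W v ->
  m <= Jf (emean u v) -> Jf u <= b -> Jf v <= b ->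
  fine (energy (ediff u v)) <= b - m + lam * \int[leb]_(x in Omega) incr u v x.
Proof.
move=> Wu Wv hm hu hv; have Wm := W_emean Wu Wv.
have [mu _] := W_adm Wu; have [mv _] := W_adm Wv.
have := Kf_midpoint
  (W_adm Wu) (W_fin Wu) (W_adm Wv) (W_fin Wv) (W_adm Wm) (W_fin Wm).
move=> /(ler_wpM2l (ltW lam0)).
have := energy_clarkson s Omega_open yg mu mv.
rewrite (W_energy Wu) (W_energy Wv) (W_energy Wm) (W_energy (W_ediff Wu Wv)).
rewrite -!EFinM -!EFinD !lee_fin /=.
move: hm hu hv; rewrite /Jf.
move: (fine (energy u)) (fine (energy v)) (fine (energy (emean u v)))
  (fine (energy (ediff u v))) (Kf u) (Kf v) (Kf (emean u v)) (Rintegral _ _ _) => *.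
lra.
Qed.

Lemma incr_Rintegral_le u v (e : R) : W u -> W v ->
  (\int[leb]_(x in Omega) (incr u v x)%:E <= e%:E)%E ->
  \int[leb]_(x in Omega) incr u v x <= e.
Proof.
move=> Wu Wv; rewrite -lee_fin /Rintegral fineK//; apply: integrable_fin_num => //.
exact: (incr_integrable
  (W_adm Wu) (W_fin Wu) (W_adm Wv) (W_fin Wv)).
Qed.

(** Along the ultrafilter of [L1_compact] a minimising sequence is Cauchy in L1,
    so its midpoint defects vanish and [Jf_clarkson] makes it Cauchy in energy; a
    subsequence is then Cauchy at a geometric rate. *)
Lemma minimizing_sequence : W (fun=> 0) -> exists m : R, exists w : nat -> V -> R,
  [/\ forall v, W v -> (energy v <= 1%:E)%E -> m <= Jf v,
      forall k, W (w k) /\ (energy (w k) <= 1%:E)%E,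
      forall k, Jf (w k) <= m + 2^-1 ^+ k &
      forall k l, (k <= l)%N ->
        (energy (ediff (w k) (w l)) <= (2^-1 ^+ k)%:E)%E /\
        (\int[leb]_(x in Omega) `|w k x - w l x|%:E <= (2^-1 ^+ k)%:E)%E].
Proof.
move=> W0; pose A := [set u | W u /\ (energy u <= 1%:E)%E].
pose S := [set Jf u | u in A].
have A0 : A (fun=> 0) by split => //; rewrite (energy0 s Omega yg) lee_fin.
have [C C0 hC] := Kf_bound.
have hS : has_inf S.
  split; first by exists (Jf (fun=> 0)); exists (fun=> 0).
  exists (- (lam * C)) => _ [u [Wu eu] <-]; rewrite /Jf.
  have : 0 <= fine (energy u) by apply: fine_ge0; exact: (energy_ge0 s Omega yg).
  have := ler_wpM2l (ltW lam0) (hC u (W_adm Wu) eu); lra.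
pose m := inf S.
have mJ u : W u -> (energy u <= 1%:E)%E -> m <= Jf u.
  by move=> Wu eu; apply: ge_inf; [case: hS|exists u].
have [u_ hu_] : {u_ : nat -> V -> R & forall n,
    [/\ W (u_ n), (energy (u_ n) <= 1%:E)%E & Jf (u_ n) < m + n.+1%:R^-1]}.
  apply: (@choice _ _ (fun n u => [/\ W u, (energy u <= 1%:E)%E & Jf u < m + n.+1%:R^-1])).
  move=> n; have [|_ [u [Wu eu] <-] h] := @inf_adherent _ S n.+1%:R^-1 _ hS.
    by rewrite invr_gt0.
  by exists u.
have Wu n : W (u_ n) by have [] := hu_ n.
have eu n : (energy (u_ n) <= 1%:E)%E by have [] := hu_ n.
have [F [PF oF cF]] := L1_compact (@ler01 R)
  (fun n => W_adm (Wu n)) eu.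
have good (e : R) : 0 < e -> exists2 B, F B & forall n l, B n -> B l ->
    [/\ (energy (ediff (u_ n) (u_ l)) <= e%:E)%E,
        (\int[leb]_(x in Omega) `|u_ n x - u_ l x|%:E <= e%:E)%E & Jf (u_ n) <= m + e].
  move=> e0.
  have e1 : 0 < e / 2 / lam by rewrite !divr_gt0.
  have [d d0 hd] := incr_small (@ler01 R) e1.
  have de0 : 0 < Num.min d e by rewrite lt_min d0.
  have [B FB hB] := cF _ de0.
  exists (B `&` [set n | Jf (u_ n) <= m + e / 2]).
    apply: filterI => //; apply: oF; exists (Num.bound (2 / e)) => // n /= hn.
    have [_ _ h] := hu_ n; apply: (le_trans (ltW h)); rewrite lerD2l.
    rewrite invf_ple ?posrE ?divr_gt0// invf_div.
    apply: (le_trans (ltW (archi_boundP _))); first by rewrite divr_ge0// ltW.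
    by rewrite ler_nat (leq_trans hn).
  move=> n l [Bn Jn] [Bl Jl]; have h := hB n l Bn Bl.
  have hde : (\int[leb]_(x in Omega) `|u_ n x - u_ l x|%:E <= d%:E)%E.
    by apply: (le_trans h); rewrite lee_fin ge_min lexx.
  split.
  - rewrite (W_energy (W_ediff (Wu n) (Wu l))) lee_fin.
    have hm := mJ _ (W_emean (Wu n) (Wu l)) (W_emean_le (Wu n) (Wu l) (eu n) (eu l)).
    have := Jf_clarkson (Wu n) (Wu l) hm Jn Jl.
    have := incr_Rintegral_le (Wu n) (Wu l) (hd _ _ (W_adm (Wu n)) (W_adm (Wu l)) (eu n) (eu l) hde).
    move=> /(ler_wpM2l (ltW lam0)); rewrite [lam * (_ / lam)]mulrC divfK ?gt_eqF//.
    lra.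
  - by apply: (le_trans h); rewrite lee_fin ge_min lexx orbT.
  - by apply: (le_trans Jn); lra.
have p2 k : 0 < 2^-1 ^+ k :> R by rewrite exprn_gt0.
have good' k : exists B, F B /\ forall n l : nat, B n -> B l ->
    [/\ (energy (ediff (u_ n) (u_ l)) <= (2^-1 ^+ k)%:E)%E,
        (\int[leb]_(x in Omega) `|u_ n x - u_ l x|%:E <= (2^-1 ^+ k)%:E)%E &
        Jf (u_ n) <= m + 2^-1 ^+ k].
  by have [B FB hB] := good _ (p2 k); exists B.
have [B hB] := choice good'.
have FB k : F [set n | forall i, (i <= k)%N -> B i n].
  elim: k => [|k IH].
    apply: filterS (hB 0%N).1 => n Bn i; rewrite leqn0 => /eqP -> //.
  apply: filterS2 IH (hB k.+1).1 => n h Bn i.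
  by rewrite leq_eqVlt => /predU1P[->//|]; rewrite ltnS; exact: h.
have exn k : exists n, forall i, (i <= k)%N -> B i n by exact: filter_ex (FB k).
have [nu hnu] := choice exn.
exists m, (fun k => u_ (nu k)); split => //.
- by move=> k; have [] := (hB k).2 _ _ (hnu k k (leqnn k)) (hnu k k (leqnn k)).
- by move=> k l kl; have [] := (hB k).2 _ _ (hnu k k (leqnn k)) (hnu l k kl).
Qed.

(** The minimizing sequence converges almost everywhere, being fast in L1.  Fatou's
    lemma puts the limit within distance [2^-k] in energy of the k-th term, hence
    in [W], and it bounds the energy of the limit, while [Kf] is continuous along
    the sequence. *)
Lemma minimizer : W (fun=> 0) -> exists u, [/\ W u, (energy u <= 1%:E)%E &
  forall v, W v -> (energy v <= 1%:E)%E -> Jf u <= Jf v].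
Proof.
move=> /minimizing_sequence[m [w [mJ Ww Jw cw]]].
have mw k : measurable_fun setT (w k) by have [] := W_adm (Ww k).1.
have p2 k : 0 < 2^-1 ^+ k :> R by rewrite exprn_gt0.
have w0 : {ae leb, forall x, forall k, ~ Omega x -> w k x = 0}.
  by apply: ae_foralln => k; have [_] := W_adm (Ww k).1.
have cO : {ae leb, forall x, Omega x -> cvgn (w ^~ x)}.
  apply: fast_L1_cvg => // [k|k]; first exact: measurable_funTS.
  have [_] := cw k k.+1 (leqnSn k); apply: le_trans.
  by under eq_integral do rewrite distrC.
have cvgw : {ae leb, forall x, cvgn (w ^~ x)}.
  apply: filterS2 w0 cO => x wx cx; have [/cx//|nOx] := pselect (Omega x).
  have -> : w ^~ x = fun=> 0 by apply/funext => k; exact: wx.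
  exact: is_cvg_cst.
(* The upper limit is measurable and equals the limit wherever there is one. *)
pose u x := fine (limn_esup (fun k => (w k x)%:E)).
have mu : measurable_fun setT u.
  apply: (measurableT_comp (fine_measurable measurableT)).
  by apply: measurable_fun_limn_esup => k; exact/measurable_EFinP.
have wu : {ae leb, forall x, (w ^~ x) @ \oo --> u x}.
  apply: filterS cvgw => x /cvg_ex[l wl]; rewrite /u.
  have cl : (w k x)%:E @[k --> \oo] --> l%:E by apply/cvg_EFin => //; first by near=> k.
  by rewrite is_cvg_limn_esupE; [rewrite (cvg_lim _ cl)|exact: cvgP cl].
have admu : admissible u.
  split => //; apply: filterS2 w0 wu => x wx cx nOx.
  apply/esym/(cvg_unique _ (F := (w ^~ x) @ \oo)) => //.
  have -> : w ^~ x = fun=> 0 by apply/funext => k; exact: wx.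
  exact: cvg_cst.
have shift k : {ae leb, forall x, (fun l => w (l + k)%N x) @ \oo --> u x}.
  apply: filterS wu => x cx; have := cx; rewrite -(cvg_shiftn k); exact.
have eku k : (energy (ediff (w k) u) <= (2^-1 ^+ k)%:E)%E.
  apply: (energy_lsc Omega_open yg (u_ := fun l => ediff (w k) (w (l + k)%N))).
  - by move=> l; exact: measurable_ediff.
  - exact: measurable_ediff.
  - apply: filterS (shift k) => x cx; rewrite /ediff.
    by apply: cvgM; [apply: cvgB => //; exact: cvg_cst|exact: cvg_cst].
  - by move=> l; have [] := cw k (l + k)%N (leq_addl _ _).
have lku k : (\int[leb]_(x in Omega) `|w k x - u x|%:E <= (2^-1 ^+ k)%:E)%E.
  apply: (L1_lsc (w := fun l => w (l + k)%N) _ (mw k) mu (shift k)) => //.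
  by move=> l; have [] := cw k (l + k)%N (leq_addl _ _).
have small (e : R) : 0 < e -> exists k, 2^-1 ^+ k <= e.
  move=> e0; exists (Num.bound e^-1).
  have h : e^-1 <= 2 ^+ Num.bound e^-1.
    apply: (le_trans (ltW (archi_boundP _))); first by rewrite invr_ge0 ltW.
    by rewrite -natrX ler_nat; apply: ltnW; exact: ltn_expl.
  by rewrite exprVn invf_ple ?posrE ?exprn_gt0.
have smalls (k l : nat) : (k <= l)%N -> 2^-1 ^+ l <= 2^-1 ^+ k :> R.
  by move=> kl; rewrite ler_wiXn2l// invf_le1// ler1n.
have Wu : W u.
  apply: (W_closed (fun k => (Ww k).1) admu) => e /small[k ke]; exists k.
  by apply: (le_trans (eku k)); rewrite lee_fin.
have eu : (energy u <= 1%:E)%E.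
  by apply: (energy_lsc Omega_open yg mw mu wu) => k; case: (Ww k).
exists u; split; [exact: Wu|exact: eu|move=> v Wv ev].
apply: (le_trans _ (mJ v Wv ev)).
apply/ler_addgt0Pr => e e0.
have e2 : 0 < e / 2 by rewrite divr_gt0.
have e2l : 0 < e / 2 / lam by rewrite divr_gt0.
have [d d0 hd] := incr_small (@ler01 R) e2l.
have de : 0 < Num.min d (e / 2) by rewrite lt_min d0.
have [k hk] := small _ de.
have [kd ke] : 2^-1 ^+ k <= d /\ 2^-1 ^+ k <= e / 2.
  by split; apply: (le_trans hk); rewrite ge_min lexx ?orbT.
have bound l : (energy (w (l + k)%N) <= (m + e / 2 + lam * (Kf u + e / 2 / lam))%:E)%E.
  have [Wl el] := Ww (l + k)%N; have sl := smalls _ _ (leq_addl l k).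
  have := Kf_increment
    (W_adm Wl) (W_fin Wl) (W_adm Wu) (W_fin Wu).
  have := incr_Rintegral_le Wl Wu (hd _ _ (W_adm Wl) (W_adm Wu) el eu
    (le_trans (lku _) (_ : ((2^-1 ^+ (l + k))%:E <= d%:E)%E))).
  rewrite lee_fin (le_trans sl kd) => /(_ isT) h1 h2.
  have h3 : lam * Kf (w (l + k)%N) <= lam * (Kf u + e / 2 / lam).
    rewrite ler_wpM2l ?(ltW lam0)//; move: h1 h2.
    by move: (Kf _) (Kf _) (Rintegral _ _ _) => *; lra.
  have := Jw (l + k)%N; rewrite (W_energy Wl) lee_fin /Jf.
  move: (le_trans sl ke) h3; move: (_ ^+ _) (fine _) (lam * _) (lam * _) => *.
  lra.
have eul : (energy u <= (m + e / 2 + lam * (Kf u + e / 2 / lam))%:E)%E.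
  by apply: (energy_lsc Omega_open yg (u_ := fun l => w (l + k)%N) _ mu (shift k)).
move: eul; rewrite (W_energy Wu) lee_fin /Jf mulrDr [lam * (_ / lam)]mulrC divfK ?gt_eqF//.
lra.
Unshelve. all: by end_near. Qed.

End Functional.

(** * Negative values of the functional *)

(** Near [x1] the function stays above a constant, and a box has positive volume. *)
Lemma Kf_gt0 f x1 : admissible f -> (energy f < +oo)%E -> Omega x1 ->
  {for x1, continuous f} -> 0 < f x1 -> 0 < Kf f.
Proof.
move=> adm ef Ox1 cf f1.
pose c := Num.min 1 (f x1 / 2).
have c0 : 0 < c by rewrite lt_min ltr01 divr_gt0.
have c1 : c <= 1 by rewrite ge_min lexx.
have cfx : c < f x1 by rewrite gt_min ltr_pdivrMr// ltr_pMr// ltr1n orbT.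
have [e e0 he] : exists2 e : R, 0 < e & forall y : V,
    (forall i, `|x1 ord0 i - y ord0 i| < e) -> Omega y /\ c < f y.
  apply: rV_nbhs_sup; apply: filterI.
    by move: Omega_open; rewrite openE; apply.
  exact: (cvgr_gt _ cf).
pose B := cbox x1 (e / 2); have e2 : 0 < e / 2 by rewrite divr_gt0.
have hB y : B y -> Omega y /\ c < f y.
  by move=> By; apply: he => i; apply: (le_lt_trans (By i)); rewrite ltr_pdivrMr// ltr_pMr// ltr1n.
have mB : measurable B by exact: measurable_cbox.
have ri := reac_integrable adm ef.
pose m := c `^ q / q; have m0 : 0 < m by rewrite divr_gt0// powR_gt0.
rewrite /Kf /Rintegral fine_gt0//; apply/andP; split; last first.
  by rewrite -ge0_fin_numE ?(integrable_fin_num _ ri)//; apply: integral_ge0 => x Ox; rewrite lee_fin (reac_ge0).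
apply: (@lt_le_trans _ _ (\int[leb]_(x in B) m%:E)%E).
  rewrite integral_cst// [X in (_ * X)%E](leb_cbox x1 (ltW e2)) -EFinM lte_fin.
  by rewrite mulr_gt0// exprn_gt0// mulr_gt0.
apply: (@le_trans _ _ (\int[leb]_(x in B) (reac f x)%:E)%E).
  apply: ge0_le_integral => //.
  - by move=> x _; rewrite lee_fin ltW.
  - apply/measurable_EFinP; apply: measurable_funS (measurable_reac adm.1) => //.
    by move=> x /hB[].
  move=> x /hB[Ox cx]; rewrite lee_fin /reac /m.
  have qx0 : 0 < qf x by apply: lt_trans (qf_gt1 Ox).
  apply: ler_pM; rewrite ?powR_ge0 ?invr_ge0 ?(ltW q0)//; last first.
    by rewrite lef_pV2 ?posrE// qf_le.
  apply: (@le_trans _ _ (c `^ qf x)).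
    apply: ger_powR; last exact: qf_le.
    by rewrite c0.
  apply: ge0_ler_powR; rewrite ?nnegrE ?(ltW c0) ?(ltW qx0)//.
  by apply: le_trans (ler_norm _); exact: ltW.
apply: ge0_subset_integral => //.
- by apply/measurable_EFinP; exact: (measurable_reac adm.1).
- by move=> x Ox; rewrite lee_fin (reac_ge0).
- by move=> x /hB[].
Qed.

(** For [t <= 1] the energy decays at least like [t^p0] and the reaction term at
    most like [t^q2]; as [q2 < p0], the latter wins for small [t]. *)
Lemma small_multiple f (q2 lam : R) : admissible f -> (energy f < +oo)%E ->
  0 < q2 < p0 -> (forall x, Omega x -> f x != 0 -> qf x <= q2) -> 0 < Kf f -> 0 < lam ->
  exists2 t : R, 0 <= t & (energy (fun x => t * f x)%R <= 1%:E)%E /\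
    Jf lam (fun x => t * f x) < 0.
Proof.
move=> adm ef /andP[q20 q2p] hq Kf0 lam0.
have [mf f0] := adm.
pose E := fine (energy f); have E0 : 0 <= E by rewrite fine_ge0// (energy_ge0 s Omega yg).
have eE : energy f = E%:E by rewrite fineK// ge0_fin_numE// (energy_ge0 s Omega yg).
(* [t] is chosen below such that [t^(p0 - q2) = m]; then the energy is at most
   [t^q2 * m * E], with [m * E] at most 1 and less than [lam * Kf f]. *)
pose m := Num.min 1 (lam * Kf f) / (E + 1).
have E1 : 0 < E + 1 by rewrite ltr_wpDl.
have lK : 0 < lam * Kf f by rewrite mulr_gt0.
have m0 : 0 < m by rewrite divr_gt0// lt_min ltr01.
have m1 : m <= 1 by rewrite ler_pdivrMr// mul1r ge_min lerDr E0.
have mE1 : m * E <= 1.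
  rewrite /m mulrAC ler_pdivrMr// mul1r.
  apply: (@le_trans _ _ (1 * E)); last by rewrite mul1r lerDl.
  by rewrite ler_wpM2r// ge_min lexx.
have mE2 : m * E < lam * Kf f.
  rewrite /m mulrAC ltr_pdivrMr//.
  apply: (@le_lt_trans _ _ (lam * Kf f * E)); last by rewrite ltr_pM2l// ltrDl.
  by rewrite ler_wpM2r// ge_min lexx orbT.
have d0 : 0 < p0 - q2 by rewrite subr_gt0.
pose t := m `^ (p0 - q2)^-1.
have t0 : 0 < t by rewrite powR_gt0.
have t1 : t <= 1.
  have : m `^ (p0 - q2)^-1 <= 1 `^ (p0 - q2)^-1.
    by apply: ge0_ler_powR; rewrite ?nnegrE ?invr_ge0 ?(ltW d0) ?(ltW m0).
  by rewrite powR1.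
have tm : t `^ (p0 - q2) = m by rewrite /t -powRrM mulVf ?gt_eqF// powRr1// ltW.
have tp : t `^ p0 = t `^ q2 * m by rewrite -tm -powRDp// addrC subrK.
have tq1 : t `^ q2 <= 1.
  have : t `^ q2 <= 1 `^ q2.
    by apply: ge0_ler_powR; rewrite ?nnegrE ?(ltW q20) ?(ltW t0).
  by rewrite powR1.
have tq0 : 0 < t `^ q2 by rewrite powR_gt0.
have t01 : 0 <= t <= 1 by rewrite (ltW t0).
have et : (energy (fun x => t * f x)%R <= (t `^ q2 * (m * E))%:E)%E.
  apply: (le_trans (energy_pow s Omega_open yg t01 mf)); rewrite eE -EFinM lee_fin tp.
  by rewrite -mulrA.
have etoo : (energy (fun x => t * f x)%R < +oo)%E by apply: (le_lt_trans et); rewrite ltry.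
have admt : admissible (fun x => t * f x).
  split; first exact: measurable_funM.
  by apply: filterS f0 => x h /h ->; rewrite mulr0.
exists t; first exact: ltW.
split.
  apply: (le_trans et); rewrite lee_fin -[leRHS]mul1r.
  by apply: ler_pM => //; rewrite ?(ltW tq0)// mulr_ge0// ltW.
have fe : fine (energy (fun x => t * f x)%R) <= t `^ q2 * (m * E).
  rewrite -lee_fin fineK// ge0_fin_numE// (energy_ge0 s Omega yg)//.
have fK : t `^ q2 * Kf f <= Kf (fun x => t * f x).
  rewrite /Kf -RintegralZl//; last exact: (reac_integrable adm ef).
  apply: le_Rintegral => //.
  - have := reac_integrable adm ef.
    move=> /(integrableZl mO (t `^ q2)); apply: eq_integrable => // x _.
  - exact: (reac_integrable admt etoo).
  move=> x Ox; rewrite /reac mulrA; have qx := qf_gt1 Ox.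
  have qx0 : 0 < qf x by apply: lt_trans qx.
  rewrite ler_wpM2r ?invr_ge0 ?(ltW qx0)//.
  have [->|fx] := eqVneq (f x) 0; first by rewrite mulr0 normr0 powR0 ?mulr0// gt_eqF.
  rewrite normrM (gtr0_norm t0) powRM ?(ltW t0)// ler_wpM2r ?powR_ge0//.
  by apply: ger_powR; rewrite ?t0//; exact: hq.
rewrite /Jf subr_lt0; apply: (le_lt_trans fe).
apply: lt_le_trans (ler_wpM2l (ltW lam0) fK).
by rewrite [ltRHS]mulrCA ltr_pM2l.
Qed.

(** * The Euler-Lagrange equation *)

Lemma young_P_ge0 : 0 <= P.
Proof.
have h1 := young_gt0 yg ltr01.
rewrite -(@pmulr_lge0 _ (Psi 1))//; apply: le_trans (young_upper yg 1).
by rewrite mulr1 -(young_psi0 yg) (young_mono yg).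
Qed.

Definition lint u v z : R := psi (Ds s u z) * Ds s v z * mu_density z.
Definition rint u v (x : V) : R := dpow (qf x) (u x) * v x.

Let mQ : measurable (QOmega Omega). Proof. exact: measurable_QOmega. Qed.

Lemma edens_integrable u : W u -> leb2.-integrable (QOmega Omega) (EFin \o edens u).
Proof.
move=> Wu; have [mu _] := W_adm Wu; apply/integrableP; split.
  exact: (measurable_edensE _ yg).
apply: le_lt_trans (W_fin Wu); rewrite /energy.
by under eq_integral do rewrite /= ger0_norm ?(edens_ge0 s yg)//.
Qed.

Lemma energy_Rintegral u : fine (energy u) = \int[leb2]_(z in QOmega Omega) edens u z.
Proof. by []. Qed.

Lemma measurable_lint u v : measurable_fun setT u -> measurable_fun setT v ->
  measurable_fun setT (lint u v).
Proof.
move=> mu mv; apply: measurable_funM; last exact: measurable_mu_density.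
apply: measurable_funM; last exact: measurable_Ds.
apply: measurableT_comp; last exact: measurable_Ds.
by apply: continuous_measurable_fun; exact: (young_cont yg).
Qed.

(** Dominates the integrands of all the variations [u + t v] with [0 <= t <= 1]. *)
Definition dom u v z : R :=
  P * K / 2 * (K / 2) * edens u z + P * K / 2 * (K / 2 + 1) * edens v z.

Lemma dom_integrable u v : W u -> W v ->
  leb2.-integrable (QOmega Omega) (EFin \o dom u v).
Proof.
move=> Wu Wv; apply: integrableD_EFin => //;
  by apply: integrableZ_EFin => //; exact: edens_integrable.
Qed.

Lemma lint_dom u v (t : R) z : 0 <= t <= 1 ->
  `|lint (fun x => u x + t * v x) v z| <= dom u v z.
Proof.
move=> t01; have K0 := young_K_ge0 yg; have P0 := young_P_ge0.
have PK : 0 <= P * K / 2 by rewrite divr_ge0// mulr_ge0.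
rewrite /lint normrM (ger0_norm (mu_density_ge0 z)) DsD DsZ.
have -> : dom u v z = (P * K / 2 * (K / 2 * (Psi (Ds s u z) + Psi (Ds s v z))
    + Psi (Ds s v z))) * mu_density z by rewrite /dom /edens; ring.
rewrite ler_wpM2r ?mu_density_ge0//; apply: (le_trans (young_mul_le yg _ _)).
rewrite ler_wpM2l// lerD2r; apply: (le_trans (young_add yg _ _)).
rewrite ler_wpM2l ?divr_ge0// lerD2l; apply: (young_le yg).
have /andP[t0 t1] := t01; rewrite normrM (ger0_norm t0).
by rewrite ler_piMl.
Qed.

Lemma lint_integrable u v (t : R) : 0 <= t <= 1 -> W u -> W v ->
  leb2.-integrable (QOmega Omega) (EFin \o lint (fun x => u x + t * v x) v).
Proof.
move=> t01 Wu Wv; have [mu _] := W_adm Wu; have [mv _] := W_adm Wv.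
apply: le_integrable (dom_integrable Wu Wv) => //.
  apply: measurable_funTS; apply/measurable_EFinP; apply: measurable_lint => //.
  by apply: measurable_funD => //; exact: measurable_funM.
move=> z _; rewrite /= lee_fin.
exact: le_trans (lint_dom u v z t01) (ler_norm _).
Qed.

Lemma lint_integrable0 u v : W u -> W v ->
  leb2.-integrable (QOmega Omega) (EFin \o lint u v).
Proof.
move=> Wu Wv; have := @lint_integrable u v 0 _ Wu Wv.
by under [X in lint X]eq_fun do rewrite mul0r addr0; apply; rewrite lexx ler01.
Qed.

Lemma rint_integrable u v : W u -> W v -> leb.-integrable Omega (EFin \o rint u v).
Proof.
move=> Wu Wv; have [mu _] := W_adm Wu; have [mv _] := W_adm Wv.
have i0 : leb.-integrable Omega (EFin \o
    (fun x => (1 + `|u x| `^ q) + (1 + `|v x| `^ q))).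
  by apply: integrableD_EFin => //;
    exact: (powq_integrable (W_adm _) (W_fin _)).
apply: le_integrable i0 => //.
  apply/measurable_EFinP; apply: measurable_funM; last exact: measurable_funTS.
  apply: measurable_funM; last exact: measurable_funTS.
  apply: measurable_powR2 => //; last exact: measurable_funB.
  by apply: measurable_funTS; exact: measurableT_comp.
move=> x Ox; have h := qf_gt1 Ox; have h0 : 0 < qf x by exact: lt_trans h.
rewrite /= lee_fin /rint normrM norm_dpow//; apply: (le_trans (power_young _ _ h)).
rewrite [leRHS]ger0_norm; last by rewrite !addr_ge0 ?powR_ge0.
have iq : (qf x)^-1 <= 1 by rewrite invf_le1// ltW.
have iq0 : 0 <= (qf x)^-1 by rewrite invr_ge0 ltW.
apply: lerD.
  apply: (@le_trans _ _ (`|u x| `^ qf x)); first by rewrite ler_piMl ?powR_ge0//; lra.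
  exact: powR_le1D (qf_le Ox).
apply: (@le_trans _ _ (`|v x| `^ qf x)); first by rewrite ler_piMr ?powR_ge0.
exact: powR_le1D (qf_le Ox).
Qed.

Lemma W_perturb u v (t : R) : W u -> W v -> W (fun x => u x + t * v x).
Proof.
move=> Wu Wv; have := W_comb 1 t Wu Wv.
by under eq_fun do rewrite mul1r.
Qed.

(** The tangent inequality at the perturbed function. *)
Lemma energy_increment u v (t : R) : 0 <= t <= 1 -> W u -> W v ->
  fine (energy (fun x => u x + t * v x)) - fine (energy u) <=
    t * \int[leb2]_(z in QOmega Omega) lint (fun x => u x + t * v x) v z.
Proof.
move=> t01 Wu Wv; have Wt := W_perturb t Wu Wv.
have iu := edens_integrable Wu; have it := edens_integrable Wt.
have il := lint_integrable t01 Wu Wv.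
rewrite !energy_Rintegral -RintegralB// -RintegralZl//; apply: le_Rintegral => //.
- exact: integrableB_EFin.
- exact: integrableZ_EFin.
move=> z _; rewrite /edens /lint -mulrBl [leRHS]mulrA ler_wpM2r ?mu_density_ge0//.
have := young_grad yg (Ds s (fun x => u x + t * v x) z) (Ds s u z).
have -> : Ds s (fun x => u x + t * v x) z = Ds s u z + t * Ds s v z.
  by rewrite DsD DsZ.
set a := psi _; rewrite (_ : a * (_ - _) = - (t * a * Ds s v z)); last by ring.
lra.
Qed.

(** The tangent inequality at the unperturbed function; it goes in the direction
    opposite to [energy_increment], so that both bound the variation of [Jf] from
    above. *)
Lemma Kf_increment_lower u v (t : R) : W u -> W v ->
  t * \int[leb]_(x in Omega) rint u v x <= Kf (fun x => u x + t * v x) - Kf u.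
Proof.
move=> Wu Wv; have Wt := W_perturb t Wu Wv.
have ir w : W w -> leb.-integrable Omega (EFin \o reac w).
  move=> Ww; exact: (reac_integrable (W_adm Ww) (W_fin Ww)).
have iu := ir _ Wu; have it := ir _ Wt; have il := rint_integrable Wu Wv.
rewrite -RintegralB// -RintegralZl//; apply: le_Rintegral => //.
- exact: integrableZ_EFin.
- exact: integrableB_EFin.
move=> x Ox; have := pow_grad (u x) (u x + t * v x) (qf_gt1 Ox).
by rewrite /rint /reac addrC addKr mulrCA.
Qed.

Section Minimum.
Variables (lam : R) (u : V -> R).
Hypothesis lam0 : 0 < lam.
Hypothesis Wu : W u.
Hypothesis eu : fine (energy u) < 1.
Hypothesis u_min : forall v, W v -> (energy v <= 1%:E)%E -> Jf lam u <= Jf lam v.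

(** Convexity keeps [u + t v] in the ball for small [t], so minimality and the
    two tangent inequalities give the estimate with [lint] at [u + t v];
    dominated convergence lets [t] tend to 0. *)
Lemma variation_ge v : W v ->
  lam * \int[leb]_(x in Omega) rint u v x <=
    \int[leb2]_(z in QOmega Omega) lint u v z.
Proof.
move=> Wv; have [mu _] := W_adm Wu; have [mv _] := W_adm Wv.
have Wuv : W (fun x => u x + v x).
  by have := W_perturb 1 Wu Wv; under eq_fun do rewrite mul1r.
have e0 w : 0 <= fine (energy w) by apply: fine_ge0; exact: (energy_ge0 s Omega yg).
(* By convexity [E (u + t v) <= E u + t (E (u + v) - E u)], which is at most 1
   for [t <= t0]. *)
pose t0 := (1 - fine (energy u)) / (1 + fine (energy (fun x => u x + v x))).
have d0 : 0 < 1 + fine (energy (fun x => u x + v x)) by rewrite ltr_wpDr.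
have t00 : 0 < t0 by rewrite divr_gt0// subr_gt0.
have t01 : t0 <= 1.
  by rewrite ler_pdivrMr// mul1r; have := e0 u; have := e0 (fun x => u x + v x); lra.
pose t (n : nat) := t0 / n.+1%:R.
have tn0 n : 0 < t n by rewrite divr_gt0.
have tnt0 n : t n <= t0 by rewrite ler_pdivrMr// ler_peMr ?(ltW t00)// ler1n.
have tn01 n : 0 <= t n <= 1 by rewrite (ltW (tn0 n)) (le_trans (tnt0 n)).
have et n : (energy (fun x => u x + t n * v x)%R <= 1%:E)%E.
  have -> : (fun x => u x + t n * v x) = (fun x => (1 - t n) * u x + t n * (u x + v x)).
    by apply/funext => x; ring.
  apply: (le_trans (energy_convex s Omega_open yg (tn01 n) mu _)).
    exact: measurable_funD.
  rewrite (W_energy Wu) (W_energy Wuv).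
  rewrite -!EFinM -EFinD lee_fin.
  have h : t n * (1 + fine (energy (fun x => u x + v x))) <= 1 - fine (energy u).
    by rewrite -ler_pdivlMr.
  move: h (mulr_ge0 (ltW (tn0 n)) (e0 u)) (tn0 n).
  by move: (t n) (fine _) (fine _) => a b c *; lra.
have aux (Et Eu Kt Ku A B : R) : Eu - lam * Ku <= Et - lam * Kt ->
    Et - Eu <= A -> B <= lam * (Kt - Ku) -> B <= A by lra.
have main n : lam * \int[leb]_(x in Omega) rint u v x <=
    \int[leb2]_(z in QOmega Omega) lint (fun x => u x + t n * v x) v z.
  have h1 := u_min (W_perturb (t n) Wu Wv) (et n).
  have h2 := energy_increment (tn01 n) Wu Wv.
  have h3 := ler_wpM2l (ltW lam0) (Kf_increment_lower (t n) Wu Wv).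
  rewrite -(ler_pM2l (tn0 n)) mulrCA.
  exact: aux h1 h2 h3.
have tcvg : t n @[n --> \oo] --> (0 : R).
  rewrite -[X in _ --> X](mulr0 t0); apply: cvgM; first exact: cvg_cst.
  exact: cvg_harmonic.
have [] := @dominated_convergence _ _ R leb2 (QOmega Omega) mQ
  (fun n => EFin \o lint (fun x => u x + t n * v x) v) (EFin \o lint u v) (EFin \o dom u v).
- move=> n; apply: measurable_funTS; apply/measurable_EFinP; apply: measurable_lint => //.
  by apply: measurable_funD => //; exact: measurable_funM.
- by apply: measurable_funTS; apply/measurable_EFinP; exact: measurable_lint.
- apply: aeW => z _; apply/cvg_EFin; first by near=> n.
  apply: cvgM; last exact: cvg_cst.
  apply: cvgM; last exact: cvg_cst.
  apply: continuous_cvg; first exact: (young_cont yg).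
  have -> : (fun n => Ds s (fun x => u x + t n * v x) z) =
      (fun n => Ds s u z + t n * Ds s v z).
    by apply/funext => n; rewrite DsD DsZ.
  have : Ds s u z + t n * Ds s v z @[n --> \oo] --> Ds s u z + 0 * Ds s v z.
    by apply: cvgD; [exact: cvg_cst|apply: cvgM => //; exact: cvg_cst].
  by rewrite mul0r addr0.
- exact: dom_integrable.
- by apply: aeW => z n _; rewrite /= lee_fin; exact: lint_dom.
move=> il _ cl; rewrite -lee_fin /Rintegral [in leRHS]fineK; last first.
  exact: integrable_fin_num.
apply: (cvge_to_ge cl); apply: nearW => n.
have := main n; rewrite /Rintegral -lee_fin [in leRHS]fineK//.
by apply: integrable_fin_num => //; exact: lint_integrable.
Unshelve. all: by end_near. Qed.

(** The inequality for [- v] is the reverse one. *)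
Lemma variation_eq v : W v ->
  \int[leb2]_(z in QOmega Omega) lint u v z =
  lam * \int[leb]_(x in Omega) rint u v x.
Proof.
move=> Wv; apply/eqP; rewrite eq_le variation_ge// andbT.
have WN : W (fun x => -1 * v x).
  by have := W_comb (-1) 0 Wv Wv; under eq_fun do rewrite mul0r addr0.
have := variation_ge WN.
have -> : rint u (fun x => -1 * v x) = (fun x => -1 * rint u v x).
  by apply/funext => x; rewrite /rint; ring.
have -> : lint u (fun x => -1 * v x) = (fun z => -1 * lint u v z).
  by apply/funext => z; rewrite /lint DsZ; ring.
rewrite !RintegralZl//; last first.
- exact: rint_integrable.
- exact: lint_integrable0.
by rewrite !mulN1r mulrN lerN2.
Qed.

End Minimum.

(** The threshold is the inverse of the bound of [Kf]: at a minimiser [Jf] is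
    negative, so its energy is less than [lam * C < 1] and it is interior; it is
    not 0 because [Jf] vanishes at 0. *)
Lemma weak_solution : W (fun=> 0) -> exists2 C, 0 < C & forall lam, 0 < lam ->
  lam < C -> (exists f, [/\ W f, (energy f <= 1%:E)%E & Jf lam f < 0]) ->
  exists u, [/\ W u, ~ {ae leb, forall x, u x = 0} & forall v, W v ->
    [/\ leb2.-integrable (QOmega Omega) (EFin \o lint u v),
        leb.-integrable Omega (EFin \o rint u v) &
        (\int[leb2]_(z in QOmega Omega) (lint u v z)%:E =
         lam%:E * \int[leb]_(x in Omega) (rint u v x)%:E)%E]].
Proof.
move=> W0; have [C C0 hC] := Kf_bound.
exists C^-1; first by rewrite invr_gt0.
move=> lam lam0 lamC [f [Wf ef Jf0]].
have [u [Wu eu umin]] := minimizer lam0 W0.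
have Ju : Jf lam u < 0 by exact: le_lt_trans (umin f Wf ef) Jf0.
have Ku := hC u (W_adm Wu) eu.
have lamC1 : lam * C < 1 by rewrite -ltr_pdivlMr// mul1r.
have eu1 : fine (energy u) < 1.
  have := ler_wpM2l (ltW lam0) Ku; move: Ju; rewrite /Jf.
  by move: (fine _) (Kf _) lamC1 => *; lra.
exists u; split => //.
  move=> u0; suff Ku0 : Kf u = 0.
    move: Ju; rewrite /Jf Ku0 mulr0 subr0 ltNge fine_ge0//.
    exact: (energy_ge0 s Omega yg).
  rewrite /Kf /Rintegral; have [mu _] := W_adm Wu.
  have -> : (\int[leb]_(x in Omega) (reac u x)%:E = \int[leb]_(x in Omega) 0%E)%E; last first.
    by rewrite integral0.
  apply: ae_eq_integral => //.
    by apply/measurable_EFinP; exact: (measurable_reac).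
  apply: filterS u0 => x ux Ox; rewrite /= /reac ux normr0 powR0 ?mul0r//.
  by rewrite gt_eqF// (lt_trans ltr01)// qf_gt1.
move=> v Wv; have il := lint_integrable0 Wu Wv; have ir := rint_integrable Wu Wv.
split; [exact: il|exact: ir|].
rewrite -(fineK (integrable_fin_num mQ il)) -(fineK (integrable_fin_num mO ir)) -EFinM.
by congr EFin; exact: (variation_eq lam0 Wu eu1 umin Wv).
Qed.

End Embedding.

(** * Test functions *)

Section TestFunctions.
Variables (R : realType) (N : nat).
Notation V := ('rV[R]_N).
Implicit Types (f g : V -> R).

Lemma class_C_comb (k : nat) (c d : R) f g : class_C k f -> class_C k g ->
  class_C k (fun x => c * f x + d * g x).
Proof.
have cont f1 g1 : continuous f1 -> continuous g1 ->
    continuous (fun x : V => c * f1 x + d * g1 x).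
  move=> cf cg x.
  exact: (cvgD (cvgM (cvg_cst c) (cf x)) (cvgM (cvg_cst d) (cg x))).
elim: k f g => [|k IH] f g; first exact: cont.
move=> [cf df] [cg dg]; split; first exact: cont.
move=> i; have [dfi Cf] := df i; have [dgi Cg] := dg i.
have dcf x := @derivableZ _ _ _ f c x _ (dfi x).
have dcg x := @derivableZ _ _ _ g d x _ (dgi x).
split=> [x|]; first exact: (derivableD (dcf x) (dcg x)).
have -> : partial i (fun x => c * f x + d * g x) = (fun x => c * partial i f x + d * partial i g x).
  apply/funext => x; have := deriveD (dcf x) (dcg x).
  by rewrite (deriveZ c (dfi x)) (deriveZ d (dgi x)).
exact: IH.
Qed.

Lemma C0infty_comb (Omega : set V) (c d : R) f g : C0infty Omega f -> C0infty Omega g ->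
  C0infty Omega (fun x => c * f x + d * g x).
Proof.
move=> [Cf kf sf] [Cg kg sg].
have sub : closure [set x | c * f x + d * g x != 0] `<=`
    closure [set x | f x != 0] `|` closure [set x | g x != 0].
  rewrite -closureU; apply: closureS => x /= h.
  have [fx|fx] := eqVneq (f x) 0; last by left.
  by right; apply: contra h => /eqP gx; rewrite fx gx !mulr0 addr0.
split; first by move=> k; exact: class_C_comb.
  apply: (subclosed_compact _ (compactU kf kg) sub); exact: closed_closure.
by move=> x /sub[/sf|/sg].
Qed.

(** The image of the support is compact. *)
Lemma bounded_compact_support f g : continuous g -> compact (closure [set x | f x != 0]) ->
  (forall x, ~ closure [set x | f x != 0] x -> g x = 0) ->
  exists2 M : R, 0 <= M & forall x, `|g x| <= M.
Proof.
move=> cg kf g0; set S := closure _ in kf g0.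
have : compact (g @` S).
  by apply: continuous_compact => //; exact: continuous_subspaceT.
move=> /compact_bounded[M [_ hM]]; exists (`|M| + 1); first by rewrite addr_ge0.
move=> x; have [Sx|nSx] := pselect (S x); last by rewrite (g0 x nSx) normr0 addr_ge0.
apply: (hM (`|M| + 1)); last by exists x.
by rewrite (le_lt_trans (ler_norm _))// ltrDl.
Qed.

Lemma off_support f x : ~ closure [set x | f x != 0] x -> \forall y \near x, f y = 0.
Proof.
move=> nx.
have : open (~` closure [set x | f x != 0]) by apply: closed_openC; exact: closed_closure.
rewrite openE => /(_ x nx); apply: filterS => y ny.
by apply: contrapT => /eqP fy; apply: ny; exact: subset_closure.
Qed.

Lemma partial_bounded f i : class_C 1 f -> compact (closure [set x | f x != 0]) ->
  exists2 M : R, 0 <= M & forall x, `|partial i f x| <= M.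
Proof.
move=> [cf df] kf; have [dfi cp] := df i.
apply: (bounded_compact_support cp kf) => x /off_support nx.
by rewrite /partial (@near_eq_derive _ _ _ f (cst 0))// derive_cst.
Qed.

Lemma line_derive f i x (t : R) : (forall y, derivable f y (delta_mx ord0 i)) ->
  is_derive t 1 (fun r : R => f (x + r *: delta_mx ord0 i))
    (partial i f (x + t *: delta_mx ord0 i)).
Proof.
move=> df; set v := delta_mx ord0 i in df *.
have e : (fun h : R => h^-1 *: (((fun r : R => f (x + r *: v)) \o shift t) (h *: (1 : R)) - f (x + t *: v)))
   = (fun h : R => h^-1 *: ((f \o shift (x + t *: v)) (h *: v) - f (x + t *: v))).
  apply/funext => h /=; congr (_ *: (f _ - _)).
  by rewrite scaler1 scalerDl addrC -addrA [t *: v + x]addrC.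
have d1 := df (x + t *: v).
split.
  by rewrite /derivable e; exact: d1.
by rewrite /partial /derive e.
Qed.

(** The mean value theorem along a coordinate direction. *)
Lemma line_lipschitz f i (M : R) x (t : R) :
  (forall y, derivable f y (delta_mx ord0 i)) ->
  (forall y, `|partial i f y| <= M) ->
  `|f (x + t *: delta_mx ord0 i) - f x| <= M * `|t|.
Proof.
move=> df hM; set v := delta_mx ord0 i.
pose g (r : R) := f (x + r *: v).
pose dg (r : R) := partial i f (x + r *: v).
have dgP (r : R) : is_derive r (1 : R) g (dg r) by exact: line_derive.
have cg (a b : R) : {within `[a, b], continuous g}.
  apply: derivable_within_continuous => r _; by have [] := dgP r.
have key (a b : R) : a <= b -> `|g b - g a| <= M * (b - a).
  move=> ab; have [c _ ->] := MVT_segment ab (fun r _ => dgP r) (cg a b).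
  have ba : 0 <= b - a by rewrite subr_ge0.
  by rewrite normrM (ger0_norm ba) ler_wpM2r//; exact: hM.
have -> : f x = g 0 by rewrite /g scale0r addr0.
rewrite -[f _]/(g t); have [t0|t0] := leP 0 t.
  by have := key _ _ t0; rewrite subr0 (ger0_norm t0).
by have := key _ _ (ltW t0); rewrite sub0r distrC (ltr0_norm t0).
Qed.

(** One coordinate is changed at a time; the partial derivatives are bounded
    because they vanish off the compact support. *)
Lemma C0infty_lipschitz (Omega : set V) f : C0infty Omega f ->
  exists2 M : R, 0 <= M & forall x y, `|f x - f y| <= M * enorm (x - y).
Proof.
move=> [Cf kf _]; have C1 := Cf 1%N.
have dfi i : forall y, derivable f y (delta_mx ord0 i) by case: C1 => _ /(_ i)[].
have [M hM] : {M : 'I_N -> R & forall i, 0 <= M i /\ forall x, `|partial i f x| <= M i}.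
  apply: (@choice _ _ (fun i M => 0 <= M /\ forall x, `|partial i f x| <= M)) => i.
  by have [M M0 hM] := partial_bounded i C1 kf; exists M.
exists (\sum_i M i); first by apply: sumr_ge0 => i _; case: (hM i).
move=> x y.
(* [z k] has the first [k] coordinates of [y] and the others of [x]. *)
pose z (k : nat) : V := \row_i (if (i < k)%N then y ord0 i else x ord0 i).
have step k (kN : (k < N)%N) :
    `|f (z k.+1) - f (z k)| <= M (Ordinal kN) * enorm (x - y).
  pose i := Ordinal kN.
  have -> : z k.+1 = z k + (y ord0 i - x ord0 i) *: delta_mx ord0 i.
    apply/rowP => j; rewrite !mxE eqxx /=; have [->|ji] := eqVneq j i.
      by rewrite /= ltnSn ltnn mulr1 addrC subrK.
    rewrite mulr0 addr0 ltnS leq_eqVlt; case: eqP => // jk.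
    by case/eqP: ji; exact: val_inj.
  have [M0 hMi] := hM i.
  apply: (le_trans (line_lipschitz (z k) _ (dfi i) hMi)).
  rewrite ler_wpM2l// enormBC; have := enorm_coord (y - x) i; by rewrite !mxE.
have tele k : (k <= N)%N -> `|f (z k) - f (z 0%N)| <=
    (\sum_(i < N | (i < k)%N) M i) * enorm (x - y).
  elim: k => [_|k IH kN]; first by rewrite subrr normr0 mulr_ge0 ?enorm_ge0// sumr_ge0// => i _; case: (hM i).
  rewrite -(subrKA (f (z k))); apply: (le_trans (ler_normD _ _)).
  rewrite (bigD1 (Ordinal kN)) ?ltnSn//= mulrDl; apply: lerD; first exact: step.
  rewrite (eq_bigl (fun i : 'I_N => (i < k)%N)) ?IH 1?ltnW// => i.
  rewrite ltnS leq_eqVlt -val_eqE /=; case: eqP => [->|_]; first by rewrite ltnn.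
  by rewrite andbT.
have z0 : z 0%N = x by apply/rowP => i; rewrite mxE.
have zN : z N = y by apply/rowP => i; rewrite mxE ltn_ord.
have := tele N (leqnn N); rewrite z0 zN distrC => h; apply: (le_trans h).
rewrite le_eqVlt; apply/orP; left; apply/eqP; congr (_ * _).
by apply: eq_bigl => i; rewrite ltn_ord.
Qed.

Lemma C0infty_bounded (Omega : set V) f : C0infty Omega f ->
  exists2 M : R, 0 <= M & forall x, `|f x| <= M.
Proof.
move=> [Cf kf _]; apply: (bounded_compact_support (Cf 0%N) kf) => x nx.
by apply: contrapT => /eqP fx; apply: nx; exact: subset_closure.
Qed.

Lemma C0infty_measurable (Omega : set V) f : C0infty Omega f -> measurable_fun setT f.
Proof.
by move=> [Cf _ _]; apply: continuous_measurable_rV; [exact: openT|move=> x _; exact: (Cf 0%N)].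
Qed.

Lemma C0infty_off (Omega : set V) f x : C0infty Omega f -> ~ Omega x -> f x = 0.
Proof.
move=> [_ _ sf] nx; apply: contrapT => /eqP fx; apply: nx; apply: sf.
exact: subset_closure.
Qed.

End TestFunctions.

(** * Finite energy of the test functions *)

Lemma dyadic (R : realType) (t : R) : 1 <= t ->
  exists j : nat, 2 ^+ j <= t < 2 ^+ j.+1.
Proof.
move=> t1.
have ex : exists n : nat, t < 2 ^+ n.
  have t0 := le_trans ler01 t1.
  exists (Num.bound t); apply: lt_le_trans (archi_boundP t0) _.
  by rewrite -natrX ler_nat; apply: ltnW; exact: ltn_expl.
case: (ex_minnP ex) => -[|n] tn mn; first by move: tn; rewrite expr0 ltNge t1.
by exists n; rewrite tn andbT leNgt; apply/negP => /mn; rewrite ltnn.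
Qed.

Lemma geometric_le (R : realType) (g : R) (n : nat) : 0 <= g < 1 ->
  \sum_(0 <= j < n) g ^+ j <= (1 - g)^-1.
Proof.
move=> /andP[g0 g1]; have g2 : 0 < 1 - g by rewrite subr_gt0.
suff -> : \sum_(0 <= j < n) g ^+ j = (1 - g ^+ n) / (1 - g).
  by rewrite ler_piMl ?invr_ge0 ?(ltW g2)// gerBl exprn_ge0.
elim: n => [|n IH]; first by rewrite big_geq// expr0 subrr mul0r.
by rewrite big_nat_recr//= IH exprS; field; rewrite gt_eqF.
Qed.

Lemma powR_expn (R : realType) (x y : R) (j : nat) : 0 <= x ->
  (x `^ y) ^+ j = (x ^+ j) `^ y.
Proof.
move=> x0; rewrite -(powR_mulrn j (powR_ge0 x y)) -(powR_mulrn j x0).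
by rewrite -!powRrM [y * _]mulrC.
Qed.

Section SmoothEnergy.
Variables (R : realType) (N : nat) (s : R) (Omega : set 'rV[R]_N).
Notation V := ('rV[R]_N).
Notation leb := (lebesgue_rV R N).
Notation leb2 := (lebesgue_rV R N \x lebesgue_rV R N)%E.
Hypothesis N1 : (1 <= N)%N.
Hypothesis s01 : 0 < s < 1.
Hypothesis Omega_open : open Omega.
Variables (Psi psi : R -> R) (P K p0 : R).
Hypothesis yg : young Psi psi P K p0.
Notation energy := (energy s Omega Psi).
Notation edens := (edens s Psi).
Notation fiber := (fiber s Psi).
Let s0 : 0 < s. Proof. by case/andP: s01. Qed.
Let mO : measurable Omega. Proof. exact: measurable_Omega. Qed.
Let al : R := 2^-1 `^ (1 - s).
Let be : R := 2^-1 `^ s.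

Implicit Types (u f : V -> R) (x y : V).
Let half_powR (p : R) : 0 < p -> 0 <= (2^-1 : R) `^ p < 1.
Proof.
move=> pp; rewrite powR_ge0 /=.
have : (2^-1 : R) `^ p < 1 `^ p.
  by apply: gt0_ltr_powR; rewrite ?nnegrE ?invr_ge0// invf_lt1// ltr1n.
by rewrite powR1.
Qed.
Let al01 : 0 <= al < 1.
Proof. by apply: half_powR; rewrite subr_gt0; case/andP: s01. Qed.
Let be01 : 0 <= be < 1.
Proof. exact: half_powR. Qed.

Lemma edensC u x y : edens u (x, y) = edens u (y, x).
Proof.
rewrite /edens /mu_density /Ds /= enormBC; congr (_ * _).
by rewrite -(youngN yg) -mulNr opprB.
Qed.

(** A pair in Q has its first or its second point in [Omega], and the density is
    symmetric. *)
Lemma energy_le_fiber u : measurable_fun setT u ->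
  (energy u <= \int[leb]_(x in Omega) fiber u x + \int[leb]_(x in Omega) fiber u x)%E.
Proof.
move=> mu.
have ed0 z : (0 <= (edens u z)%:E)%E by rewrite lee_fin (edens_ge0 _ yg).
have med D : measurable_fun D (fun z => (edens u z)%:E) by exact: (measurable_edensE s yg).
have mS : measurable (Omega `*` [set: V]) by exact: measurableX.
have mS' : measurable ([set: V] `*` Omega) by exact: measurableX.
have -> : (\int[leb]_(x in Omega) fiber u x + \int[leb]_(x in Omega) fiber u x =
  \int[leb2]_(z in Omega `*` setT) (edens u z)%:E + \int[leb2]_(z in setT `*` Omega) (edens u z)%:E)%E.
  congr (_ + _)%E; first by rewrite (fiber_strip s Omega_open yg).
  rewrite [RHS]integral_mkcond /= fubini_tonelli2/=; first last.
  - by apply: erestrict_ge0 => z; rewrite lee_fin (edens_ge0 _ yg).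
  - by apply/(measurable_restrictT _ _).1.
  rewrite integral_mkcond.
  apply: eq_integral => y _; rewrite /fubini_G patchE; case: ifPn => xO.
    apply: eq_integral => x _; rewrite patchE ifT// 1?edensC// inE; split => //.
    by rewrite inE in xO.
  rewrite integral0_eq// => x _; rewrite patchE ifF//.
  by apply/negP; rewrite inE => -[/= _ Ox]; rewrite notin_setE in xO.
rewrite /energy.
have -> : QOmega Omega = Omega `*` setT `|` (([set: V] `*` Omega) `\` (Omega `*` setT)).
  apply/seteqP; split=> -[x y] /=.
    move=> h; have [Ox|nx] := pselect (Omega x); first by left.
    right; split; last by case.
    by split => //; apply: contrapT => ny; apply: h.
  by case=> [[Ox _] []//|[[_ Oy] _] []//].
rewrite ge0_integral_setU//.
- by rewrite leeD2l//; apply: ge0_subset_integral => //; exact: measurableD.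
- exact: measurableD.
- by rewrite disj_set2E; apply/eqP; rewrite setDE setICA setICr setI0.
Qed.

(** For [u] bounded and Lipschitz, [|Ds u|] is at most a constant times
    [min (e^(1-s), e^(-s))] at distance [e], so the density is integrable both near
    [x] and at infinity.  The dyadic shells around [x] are dominated by boxes,
    whose volumes make the series geometric with ratios [al] and [be]. *)
Lemma fiber_smooth u (B : R) x : measurable_fun setT u -> 0 <= B ->
  (forall x y, `|u x - u y| <= B) -> (forall x y, `|u x - u y| <= B * enorm (x - y)) ->
  (fiber u x <= (Psi B * 4 ^+ N * ((1 - al)^-1 + (1 - be)^-1))%:E)%E.
Proof.
move=> mu B0 uB uL.
pose c1 (j : nat) : R := Psi B * al ^+ j * 2 ^+ j.+1 ^+ N.
pose c2 (j : nat) : R := Psi B * be ^+ j * 2 ^- j ^+ N.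
pose b1 (j : nat) : set V := cbox x (2 ^- j).
pose b2 (j : nat) : set V := cbox x (2 ^+ j.+1).
pose G (j : nat) (y : V) : \bar R := ((c1 j)%:E * (\1_(b1 j) y)%:E + (c2 j)%:E * (\1_(b2 j) y)%:E)%E.
have PB : 0 <= Psi B by exact: (young_ge0 yg).
have [al0 al1] := andP al01; have [be0 be1] := andP be01.
have c10 j : 0 <= c1 j by rewrite !mulr_ge0 ?exprn_ge0.
have c20 j : 0 <= c2 j by rewrite !mulr_ge0 ?exprn_ge0// invr_ge0 exprn_ge0.
have i0 (A : set V) y : (0 <= (\1_A y : R)%:E)%E by rewrite lee_fin.
have mI (A : set V) : measurable A -> measurable_fun setT (fun y => (\1_A y : R)%:E).
  by move=> mA; apply/measurable_EFinP; exact: measurable_indic.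
have mb1 j : measurable (b1 j) by exact: measurable_cbox.
have mb2 j : measurable (b2 j) by exact: measurable_cbox.
have G0 j y : (0 <= G j y)%E by rewrite adde_ge0// mule_ge0// lee_fin.
have mG j : measurable_fun setT (G j).
  by apply: emeasurable_funD; apply: measurable_funeM; exact: mI.
have IG j : (\int[leb]_y G j y = (Psi B * 4 ^+ N * (al ^+ j + be ^+ j))%:E)%E.
  rewrite ge0_integralD//; last 4 first.
  - by move=> y _; rewrite mule_ge0// lee_fin.
  - by apply: measurable_funeM; exact: mI.
  - by move=> y _; rewrite mule_ge0// lee_fin.
  - by apply: measurable_funeM; exact: mI.
  rewrite !ge0_integralZl//; try exact: mI; try by rewrite lee_fin.
  have I1 : (\int[leb]_y (\1_(b1 j) y)%:E = ((2 * 2 ^- j) ^+ N)%:E)%E.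
    by rewrite integral_indic// setIT; apply: leb_cbox; rewrite invr_ge0 exprn_ge0.
  have I2 : (\int[leb]_y (\1_(b2 j) y)%:E = ((2 * 2 ^+ j.+1) ^+ N)%:E)%E.
    by rewrite integral_indic// setIT; apply: leb_cbox; rewrite exprn_ge0.
  rewrite I1 I2.
  rewrite -!EFinM -EFinD; congr EFin; rewrite /c1 /c2.
  have p2 : (2 ^+ j : R) != 0 by rewrite expf_neq0.
  have e1 : 2 ^+ j.+1 ^+ N * (2 * 2 ^- j) ^+ N = 4 ^+ N :> R.
    by rewrite -exprMn; congr (_ ^+ _); rewrite exprS; field.
  have e2 : 2 ^- j ^+ N * (2 * 2 ^+ j.+1) ^+ N = 4 ^+ N :> R.
    by rewrite -exprMn; congr (_ ^+ _); rewrite exprS; field.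
  by rewrite -!(mulrA (Psi B)) -!mulrDr -2!(mulrA (_ ^+ j)) e1 e2; ring.
have dom y : ((edens u (x, y))%:E <= \sum_(0 <= j <oo) G j y)%E.
  suff [j hj] : exists j, ((edens u (x, y))%:E <= G j y)%E.
    apply: (le_trans hj); apply: (@le_trans _ _ (\sum_(0 <= i < j.+1) G i y)%E).
      by rewrite big_nat_recr//= leeDr// sume_ge0.
    exact: nneseries_lim_ge.
  have [->|xy] := eqVneq x y.
    by exists 0%N; rewrite /edens /Ds subrr mul0r (young_0 yg) mul0r.
  set e := enorm (x - y); have e0 : 0 < e by exact: enorm_gt0.
  have es : 0 < e `^ s by rewrite powR_gt0.
  have low (m : R) : 0 <= m <= 1 -> `|u x - u y| / e `^ s <= B * m ->
      edens u (x, y) <= Psi B * m * e ^- N.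
    move=> m01 h; rewrite /edens /mu_density /= -/e ler_wpM2r ?invr_ge0 ?exprn_ge0 ?(ltW e0)//.
    rewrite [leRHS]mulrC; apply: le_trans (young_scale yg _ m01).
    apply: (young_le yg); rewrite [m * B]mulrC /Ds /= -/e normrM normfV (gtr0_norm es).
    by apply: (le_trans h); exact: ler_norm.
  have [e1|e1] := leP e 1.
    have e1V : 1 <= e^-1 by rewrite invf_ge1.
    have [j /andP[j1 j2]] := dyadic e1V.
    exists j.
    have ej : e <= 2 ^- j by rewrite -(invrK e) lef_pV2// posrE ?invr_gt0// exprn_gt0.
    have m0 : 0 <= e `^ (1 - s) by exact: powR_ge0.
    have ma : e `^ (1 - s) <= al ^+ j.
      rewrite powR_expn// exprVn; apply: ge0_ler_powR => //; rewrite ?nnegrE ?(ltW e0) ?invr_ge0 ?exprn_ge0//.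
      by rewrite subr_ge0 ltW//; case/andP: s01.
    apply: (@le_trans _ _ ((c1 j)%:E * (\1_(b1 j) y)%:E)%E); last by rewrite leeDl// mule_ge0// lee_fin.
    rewrite indicE mem_set /=; last exact: cbox_enorm.
    rewrite mule1 lee_fin; apply: (le_trans (low (e `^ (1 - s)) _ _)).
    - by rewrite m0 /=; apply: (le_trans ma); rewrite exprn_ile1// ltW.
    - rewrite powRB//; last by apply/implyP => _; rewrite gt_eqF.
      by rewrite powRr1 ?(ltW e0)// mulrA ler_wpM2r ?invr_ge0 ?(ltW es)//; exact: uL.
    rewrite /c1 -!mulrA ler_wpM2l//; apply: ler_pM => //.
    - by rewrite invr_ge0 exprn_ge0// ltW.
    - by rewrite -exprVn lerXn2r ?nnegrE ?exprn_ge0 ?invr_ge0 ?(ltW e0)// ltW.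
  have [j /andP[j1 j2]] := dyadic (ltW e1).
  exists j.
  have m0 : 0 <= (e `^ s)^-1 by rewrite invr_ge0 ltW.
  have ma : (e `^ s)^-1 <= be ^+ j.
    have -> : (e `^ s)^-1 = e^-1 `^ s.
      by rewrite -powRN -(powR_inv1 (ltW e0)) -powRrM mulN1r.
    rewrite powR_expn// exprVn; apply: ge0_ler_powR; rewrite ?nnegrE ?invr_ge0 ?exprn_ge0//.
    - exact: ltW.
    - exact: ltW.
    - by rewrite lef_pV2// posrE// exprn_gt0.
  apply: (@le_trans _ _ ((c2 j)%:E * (\1_(b2 j) y)%:E)%E); last by rewrite leeDr// mule_ge0// lee_fin.
  rewrite indicE mem_set /=; last by apply: cbox_enorm; exact: ltW.
  rewrite mule1 lee_fin; apply: (le_trans (low (e `^ s)^-1 _ _)).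
  - by rewrite m0 /=; apply: (le_trans ma); rewrite exprn_ile1// ltW.
  - by rewrite ler_wpM2r.
  rewrite /c2 -!mulrA ler_wpM2l//; apply: ler_pM => //.
  - by rewrite invr_ge0 exprn_ge0// ltW.
  - rewrite exprVn lef_pV2 ?posrE ?exprn_gt0//.
    by rewrite lerXn2r ?nnegrE ?exprn_ge0 ?(ltW e0).
apply: (@le_trans _ _ (\int[leb]_y \sum_(0 <= j <oo) G j y)%E).
  apply: ge0_le_integral => //.
  - by move=> y _; rewrite lee_fin (edens_ge0 _ yg).
  - by apply/measurable_EFinP; exact: (measurable_edens_fiber _ yg).
  - by apply: ge0_emeasurable_sum.
rewrite integral_nneseries//.
apply: lime_le; first by apply: is_cvg_nneseries => j _ _; exact: integral_ge0.
apply: nearW => n; under eq_bigr do rewrite IG.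
rewrite sumEFin lee_fin -mulr_sumr ler_wpM2l ?mulr_ge0 ?exprn_ge0//.
by rewrite big_split /=; apply: lerD; exact: geometric_le.
Qed.

(** The fibers are bounded uniformly over [Omega], which has finite measure. *)
Lemma C0infty_energy f : (leb Omega < +oo)%E -> C0infty Omega f -> (energy f < +oo)%E.
Proof.
move=> fO Cf; have mf := C0infty_measurable Cf.
have [M M0 hM] := C0infty_bounded Cf; have [M' M'0 hM'] := C0infty_lipschitz Cf.
pose B := Num.max (2 * M) M'.
have B0 : 0 <= B by rewrite le_max M'0 orbT.
have b1 x y : `|f x - f y| <= B.
  rewrite le_max; apply/orP; left; rewrite mulr_natl mulr2n.
  by apply: (le_trans (ler_normB _ _)); exact: lerD.
have b2 x y : `|f x - f y| <= B * enorm (x - y).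
  by apply: (le_trans (hM' x y)); rewrite ler_wpM2r ?enorm_ge0// le_max lexx orbT.
have h x := fiber_smooth x mf B0 b1 b2; set C := (X in X%:E) in h.
apply: (le_lt_trans (energy_le_fiber mf)).
suff : (\int[leb]_(x in Omega) fiber f x < +oo)%E by move=> ?; exact: lte_add_pinfty.
apply: (@le_lt_trans _ _ (\int[leb]_(x in Omega) C%:E)%E).
  apply: ge0_le_integral => //.
  - by move=> x _; exact: (fiber_ge0 s yg).
  - by apply: measurable_funTS; exact: (measurable_fiber s yg).
rewrite integral_cst//.
exact: (lte_mul_pinfty (le_trans (fiber_ge0 s yg f 0) (h 0)) _ fO).
Qed.

End SmoothEnergy.

(** * Smooth bumps *)

Section Bump1D.
Variable R : realType.
Implicit Types (f g : R -> R) (t x : R) (n : nat).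

Lemma is_derive_comp1 f g x (df dg : R) :
  is_derive x (1 : R) f df -> is_derive (f x) (1 : R) g dg ->
  is_derive x (1 : R) (g \o f) (dg * df).
Proof.
move=> [f1 f2] [g1 g2]; split.
  have Df := (derivable1_diffP f x).1 f1; have Dg := (derivable1_diffP g (f x)).1 g1.
  exact: ((derivable1_diffP (g \o f) x).2 (differentiable_comp Df Dg)).
by rewrite -derive1E (derive1_comp f1 g1) !derive1E f2 g2.
Qed.

Let D : {poly R} := 1 - 'X^2.
Let w (t : R) : R := (1 - t ^+ 2)^-1.

(** With [w = 1 / (1 - t^2)] one has [w' = 2 t w^2], so the functions
    [p(t) w^(2n) exp (-w)] are mapped to each other by differentiation; the
    recursion records the effect on [p]. *)
Fixpoint bump_poly (n : nat) : {poly R} :=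
  if n is n'.+1 then
    let p := bump_poly n' in
    p^`() * D ^+ 2 + (4 * n')%:R *: ('X * p * D) - 2 *: ('X * p)
  else 1.

(** The n-th derivative of [exp (-1 / (1 - t^2))], extended by 0. *)
Definition bump (n : nat) (t : R) : R :=
  if `|t| < 1 then (bump_poly n).[t] * w t ^+ (2 * n) * expR (- w t) else 0.

Lemma bump_gt0 t : `|t| < 1 -> 0 < bump 0 t.
Proof.
by move=> t1; rewrite /bump t1 /= hornerC mul1r muln0 expr0 mul1r expR_gt0.
Qed.

Lemma bump_ge0 t : 0 <= bump 0 t.
Proof.
have [t1|t1] := ltP `|t| 1; first by rewrite ltW// bump_gt0.
by rewrite /bump ltNge t1.
Qed.

Let sqr_lt1 t : `|t| < 1 -> 0 < 1 - t ^+ 2.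
Proof.
by move=> t1; rewrite subr_gt0 -real_normK ?num_real// exprn_ilt1.
Qed.

Let w_derive t : `|t| < 1 -> is_derive t (1 : R) w (2 * t * w t ^+ 2).
Proof.
move=> t1; have d0 := gt_eqF (sqr_lt1 t1).
have dD := is_derive_poly D t.
have De x : D.[x] = 1 - x ^+ 2 by rewrite /D !hornerE.
have -> : w = (fun x => (D.[x])^-1) by apply/funext => x; rewrite De.
have Dt0 : D.[t] != 0 by rewrite De d0.
have [d1 d2] := dD.
split; first exact: derivableV.
rewrite deriveV// d2 /GRing.scale /= /D derivB derivC derivXn hornerE !hornerE /=.
by field; rewrite -De.
Qed.

Lemma bump_derive_in n t : `|t| < 1 -> is_derive t (1 : R) (bump n) (bump n.+1 t).
Proof.
move=> t1.
have dw := w_derive t1.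
have [dp dX] := (is_derive_poly (bump_poly n) t, is_deriveX (2 * n) dw).
have dN := is_deriveN dw.
have dE := is_derive_comp1 dN (is_derive_expR _).
have dG := is_deriveM (is_deriveM dp dX) dE.
have near1 : \forall x \near t, `|x| < 1.
  have ct : `|x| @[x --> t] --> `|t| by apply: cvg_norm; exact: cvg_id.
  exact: (cvgr_lt _ ct).
apply: near_eq_is_derive (is_derive_eq dG _).
  near=> x; have x1 : `|x| < 1 by near: x.
  by rewrite /bump x1 /= !fctE.
rewrite /bump t1 /= !fctE /GRing.scale /= mulnS addSn add1n !exprS.
rewrite !(hornerE, hornerXn) /=.
have d0 : 1 - t ^+ 2 != 0 by rewrite gt_eqF// sqr_lt1.
have wD : (1 - t ^+ 2) = (w t)^-1 by rewrite invrK.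
have w0 : w t != 0 by rewrite invr_eq0.
rewrite wD; case: n {dp dX dG} => [|n].
  move: (_.[t]) (_^`().[t]) (expR (- w t)) (w t) w0 => a b e v v0.
  by rewrite !muln0 !expr0 /=; field.
rewrite !natrM mulnS addSn add1n /= !exprS.
move: (_.[t]) (_^`().[t]) (expR (- w t)) (w t) w0 (n.+1%:R) (_ ^+ (2 * n)) => a b e v v0 m c.
by field.
Unshelve. all: by end_near. Qed.

(** The exponential beats every power of [w], in particular [w^(2n+2)]. *)
Lemma bump_quadratic n : exists2 C : R, 0 <= C & forall t, `|bump n t| <= C * (1 - `|t|) ^+ 2.
Proof.
pose B := \sum_(i < size (bump_poly n)) `|(bump_poly n)`_i|.
pose m := (2 * n).+1.
have B0 : 0 <= B by exact: sumr_ge0.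
exists (B * (m.+1)`!%:R * 4); first by rewrite !mulr_ge0.
move=> t; rewrite /bump; case: ifPn => [t1|_]; last first.
  by rewrite normr0; apply: mulr_ge0; [rewrite !mulr_ge0|exact: sqr_ge0].
have Bt : `|(bump_poly n).[t]| <= B.
  rewrite horner_coef; apply: (le_trans (ler_norm_sum _ _ _)); apply: ler_sum => i _.
  by rewrite normrM normrX ler_piMr// exprn_ile1// ltW.
have w0 : 0 < w t by rewrite invr_gt0 sqr_lt1.
have h : w t ^+ (2 * n) * expR (- w t) <= (m.+1)`!%:R * (w t ^+ 2)^-1.
  rewrite expRN ler_pdivrMr ?expR_gt0//.
  have := expR_ge1Dxn m (ltW w0) => he.
  have h2 : w t ^+ m.+1 / m.+1`!%:R <= expR (w t) by apply: le_trans he; rewrite lerDr.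
  have em : w t ^+ m.+1 = w t ^+ (2 * n) * w t ^+ 2.
    by rewrite -exprD; congr (_ ^+ _); rewrite /m; lia.
  rewrite ler_pdivrMr ?ltr0n ?fact_gt0// em in h2.
  by rewrite mulrAC ler_pdivlMr ?exprn_gt0// [leRHS]mulrC.
rewrite -mulrA normrM; apply: (le_trans (ler_pM _ _ Bt (lexx _))) => //.
rewrite -!mulrA ler_wpM2l// ger0_norm; last by rewrite mulr_ge0 ?expR_ge0// exprn_ge0// ltW.
apply: (le_trans h); rewrite ler_wpM2l// /w -exprVn invrK.
have -> : 1 - t ^+ 2 = (1 - `|t|) * (1 + `|t|).
  by rewrite -[t ^+ 2]real_normK ?num_real//; ring.
rewrite exprMn mulrC ler_wpM2r ?sqr_ge0//.
have -> : 4 = 2 ^+ 2 :> R by ring.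
by rewrite lerXn2r ?nnegrE ?addr_ge0//; lra.
Qed.

(** At a point with [|t| >= 1] the quadratic bound makes the difference quotients
    tend to 0. *)
Lemma bump_derive n t : is_derive t (1 : R) (bump n) (bump n.+1 t).
Proof.
have [t1|t1] := ltP `|t| 1; first exact: bump_derive_in.
rewrite [X in is_derive _ _ _ X]/bump ltNge t1 /=.
have [C C0 hC] := bump_quadratic n.
have bt : bump n t = 0 by rewrite /bump ltNge t1.
have key h : `|h^-1 *: (bump n (h *: (1 : R) + t) - bump n t)| <= C * `|h|.
  have [->|h0] := eqVneq h 0; first by rewrite invr0 scale0r normr0 mulr_ge0.
  rewrite bt subr0 normrZ normfV ler_pdivrMl ?normr_gt0// scaler1.
  have [u1|u1] := ltP `|h + t| 1; last first.
    by rewrite /bump ltNge u1 /= normr0 !mulr_ge0.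
  apply: (le_trans (hC _)); rewrite [leRHS]mulrCA -expr2 ler_wpM2l//.
  rewrite lerXn2r ?nnegrE ?subr_ge0 ?(ltW u1)//.
  have := ler_normB (h + t) h; rewrite addrC addKr; lra.
have lim0 : h^-1 *: (bump n (h *: (1 : R) + t) - bump n t) @[h --> (0:R)^'] --> (0 : R).
  apply/cvgr0Pnorm_le => e e0; near=> h; apply: (le_trans (key h)).
  have : `|h| <= e / (C + 1).
    near: h; apply: (@dnbhs0_le _ R); by rewrite divr_gt0// ltr_wpDl.
  rewrite ler_pdivlMr ?ltr_wpDl// mulrDr mulr1 mulrC => hh.
  by apply: le_trans hh; rewrite lerDl.
split; first by apply/cvg_ex; exists 0.
exact: cvg_lim.
Unshelve. all: by end_near. Qed.

End Bump1D.

Section BumpND.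
Variables (R : realType) (N : nat) (p : 'rV[R]_N) (r : R).
Hypothesis (r0 : 0 < r).
Notation V := ('rV[R]_N).
Implicit Types (x : V) (al : 'I_N -> nat).

Definition bump_factor (i : 'I_N) (n : nat) (t : R) : R :=
  r ^- n * bump n ((t - p ord0 i) / r).

(** The family of these products is closed under partial derivatives, which makes
    smoothness an induction on the order; [al] counts the derivatives. *)
Definition bump_prod al (x : V) : R := \prod_i bump_factor i (al i) (x ord0 i).

Lemma bump_factor_derive i n (t : R) :
  is_derive t (1 : R) (bump_factor i n) (bump_factor i n.+1 t).
Proof.
have rn : r != 0 by rewrite gt_eqF.
have da : is_derive t (1 : R) (fun x : R => (x - p ord0 i) / r) r^-1.
  have -> : (fun x : R => (x - p ord0 i) / r) = r^-1 \*: ((@id R) - cst (p ord0 i)).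
    by apply/funext => x /=; rewrite !fctE mulrC.
  apply: is_derive_eq; by rewrite subr0 /GRing.scale /= mulr1.
have dc := is_derive_comp1 da (bump_derive n _).
have h := is_deriveZ (r ^- n) dc; refine (is_derive_eq h _).
rewrite /bump_factor /GRing.scale /= exprS invfM; ring.
Qed.

Lemma bump_prod_continuous al : continuous (bump_prod al).
Proof.
suff h (l : seq 'I_N) : continuous (fun x : V => \prod_(i <- l) bump_factor i (al i) (x ord0 i)).
  exact: h.
elim: l => [|i l IH] x.
  rewrite (_ : (fun _ => _) = cst 1); first exact: cst_continuous.
  by apply/funext => y; rewrite big_nil.
rewrite (_ : (fun _ => _) = (fun y : V => bump_factor i (al i) (y ord0 i) *
    \prod_(j <- l) bump_factor j (al j) (y ord0 j))); last first.
  by apply/funext => y; rewrite big_cons.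
have c1 : {for x, continuous (fun y : V => bump_factor i (al i) (y ord0 i))}.
  apply: (@continuous_comp _ _ _ (fun y : V => y ord0 i) (bump_factor i (al i))).
    exact: coord_continuous.
  have [d _] := bump_factor_derive i (al i) (x ord0 i).
  exact: differentiable_continuous ((derivable1_diffP _ _).1 d).
exact: (cvgM c1 (IH x)).
Qed.

Definition incr_at (i : 'I_N) al (j : 'I_N) : nat := if j == i then (al j).+1 else al j.

Lemma bump_prod_partial al i x :
  derivable (bump_prod al) x (delta_mx ord0 i) /\
  partial i (bump_prod al) x = bump_prod (incr_at i al) x.
Proof.
set v := delta_mx ord0 i.
pose c := \prod_(j | j != i) bump_factor j (al j) (x ord0 j).
have sp (t : R) : bump_prod al (t *: v + x) = c * bump_factor i (al i) (t + x ord0 i).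
  rewrite /bump_prod (bigD1 i)//= mulrC !mxE !eqxx mulr1; congr (_ * _).
  by apply: eq_bigr => j /negPf ji; rewrite !mxE eqxx ji mulr0 add0r.
have [d1 d2] := is_deriveZ c (bump_factor_derive i (al i) (x ord0 i)).
have e : (fun h : R => h^-1 *: ((bump_prod al \o shift x) (h *: v) - bump_prod al x)) =
   (fun h : R => h^-1 *: (((c \*: bump_factor i (al i)) \o shift (x ord0 i)) (h *: (1 : R)) -
      (c \*: bump_factor i (al i)) (x ord0 i))).
  apply/funext => h /=; rewrite sp scaler1; congr (_ *: (_ - _)).
  by have := sp 0; rewrite scale0r !add0r.
split; first by rewrite /derivable e; exact: d1.
rewrite /partial /derive e -[LHS]/('D_1 (c \*: bump_factor i (al i)) (x ord0 i)) d2.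
rewrite /bump_prod (bigD1 i)//= mulrC /incr_at eqxx; congr (_ * _).
by apply: eq_bigr => j /negPf ->.
Qed.

Lemma bump_prod_class_C k al : class_C k (bump_prod al).
Proof.
elim: k al => [|k IH] al /=; first exact: bump_prod_continuous.
split; first exact: bump_prod_continuous.
move=> i; split=> [x|]; first by have [] := bump_prod_partial al i x.
have -> : partial i (bump_prod al) = bump_prod (incr_at i al).
  by apply/funext => x; have [] := bump_prod_partial al i x.
exact: IH.
Qed.

Lemma closed_cbox : closed (cbox p r).
Proof.
have -> : cbox p r = \bigcap_(i in [set: 'I_N])
    ((fun x : V => `|p ord0 i - x ord0 i|) @^-1` [set t : R | t <= r]).
  by apply/seteqP; split => x /= h i; [move=> _; exact: h|exact: (h i I)].
apply: closed_bigI => i _; apply: closed_comp; last exact: closed_le.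
move=> x _; exact: (cvg_norm (cvgB (cvg_cst (p ord0 i)) (@coord_continuous R 1 N ord0 i x))).
Qed.

Lemma bump_prod_support x : bump_prod (fun=> 0%N) x != 0 -> cbox p r x.
Proof.
move=> /prodf_neq0 h i; have := h i isT; rewrite /bump_factor /bump.
case: ifPn => [+ _|_]; last by rewrite mulr0 eqxx.
by rewrite normrM normfV (gtr0_norm r0) ltr_pdivrMr// mul1r distrC => /ltW.
Qed.

End BumpND.

Lemma compact_cbox (R : realType) (N : nat) (p : 'rV[R]_N) (r : R) :
  compact (cbox p r).
Proof.
rewrite cboxE.
apply: (rV_compact (A := fun i => `[p ord0 i - r, p ord0 i + r]%classic)) => i.
exact: segment_compact.
Qed.

Lemma bump_exists (R : realType) (N : nat) (U : set 'rV[R]_N) (x1 : 'rV[R]_N) :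
  open U -> U x1 ->
  exists f, [/\ C0infty U f, (forall x, 0 <= f x) & 0 < f x1].
Proof.
move=> Uo Ux1.
have [e e0 eU] : exists2 e : R, 0 < e &
    forall y : 'rV[R]_N, (forall i, `|x1 ord0 i - y ord0 i| < e) -> U y.
  by apply: rV_nbhs_sup; move: Uo; rewrite openE; apply.
pose r := e / 2; have r0 : 0 < r by rewrite divr_gt0.
have clo : closure [set x | bump_prod x1 r (fun=> 0%N) x != 0] `<=` cbox x1 r.
  rewrite ((closure_id (cbox x1 r)).1 (@closed_cbox R N x1 r)).
  by apply: closureS => x; exact: bump_prod_support.
exists (bump_prod x1 r (fun=> 0%N)); split; first split.
- by move=> k; exact: bump_prod_class_C.
- apply: (subclosed_compact _ (compact_cbox (p := x1) (r := r)) clo); exact: closed_closure.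
- move=> x /clo h; apply: eU => i; apply: (le_lt_trans (h i)).
  by rewrite /r; lra.
- by move=> x; apply: prodr_ge0 => i _; rewrite mulr_ge0 ?bump_ge0// invr_ge0 exprn_ge0// ltW.
apply: prodr_gt0 => i _; rewrite /bump_factor expr0 invr1 mul1r subrr mul0r.
by apply: bump_gt0; rewrite normr0.
Qed.

(** * The Orlicz-Sobolev space in terms of the energy *)

Section OrliczSpace.
Variables (R : realType) (N : nat) (s : R) (Omega : set 'rV[R]_N) (a : 'I_N -> R -> R).
Notation V := ('rV[R]_N).
Notation leb := (lebesgue_rV R N).
Notation leb2 := (lebesgue_rV R N \x lebesgue_rV R N)%E.
Implicit Types (u v w f : V -> R) (z : V * V).
Hypothesis Omega_open : open Omega.
Hypothesis homeo : forall i, increasing_homeomorphism (phi (a i)).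
Variables (P K p0 : R).
Hypothesis yg : young (Phi_sum a) (phi_sum a) P K p0.
Notation energy := (energy s Omega (Phi_sum a)).
Notation edens := (edens s (Phi_sum a)).

(** Convexity and [Phi (a i) 0 = 0]. *)
Lemma Phi_scale_le i (l t : R) : 0 <= l <= 1 -> 0 <= t -> Phi (a i) (l * t) <= l * Phi (a i) t.
Proof.
move=> /andP[l0 l1] t0; have x0 : 0 <= l * t by rewrite mulr_ge0.
have h1 := Phi_grad_nng (homeo i) x0 t0.
have h2 := Phi_grad_nng (homeo i) x0 (lexx 0).
rewrite Phi_at0 in h2.
have l1' : 0 <= 1 - l by rewrite subr_ge0.
have := lerD (ler_wpM2l l0 h1) (ler_wpM2l l1' h2).
move: (phi _ _) (Phi _ _) (Phi _ _) => x y y'; nra.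
Qed.

Lemma Phi_le_sum i (t : R) : 0 <= t -> Phi (a i) t <= Phi_sum a t.
Proof.
move=> t0; rewrite /Phi_sum (ger0_norm t0) (bigD1 i)//= lerDl.
by apply: sumr_ge0 => j _; exact: Phi_ge0.
Qed.

Lemma measurable_Phi_Ds i u (l : R) : 0 < l -> measurable_fun setT u ->
  measurable_fun (QOmega Omega) (fun z => (Phi (a i) (`|Ds s u z| / l) * mu_density z)%:E).
Proof.
move=> l0 mu; apply: measurable_funTS; apply/measurable_EFinP.
apply: measurable_funM; last exact: measurable_mu_density.
(* Monotone on the whole line, hence measurable. *)
pose g (t : R) := Phi (a i) (Num.max 0 t).
rewrite (_ : (fun _ => _) = g \o (fun z => `|Ds s u z| / l)); last first.
  by apply/funext => z; rewrite /g /= max_r// divr_ge0// ltW.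
apply: measurableT_comp.
  apply: nondecreasing_measurable => // x y xy; apply: Phi_le => //.
    by rewrite le_max lexx.
  by rewrite ge_max !le_max lexx xy orbT.
apply: measurable_funM => //; apply: measurableT_comp => //; exact: measurable_Ds.
Qed.

Lemma seminorm_ge0 b u : (0 <= seminorm s Omega b u)%E.
Proof. by apply: le_ereal_inf_tmp => _ [l [l0 _] <-]; rewrite lee_fin ltW. Qed.

(** A seminorm below [e <= 1] gives a modular at most 1 for some [l < e], and the
    modular at 1 is at most [l] times the modular at [l]. *)
Lemma orlicz_energy u (e : R) : measurable_fun setT u -> 0 < e <= 1 ->
  (orlicz_norm s Omega a u < e%:E)%E -> (energy u <= (N%:R * e)%:E)%E.
Proof.
move=> mu /andP[e0 e1] ue.
have mQ := measurable_QOmega Omega_open.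
have r0 z : 0 <= mu_density z by exact: mu_density_ge0.
have key i : (\int[leb2]_(z in QOmega Omega) (Phi (a i) `|Ds s u z| * mu_density z)%:E <= e%:E)%E.
  have : (seminorm s Omega (a i) u < e%:E)%E.
    apply: le_lt_trans ue; rewrite /orlicz_norm (bigD1 i)//= leeDl// sume_ge0// => j _.
    exact: seminorm_ge0.
  move=> /ereal_inf_lt[_ [l [l0 hl] <-]]; rewrite lte_fin => le.
  apply: (@le_trans _ _ (l%:E * modular s Omega (a i) u l)%E); last first.
    apply: (@le_trans _ _ (l%:E * 1)%E); first by rewrite lee_wpmul2l// lee_fin ltW.
    by rewrite mule1 lee_fin ltW.
  rewrite /modular -ge0_integralZl//; last 3 first.
  - exact: measurable_Phi_Ds.
  - by move=> z _; rewrite lee_fin mulr_ge0// Phi_ge0// divr_ge0// ltW.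
  - by rewrite lee_fin ltW.
  apply: ge0_le_integral => //.
  - by move=> z _; rewrite lee_fin mulr_ge0// Phi_ge0.
  - have := @measurable_Phi_Ds i u 1 ltr01 mu; apply: eq_measurable_fun => z _.
    by rewrite divr1.
  - by apply: measurable_funeM; exact: measurable_Phi_Ds.
  - move=> z _; rewrite -EFinM lee_fin mulrA ler_wpM2r//.
    have e2 : l * (`|Ds s u z| / l) = `|Ds s u z| by rewrite mulrC divfK ?gt_eqF.
    have := @Phi_scale_le i l (`|Ds s u z| / l); rewrite e2; apply.
      by rewrite (ltW l0) /= ltW// (lt_le_trans le).
    by rewrite divr_ge0// ltW.
have -> : energy u = (\sum_(i < N) \int[leb2]_(z in QOmega Omega) (Phi (a i) `|Ds s u z| * mu_density z)%:E)%E.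
  rewrite -ge0_integral_sum//.
  - apply: eq_integral => z _; rewrite /edens /Phi_sum mulr_suml sumEFin//.
  - move=> i; have := @measurable_Phi_Ds i u 1 ltr01 mu; apply: eq_measurable_fun => z _.
    by rewrite divr1.
  - by move=> i z _; rewrite lee_fin mulr_ge0// Phi_ge0.
apply: (@le_trans _ _ (\sum_(i < N) e%:E)%E); first by apply: lee_sum => i _; exact: key.
by rewrite sumEFin lee_fin sumr_const card_ord mulr_natl.
Qed.

(** Dilating by [1 / l] multiplies the energy by a fixed constant, so an energy
    small enough leaves the modulars at [l] at most 1. *)
Lemma energy_orlicz (e : R) : 0 < e -> exists2 d : R, 0 < d &
  forall u, measurable_fun setT u -> (energy u <= d%:E)%E ->
  (orlicz_norm s Omega a u < e%:E)%E.
Proof.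
(* [N * l < e], so it suffices that every seminorm be at most [l]. *)
move=> e0; pose l : R := e / (N.+1)%:R.
have l0 : 0 < l by rewrite divr_gt0.
have [C C0 hC] := young_dilate yg l^-1.
have C1 : 0 < C + 1 by rewrite ltr_wpDl.
exists (C + 1)^-1; first by rewrite invr_gt0.
move=> u mu ue.
have r0 z : 0 <= mu_density z by exact: mu_density_ge0.
have mQ := measurable_QOmega Omega_open.
have sl i : (seminorm s Omega (a i) u <= l%:E)%E.
  apply: ereal_inf_lbound; exists l => //; split => //.
  apply: (@le_trans _ _ (C%:E * energy u)%E).
    rewrite /energy -ge0_integralZl//; last 2 first.
    - exact: (measurable_edensE s yg).
    - by move=> z _; rewrite lee_fin (edens_ge0 _ yg).
    apply: ge0_le_integral => //.
    - by move=> z _; rewrite lee_fin mulr_ge0// Phi_ge0// divr_ge0// ltW.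
    - exact: measurable_Phi_Ds.
    - by apply: measurable_funeM; exact: (measurable_edensE s yg).
    move=> z _; rewrite -EFinM lee_fin /edens mulrA ler_wpM2r//.
    apply: le_trans (hC _); rewrite -(young_abs yg) (normrM l^-1) (normfV l) (gtr0_norm l0) [l^-1 * _]mulrC.
    by apply: Phi_le_sum; rewrite divr_ge0// ltW.
  apply: (@le_trans _ _ (C%:E * ((C + 1)^-1)%:E)%E); first by rewrite lee_wpmul2l.
  by rewrite -EFinM lee_fin ler_pdivrMr// mul1r lerDl.
apply: (@le_lt_trans _ _ (\sum_(i < N) l%:E)%E); first by apply: lee_sum.
rewrite sumEFin lte_fin sumr_const card_ord -mulr_natr /l mulrAC ltr_pdivrMr//.
by rewrite ltr_pM2l// ltr_nat.
Qed.

(** Approximation in norm is approximation in energy; the energy is convenient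
    because it is a single integral. *)
Lemma W0_energy u : W0 s Omega a u <-> admissible Omega u /\
  forall e : R, 0 < e -> exists2 f, C0infty Omega f & (energy (fun x => u x - f x)%R <= e%:E)%E.
Proof.
have mB f : measurable_fun setT u -> C0infty Omega f -> measurable_fun setT (fun x => u x - f x).
  by move=> mu Cf; apply: measurable_funB => //; exact: C0infty_measurable Cf.
split=> [[mu u0 h]|[[mu u0] h]].
  split=> // e e0.
  pose d := Num.min 1 (e / N.+1%:R).
  have d0 : 0 < d by rewrite lt_min ltr01 divr_gt0.
  have [f Cf uf] := h d d0; exists f => //.
  have d1 : 0 < d <= 1 by rewrite d0 /= ge_min lexx.
  apply: (le_trans (orlicz_energy (mB f mu Cf) d1 uf)); rewrite lee_fin.
  apply: (@le_trans _ _ (N.+1%:R * (e / N.+1%:R))); last by rewrite mulrC divfK.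
  by apply: ler_pM => //; rewrite ?(ltW d0)// ?ler_nat// ge_min lexx orbT.
split=> // e e0; have [d d0 hd] := energy_orlicz e0.
have [f Cf uf] := h d d0; exists f => //.
exact: (hd _ (mB f mu Cf) uf).
Qed.

(** Convexity and the control of dilations make the functions of finite energy
    a vector space and convergence in energy linear. *)
Lemma energy_lin (c d : R) : exists2 C, 0 <= C & forall u v, measurable_fun setT u ->
  measurable_fun setT v ->
  (energy (fun x => c * u x + d * v x)%R <= C%:E * energy u + C%:E * energy v)%E.
Proof.
have [C1 C10 h1] := young_dilate yg c; have [C2 C20 h2] := young_dilate yg d.
have K0 := young_K_ge0 yg.
pose C := K / 2 * (C1 + C2).
have C0 : 0 <= C by rewrite !mulr_ge0// ?addr_ge0// invr_ge0.
exists C => // u v mu mv; apply: (energy_comb1 Omega_open yg) => //.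
  by apply: measurable_funD; exact: measurable_funM.
move=> z; rewrite (DsD s (fun x => c * u x) (fun x => d * v x)) !DsZ.
apply: (le_trans (young_add yg _ _)).
have k2 : 0 <= K / 2 by rewrite divr_ge0.
rewrite /C -!(mulrA (K / 2)) -mulrDr ler_wpM2l//.
have pu := young_ge0 yg (Ds s u z); have pv := young_ge0 yg (Ds s v z).
by apply: lerD; [apply: (le_trans (h1 _))|apply: (le_trans (h2 _))]; apply: ler_wpM2r => //; rewrite ?lerDl ?lerDr.
Qed.

End OrliczSpace.

(** * Existence of eigenvalues *)

(** [q] is bounded on the compact closure of [Omega], so the supremum is finite. *)
Lemma q_plus_bound (R : realType) (N : nat) (Omega : set 'rV[R]_N) (q : 'rV[R]_N -> R) x0 :
  bounded_set Omega -> {within closure Omega, continuous q} -> closure Omega x0 ->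
  forall x, closure Omega x -> q x <= fine (q_plus Omega q).
Proof.
move=> Ob cq cx0.
have kc : compact (closure Omega).
  have [L L0 OL] := bounded_cbox Ob.
  apply: (subclosed_compact _ (@compact_cbox R N 0 L)); first exact: closed_closure.
  by rewrite ((closure_id (cbox 0 L)).1 (@closed_cbox R N 0 L)); exact: closureS.
have [M [_ hM]] := compact_bounded (continuous_compact cq kc).
have ub x : closure Omega x -> q x <= `|M| + 1.
  move=> cx; apply: (le_trans (ler_norm _)); apply: (hM (`|M| + 1)); last by exists x.
  by rewrite (le_lt_trans (ler_norm _))// ltrDl.
have up x : closure Omega x -> ((q x)%:E <= q_plus Omega q)%E.
  by move=> cx; apply: ereal_sup_ubound; exists x.
have fin : q_plus Omega q \is a fin_num.
  rewrite fin_numElt; apply/andP; split; first by apply: lt_le_trans (up _ cx0); rewrite ltNyr.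
  apply: (@le_lt_trans _ _ (`|M| + 1)%:E); last by rewrite ltry.
  by apply: ge_ereal_sup => _ [x cx <-]; rewrite lee_fin ub.
by move=> x cx; rewrite -lee_fin fineK// up.
Qed.

(** The infimum is over the closure, so continuity is used to move from a point of
    the closure to an open subset of [Omega]. *)
Lemma local_exponent (R : realType) (N : nat) (Omega : set 'rV[R]_N) (q : 'rV[R]_N -> R) (m : R) :
  open Omega -> {within closure Omega, continuous q} -> (q_minus Omega q < m%:E)%E ->
  exists (q2 : R) (U : set 'rV[R]_N) (x1 : 'rV[R]_N),
    [/\ q2 < m, open U, U `<=` Omega, U x1 & forall x, U x -> q x <= q2].
Proof.
move=> Oo cq /ereal_inf_lt[_ [x0 cx0 <-]]; rewrite lte_fin => qx0.
pose q2 := (q x0 + m) / 2.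
have q02 : q x0 < q2 by rewrite /q2; lra.
have q2m : q2 < m by rewrite /q2; lra.
have near0 : nbhs x0 [set y | closure Omega y -> q y < q2].
  have lim := (subspace_continuousP (closure Omega) q).1 cq x0 cx0.
  exact: (cvgr_lt _ lim).
pose B := [set y | closure Omega y -> q y < q2]^°%classic.
have [x1 [Ox1 Bx1]] := cx0 _ (nbhs_interior near0).
exists q2, (Omega `&` B), x1; split => //.
- by apply: openI => //; exact: open_interior.
- move=> x [Ox /interior_subset Bx]; apply: ltW; apply: Bx; exact: subset_closure.
Qed.

Lemma small_combination (R : realType) (C e : R) (x y : \bar R) : 0 <= C -> 0 < e ->
  (x <= (e / (2 * (C + 1)))%:E)%E -> (y <= (e / (2 * (C + 1)))%:E)%E ->
  (C%:E * x + C%:E * y <= e%:E)%E.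
Proof.
move=> C0 e0; set k := e / _ => xk yk.
have C0E : (0 <= C%:E)%E by rewrite lee_fin.
apply: (le_trans (leeD (lee_wpmul2l C0E xk) (lee_wpmul2l C0E yk))).
rewrite -!EFinM -EFinD lee_fin.
have C1 : 0 < C + 1 by rewrite ltr_wpDl.
have -> : C * k + C * k = e * (C / (C + 1)) by rewrite /k; field; rewrite gt_eqF.
by rewrite ler_piMr ?(ltW e0)// ler_pdivrMr// mul1r lerDl.
Qed.

Theorem theorem3p2 (R : realType) (N : nat) (s : R)
    (Omega : set 'rV[R]_N) (q : 'rV[R]_N -> R) (a : 'I_N -> R -> R)
    (N_ge1 : (1 <= N)%N)
    (s01 : 0 < s < 1)
    (Omega_open : open Omega)
    (Omega_bounded : bounded_set Omega)
    (Omega_lipschitz : lipschitz_boundary Omega)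
    (q_continuous : {within closure Omega, continuous q})
    (q_gt1 : forall x, closure Omega x -> 1 < q x)
    (phi_homeo : forall i, increasing_homeomorphism (phi (a i)))
    (hyp_a : forall i,
       [/\ (1 < phi_minus (a i))%E, (phi_minus (a i) <= phi_plus (a i))%E
         & (phi_plus (a i) < +oo)%E])
    (hyp_b : forall i,
       @convex_function R R^o [set t | 0 <= t] (fun t => Phi (a i) (Num.sqrt t)))
    (hyp_cd : exists j,
       [/\ (\int[lebesgue_measure]_(tau in `]0%R, 1%R])
              (sobolev_integrand N s (a j) tau)%:E < +oo)%E,
           (\int[lebesgue_measure]_(tau in `[1%R, +oo[)
              (sobolev_integrand N s (a j) tau)%:E = +oo)%E
         & forall k : R, 0 < k ->
             (t `^ fine (q_plus Omega q) / Phi_star N s (a j) (k * t))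
               @[t --> +oo] --> (0 : R)])
    (hyp_q : (q_minus Omega q < \big[Order.min/+oo]_(i < N) phi_minus (a i))%E) :
  exists2 lambda_star : R, 0 < lambda_star &
    forall lambda, 0 < lambda < lambda_star -> weak_eigenvalue s Omega a q lambda.
Proof.
have q_minus1 : (1%:E <= q_minus Omega q)%E.
  by apply: le_ereal_inf_tmp => _ [x cx <-]; rewrite lee_fin ltW// q_gt1.
have min_le i : (\big[Order.min/+oo]_(i < N) phi_minus (a i) <= phi_minus (a i))%E.
  by rewrite (bigD1 i)//= ge_min lexx.
set m := (\big[Order.min/+oo]_(i < N) phi_minus (a i))%E in hyp_q min_le.
have mfin : m \is a fin_num.
  rewrite fin_numElt (lt_trans _ hyp_q) ?(lt_le_trans _ q_minus1) ?ltNyr//=.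
  have [_ h1 h2] := hyp_a (Ordinal N_ge1).
  by apply: le_lt_trans h2; apply: le_trans h1.
pose p0 := fine m; have p0E : m = p0%:E by rewrite fineK.
rewrite p0E in hyp_q min_le.
have [q2 [U [x1 [q2p0 Uo UO Ux1 qU]]]] := local_exponent Omega_open q_continuous hyp_q.
have cO x : Omega x -> closure Omega x by exact: subset_closure.
have qle x : Omega x -> q x <= fine (q_plus Omega q).
  move=> Ox; apply: (q_plus_bound Omega_bounded q_continuous (cO _ (UO _ Ux1))); exact: cO.
have qp1 : 1 < fine (q_plus Omega q).
  by apply: lt_le_trans (qle _ (UO _ Ux1)); apply: q_gt1; apply: cO; exact: UO.
have mq : measurable_fun Omega q by exact: within_continuous_measurable_rV.
have q1' x : Omega x -> 1 < q x by move=> /cO; exact: q_gt1.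
have [L L0 OL] := bounded_cbox Omega_bounded.
have s0 : 0 < s by case/andP: s01.
have hmax i : (phi_plus (a i) < +oo)%E by have [] := hyp_a i.
have [P [K yg]] := young_Phi_sum N_ge1 phi_homeo min_le hmax hyp_b.
have growth A : 0 < A -> exists2 T : R, 0 < T & forall r : R, T <= r ->
    A * r `^ ((fine (q_plus Omega q))^-1 + s / N%:R)^-1 <= Phi_sum a r.
  move=> A0; have [j [fin1 infy lim]] := hyp_cd.
  have [T T0 hT] := Phi_growth N_ge1 s0 (phi_homeo j) fin1 infy qp1 (lim 1 ltr01) A0.
  exists T => // r Tr; apply: (le_trans (hT r Tr)).
  by apply: Phi_le_sum => //; apply: ltW; exact: lt_le_trans Tr.
pose W := W0 s Omega a.
have WE u := W0_energy s Omega_open phi_homeo yg u.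
have mC f : C0infty Omega f -> measurable_fun setT f by exact: C0infty_measurable.
have mO := measurable_Omega Omega_open.
have lO : (lebesgue_rV R N Omega < +oo)%E.
  apply: (@le_lt_trans _ _ (lebesgue_rV R N (cbox 0 L))); last by rewrite leb_cbox ?ltry// ltW.
  by apply: le_measure => //; rewrite inE//; exact: measurable_cbox.
have C0fin f : C0infty Omega f -> (energy s Omega (Phi_sum a) f < +oo)%E.
  by move=> Cf; exact: (C0infty_energy s01 Omega_open yg lO Cf).
have E0 u : (0 <= energy s Omega (Phi_sum a) u)%E by exact: (energy_ge0 s Omega yg).
have W_C0 f : C0infty Omega f -> W f.
  move=> Cf; apply/WE; split.
    split; first exact: mC.
    by apply: nearW => x; exact: C0infty_off Cf.
  move=> e e0; exists f => //.
  rewrite (_ : (fun x => f x - f x) = (fun=> 0)); last by apply/funext => x; rewrite subrr.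
  by rewrite (energy0 s Omega yg) lee_fin ltW.
have W_adm u : W u -> admissible Omega u by move=> /WE[].
(* [u = (u - f) + f] for a test function [f] close to [u] in energy. *)
have W_fin u : W u -> (energy s Omega (Phi_sum a) u < +oo)%E.
  move=> /WE[[mu _] /(_ 1 ltr01)[f Cf uf]].
  have [C C0' hC] := energy_lin s Omega_open yg 1 1.
  have muf : measurable_fun setT (fun x => u x - f x) by apply: measurable_funB => //; exact: mC.
  have := hC _ _ muf (mC f Cf).
  rewrite (_ : (fun x => 1 * (u x - f x) + 1 * f x) = u); last first.
    by apply/funext => x; rewrite !mul1r subrK.
  move=> h; apply: (le_lt_trans h); apply: lte_add_pinfty; apply: lte_mul_pinfty => //.
  - by apply: (le_lt_trans uf); rewrite ltry.
  - exact: C0fin.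
have W_comb (c d : R) u v : W u -> W v -> W (fun x => c * u x + d * v x).
  move=> /WE[[mu u0] hu] /WE[[mv v0] hv]; apply/WE; split.
    split; first by apply: measurable_funD; exact: measurable_funM.
    by apply: filterS2 u0 v0 => x hu0 hv0 nx; rewrite hu0// hv0// !mulr0 addr0.
  move=> e e0; have [C C0' hC] := energy_lin s Omega_open yg c d.
  pose k := e / (2 * (C + 1)); have k0 : 0 < k by rewrite divr_gt0// mulr_gt0// ltr_wpDl.
  have [f Cf uf] := hu k k0; have [g Cg vg] := hv k k0.
  exists (fun x => c * f x + d * g x); first exact: C0infty_comb.
  have muf : measurable_fun setT (fun x => u x - f x) by apply: measurable_funB => //; exact: mC.
  have mvg : measurable_fun setT (fun x => v x - g x) by apply: measurable_funB => //; exact: mC.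
  have := hC _ _ muf mvg.
  rewrite (_ : (fun x => c * (u x - f x) + d * (v x - g x)) =
    (fun x => c * u x + d * v x - (c * f x + d * g x))); last by apply/funext => x; ring.
  move=> h; apply: (le_trans h); exact: (small_combination C0' e0 uf vg).
(* [u - f] is the sum of [w n - f] and of [-2] times the half difference of [w n]
   and [u]. *)
have W_closed (w : nat -> 'rV[R]_N -> R) u : (forall k, W (w k)) -> admissible Omega u ->
    (forall e : R, 0 < e -> exists k, (energy s Omega (Phi_sum a) (ediff (w k) u) <= e%:E)%E) -> W u.
  move=> Ww adm hw; apply/WE; split => // e e0.
  have [C C0' hC] := energy_lin s Omega_open yg (- 2) 1.
  pose k := e / (2 * (C + 1)); have k0 : 0 < k by rewrite divr_gt0// mulr_gt0// ltr_wpDl.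
  have [n hn] := hw k k0; have /WE[[mw _] /(_ k k0)[f Cf wf]] := Ww n.
  exists f => //.
  have md : measurable_fun setT (ediff (w n) u) by apply: measurable_ediff => //; exact: adm.1.
  have mwf : measurable_fun setT (fun x => w n x - f x) by apply: measurable_funB => //; exact: mC.
  have := hC _ _ md mwf.
  rewrite (_ : (fun x => _ + _) = (fun x => u x - f x)); last first.
    by apply/funext => x; rewrite /ediff; field.
  move=> h; apply: (le_trans h); exact: (small_combination C0' e0 hn wf).
have W00 : W (fun=> 0).
  have [f [Cf _ _]] := bump_exists Uo Ux1.
  have [Cf' kf sf] := Cf; have CfO : C0infty Omega f by split => // x /sf; exact: UO.
  have := W_comb 0 0 f f (W_C0 f CfO) (W_C0 f CfO).
  by rewrite (_ : (fun x => _) = (fun=> 0))//; apply/funext => x; rewrite !mul0r addr0.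
have [C C0' hC] := weak_solution N_ge1 s01 Omega_open L0 OL yg qp1 growth mq q1' qle
  W_adm W_fin W_comb W_closed W00.
exists C => // lam /andP[lam0 lamC].
have [f [Cf f0 fx1]] := bump_exists Uo Ux1.
have [Cf' kf sf] := Cf; have CfO : C0infty Omega f by split => // x /sf; exact: UO.
have Wf := W_C0 f CfO.
have q20 : 0 < q2 by apply: lt_le_trans (qU _ Ux1); apply: (lt_trans ltr01); apply: q1'; exact: UO.
have q2p : 0 < q2 < p0 by rewrite q20.
have cf : {for x1, continuous f} by exact: (Cf' 0%N).
have Kf0 := Kf_gt0 N_ge1 s01 Omega_open L0 OL yg qp1 growth mq q1' qle (W_adm f Wf) (W_fin f Wf) (UO _ Ux1) cf fx1.
have hqf x : Omega x -> f x != 0 -> q x <= q2.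
  by move=> _ fx; apply: qU; apply: sf; exact: subset_closure.
have [t t0 [et Jt]] := small_multiple N_ge1 s01 Omega_open L0 OL yg qp1 growth mq q1' qle (W_adm f Wf) (W_fin f Wf)
  q2p hqf Kf0 lam0.
have Wt : W (fun x => t * f x).
  have := W_comb t 0 f f Wf Wf.
  by rewrite (_ : (fun x => t * f x + _) = (fun x => t * f x))//; apply/funext => x; rewrite mul0r addr0.
have [u [Wu nu hu]] := hC lam lam0 lamC (ex_intro _ _ (And3 Wt et Jt)).
exists u; split => // v Wv; have [i1 i2 e] := hu v Wv.
have l1 : lhs_integrand s a u v = lint s (phi_sum a) u v.
  by apply/funext => z; rewrite /lhs_integrand /lint /phi_sum !mulr_suml.
by rewrite l1.
Qed.
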